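(* Let $0<n<d$ be integers and let $1\le p<\infty$. (Sufficiency.) Suppose $\mu$ is a Radon measure on $\mathbb{R}^d$ satisfying $\Theta^{n,*}(\mu,x)>0$ and $\Theta^n_*(\mu,x)<\infty$ for $\mu$-a.e. $x\in\mathbb{R}^d$. Assume that for $\mu$-a.e. $x\in\mathbb{R}^d$ there exist some $V_x\in G(d,d-n)$ and $\alpha_x\in(0,1)$ such that $$\mathcal{E}_{\mu,p}(x,V_x,\alpha_x,1)<\infty .$$ Then $\mu$ is $n$-rectifiable. (Necessity.) Conversely, if $\mu$ is an $n$-rectifiable Radon measure on $\mathbb{R}^d$, then for $\mu$-a.e. $x\in\mathbb{R}^d$ there exists $V_x\in G(d,d-n)$ such that for all $\alpha\in(0,1)$ $$\mathcal{E}_{\mu,p}(x,V_x,\alpha,1)<\infty .$$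
   Context: $G(d,m)$ is the Grassmannian of $m$-dimensional linear subspaces of $\mathbb{R}^d$; $B(x,r)$ is the open ball. For $V\in G(d,m)$, $x\in\mathbb{R}^d$, $\alpha\in(0,1)$, $r>0$, $$K(x,V,\alpha)=\{y\in\mathbb{R}^d:\operatorname{dist}(y,V+x)<\alpha|x-y|\},\qquad K(x,V,\alpha,r)=K(x,V,\alpha)\cap B(x,r).$$ For a Radon measure $\mu$, the lower and upper densities are $\Theta^n_*(\mu,x)=\liminf_{r\to0}\mu(B(x,r))/r^n$ and $\Theta^{n,*}(\mu,x)=\limsup_{r\to0}\mu(B(x,r))/r^n$. For $V\in G(d,d-n)$, $\alpha\in(0,1)$, $1\le p<\infty$, $R>0$, the conical energy is $$\mathcal{E}_{\mu,p}(x,V,\alpha,R)=\int_0^R\Big(\frac{\mu(K(x,V,\alpha,r))}{r^n}\Big)^p\,\frac{dr}{r}.$$ A measurable set $E\subset\mathbb{R}^d$ is $n$-rectifiable if there are countably many Lipschitz maps $f_i:\mathbb{R}^n\to\mathbb{R}^d$ with $\mathcal{H}^n(E\setminus\bigcup_i f_i(\mathbb{R}^n))=0$, where $\mathcal{H}^n$ is $n$-dimensional Hausdorff measure. A Radon measure $\mu$ is $n$-rectifiable if $\mu\ll\mathcal{H}^n$ and there exists an $n$-rectifiable set $E\subset\mathbb{R}^d$ with $\mu(\mathbb{R}^d\setminus E)=0$. *)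

(* Defs.v *)
From HB Require Import structures.
From mathcomp Require Import all_boot all_order all_algebra.
From mathcomp Require Import all_classical all_reals all_analysis.
Import Order.TTheory GRing.Theory Num.Theory.
Import numFieldNormedType.Exports.

Set Implicit Arguments.
Unset Strict Implicit.
Unset Printing Implicit Defensive.

Local Open Scope classical_set_scope.
Local Open Scope ring_scope.

(* The norm [`|x|] of 'rV[R]_d is the sup norm. It has the same open and
   compact sets as the Euclidean norm, so its topology is used as is, but
   balls, cones and diameters are Euclidean. *)
Notation borel_rV R d := (g_sigma_algebraType (@open 'rV[R]_d)).

Section euclidean.
Variables (R : realType) (d : nat).
Implicit Types (x y : 'rV[R]_d) (A : set 'rV[R]_d).

Definition enorm x : R := Num.sqrt (\sum_i x ord0 i ^+ 2).

Definition eball x (r : R) : set 'rV[R]_d := [set y | enorm (x - y) < r].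

(* Only used with A nonempty ([inf set0] is 0). *)
Definition edistance y A : R := inf [set enorm (y - a) | a in A].

(* The point 0 is adjoined so that the empty set has diameter 0 rather than
   [ereal_sup set0 = -oo]; other sets are unaffected. *)
Definition ediam A : \bar R :=
  ereal_sup (0%E |` [set (enorm (p.1 - p.2))%:E | p in A `*` A]).

Definition grassmannian (m : nat) : set {vspace 'rV[R]_d} :=
  [set V | \dim V = m].

Definition cone x (V : {vspace 'rV[R]_d}) (alpha : R) : set 'rV[R]_d :=
  [set y | edistance y [set v + x | v in [set` V]] < alpha * enorm (x - y)].

Definition tcone x V alpha (r : R) : set 'rV[R]_d :=
  cone x V alpha `&` eball x r.

End euclidean.

Section hausdorff.
Variables (R : realType) (d : nat).
Implicit Types (A : set 'rV[R]_d).
Local Open Scope ereal_scope.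

(* For n > 0. No normalising constant: the measure only enters through its
   null sets. *)
Definition hausdorff_content (n : nat) (delta : R) A : \bar R :=
  ereal_inf [set \sum_(0 <= i <oo) ediam (F i) ^+ n |
    F in [set F : nat -> set 'rV[R]_d |
      A `<=` \bigcup_i F i /\ forall i, ediam (F i) <= delta%:E]].

Definition hausdorff_measure (n : nat) : set (borel_rV R d) -> \bar R :=
  fun A => ereal_sup [set hausdorff_content n delta A |
                       delta in [set delta : R | (0 < delta)%R]].

End hausdorff.

Section measures.
Variables (R : realType) (d : nat).
Implicit Types (mu : {measure set (borel_rV R d) -> \bar R}).
Local Open Scope ereal_scope.

Definition radon mu : Prop :=
  [/\ forall K : set 'rV[R]_d, compact K -> mu K < +oo,
      forall U : set 'rV[R]_d, open U ->
        mu U = ereal_sup [set mu K |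
                 K in [set K : set 'rV[R]_d | compact K /\ K `<=` U]] &
      forall A : set (borel_rV R d), measurable A ->
        mu A = ereal_inf [set mu U |
                 U in [set U : set 'rV[R]_d | open U /\ A `<=` U]]].

Definition lower_density (n : nat) mu (x : 'rV[R]_d) : \bar R :=
  limf_einf (fun r : R => mu (eball x r) * ((r ^+ n)^-1)%:E) (0%R^'+).

Definition upper_density (n : nat) mu (x : 'rV[R]_d) : \bar R :=
  limf_esup (fun r : R => mu (eball x r) * ((r ^+ n)^-1)%:E) (0%R^'+).

Definition conical_energy (n : nat) mu (p : R) (x : 'rV[R]_d)
    (V : {vspace 'rV[R]_d}) (alpha rmax : R) : \bar R :=
  \int[lebesgue_measure]_(r in `]0%R, rmax[%classic)
    ((mu (tcone x V alpha r) * ((r ^+ n)^-1)%:E) `^ p * (r^-1)%:E).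

Definition lipschitz_map (n : nat) (f : 'rV[R]_n -> 'rV[R]_d) : Prop :=
  exists L : R, forall x y, (enorm (f x - f y) <= L * enorm (x - y))%R.

Definition rectifiable_set (n : nat) (E : set (borel_rV R d)) : Prop :=
  measurable E /\
  exists f : nat -> 'rV[R]_n -> 'rV[R]_d,
    (forall i, lipschitz_map (f i)) /\
    hausdorff_measure n (E `\` \bigcup_i range (f i)) = 0.

Definition rectifiable_measure (n : nat) mu : Prop :=
  mu `<< @hausdorff_measure R d n /\
  exists E, rectifiable_set n E /\ mu (~` E) = 0.

End measures.

(* Main.v *)
Require Import Defs.
From HB Require Import structures.
From mathcomp Require Import all_boot all_order all_algebra.
From mathcomp Require Import all_classical all_reals all_analysis.
From mathcomp Require Import measurable_realfun ring lra.
Import Order.TTheory GRing.Theory Num.Theory.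
Import numFieldNormedType.Exports.

(** The two halves have independent proofs. Throughout, planes of codimension [n]
    are kernels of matrices [L^T], so that rational matrices provide countably many
    planes, and sets of zero Hausdorff measure are handled as sets of zero content
    [content_zero]. The covering tool is Vitali's lemma for balls of the sup norm,
    [vitali_covering], and null sets are recognised by [proportion_negligible].

    Sufficiency. A finite energy at [x] makes the density of the cone around [x]
    tend to 0 ([energy_density]), while the density of full balls does not. Consider
    a small set [A] whose points all have cones of very small density. If [x] in [A]
    sees a point of [A] in its narrow cone, choose such a point [y] almost as far as
    possible: the points of [A] lying over a small ball of the base of radius
    comparable to [|x - y|] are all in the cones of [x] or of [y], so they have very
    small measure. Summing over a Vitali covering of the base shows that the points
    of this kind are a small fraction of a ball of positive density
    ([wide_part_small]), and by a density argument the measure lives on countably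
    many sets no point of which sees another in its cone ([graph_covering]). These
    are subsets of Lipschitz graphs ([graph_lipschitz]); a set of zero content
    inside such a graph projects to a null set, and bounded lower densities transfer
    this to the measure ([graph_content_negligible]), whence absolute continuity.

    Necessity. The measure lives on the images of Lipschitz maps [f]. By Rademacher's
    theorem ([rademacher], proved here from the one-dimensional case, Fubini's
    theorem and the negligibility of porous sets) and a theorem of Sard type
    ([degenerate_content_zero]) almost every point is [f a] with a derivative of full
    rank at [a]; its plane is the orthogonal complement of the tangent plane. Cut the
    domain into pieces on which [f] is nearly affine. If [y] is in the cone at [f a],
    then [y] is as far from the image of the piece as from [f a], up to a constant
    ([cone_gap]). So for fixed [y] at distance [rho] from the image, the dyadic sum
    of [2 ^ (k n)] over the scales at which [y] is in the truncated cone of [f a] is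
    at most a multiple of [rho ^ - n], and is nonzero only for [a] in a set of
    measure at most a multiple of [rho ^ n]. Integrating in [y] and exchanging the
    integrals, the dyadic sums of the measures of the cones of [f a] are integrable
    in [a], hence finite almost everywhere ([piece_finite]). Since the upper density
    is finite almost everywhere ([upper_bound_ae]), these sums control the energy
    for every exponent [p] ([energy_finite]). *)

Set Implicit Arguments.
Unset Strict Implicit.
Unset Printing Implicit Defensive.

Local Open Scope classical_set_scope.
Local Open Scope ring_scope.

(** * Euclidean norm and matrices *)
Section euclid.
Variables (R : realType) (d : nat).
Implicit Types (x y z u v w : 'rV[R]_d).

Definition dotp x y : R := \sum_i x ord0 i * y ord0 i.

Lemma dotpC x y : dotp x y = dotp y x.
Proof. by apply: eq_bigr => i _; rewrite mulrC. Qed.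

Lemma dotpDl x y z : dotp (x + y) z = dotp x z + dotp y z.
Proof. by rewrite -big_split; apply: eq_bigr => i _; rewrite !mxE mulrDl. Qed.

Lemma dotpZl a x y : dotp (a *: x) y = a * dotp x y.
Proof. by rewrite mulr_sumr; apply: eq_bigr => i _; rewrite !mxE mulrA. Qed.

Lemma dotpDr x y z : dotp z (x + y) = dotp z x + dotp z y.
Proof. by rewrite dotpC dotpDl !(dotpC z). Qed.

Lemma dotpZr a x y : dotp x (a *: y) = a * dotp x y.
Proof. by rewrite dotpC dotpZl dotpC. Qed.

Lemma dotp_ge0 x : 0 <= dotp x x.
Proof. by apply: sumr_ge0 => i _; rewrite -expr2 sqr_ge0. Qed.

Lemma enormE x : enorm x = Num.sqrt (dotp x x).
Proof. by rewrite /enorm /dotp; under [in RHS]eq_bigr do rewrite -expr2. Qed.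

Lemma enorm_ge0 x : 0 <= enorm x. Proof. exact: sqrtr_ge0. Qed.
Hint Resolve enorm_ge0 : core.

Lemma enorm_sqr x : enorm x ^+ 2 = dotp x x.
Proof. by rewrite enormE sqr_sqrtr ?dotp_ge0. Qed.

Lemma enorm0 : enorm (0 : 'rV[R]_d) = 0.
Proof. by rewrite /enorm big1 ?sqrtr0// => i _; rewrite mxE expr0n. Qed.

Lemma enormZ a x : enorm (a *: x) = `|a| * enorm x.
Proof. by rewrite !enormE dotpZl dotpZr mulrA -expr2 sqrtrM ?sqr_ge0// sqrtr_sqr. Qed.

Lemma enormN x : enorm (- x) = enorm x.
Proof. by rewrite -scaleN1r enormZ normrN1 mul1r. Qed.

Lemma enormBC x y : enorm (x - y) = enorm (y - x).
Proof. by rewrite -opprB enormN. Qed.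

Lemma coord_le_enorm x i : `|x ord0 i| <= enorm x.
Proof.
rewrite -sqrtr_sqr /enorm ler_sqrt ?sumr_ge0// => [|? _]; last exact: sqr_ge0.
by rewrite (bigD1 i)//= lerDl sumr_ge0// => ? _; exact: sqr_ge0.
Qed.

Lemma enorm_eq0 x : enorm x = 0 -> x = 0.
Proof.
move=> x0; apply/rowP => i; rewrite mxE; apply/eqP.
by rewrite -normr_le0 -x0; exact: coord_le_enorm.
Qed.

Lemma dotp_le x y : dotp x y <= enorm x * enorm y.
Proof.
have [->|y0] := eqVneq y 0.
  rewrite enorm0 mulr0 /dotp big1// => i _; by rewrite mxE mulr0.
have ey : 0 < enorm y.
  by rewrite lt_neqAle enorm_ge0 eq_sym andbT; apply: contra_neq y0; exact: enorm_eq0.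
have := dotp_ge0 (enorm y ^+ 2 *: x - dotp x y *: y).
rewrite -scaleNr dotpDl !dotpDr !dotpZl !dotpZr -!enorm_sqr (dotpC y x).
set a := enorm x; set b := enorm y; set c := dotp x y => h.
have b2 : 0 < b ^+ 2 by rewrite exprn_gt0.
have {}h : c ^+ 2 <= (a * b) ^+ 2.
  rewrite -(ler_pM2l b2) -subr_ge0.
  by apply: (le_trans h); rewrite le_eqVlt; apply/orP; left; apply/eqP; ring.
rewrite (le_trans (ler_norm c))// -(@ler_pXn2r _ 2) ?nnegrE ?mulr_ge0 ?enorm_ge0//.
by rewrite real_normK ?num_real.
Qed.

Lemma enormD x y : enorm (x + y) <= enorm x + enorm y.
Proof.
rewrite -(@ler_pXn2r _ 2) ?nnegrE ?addr_ge0 ?enorm_ge0//.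
rewrite sqrrD !enorm_sqr dotpDl !dotpDr (dotpC y x).
have := dotp_le x y; lra.
Qed.

Lemma enorm_dist z x y : enorm (x - y) <= enorm (x - z) + enorm (z - y).
Proof. by rewrite (_ : x - y = (x - z) + (z - y)) ?enormD// addrA subrK. Qed.

Lemma enorm_lerB x y : enorm x - enorm y <= enorm (x - y).
Proof. by rewrite lerBlDr -{1}(subrK y x) enormD. Qed.

(** Pythagoras; used to see that a point near the normal direction is no closer
    to the tangent plane than to its centre. *)
Lemma enorm_orth u v : dotp u v = 0 -> enorm u <= enorm (u - v).
Proof.
move=> uv; rewrite -(@ler_pXn2r _ 2) ?nnegrE ?enorm_ge0//.
rewrite !enorm_sqr -scaleN1r dotpDl !dotpDr !dotpZl !dotpZr (dotpC v u) uv.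
have := dotp_ge0 v; lra.
Qed.

Lemma enorm_le_sum x : enorm x <= \sum_i `|x ord0 i|.
Proof.
rewrite -(@ler_pXn2r _ 2) ?nnegrE ?enorm_ge0 ?sumr_ge0//.
rewrite enorm_sqr expr2 mulr_sumr; apply: ler_sum => i _.
rewrite (bigD1 i)//= mulrDl -expr2 -real_normK ?num_real// -expr2 lerDl.
by rewrite mulr_ge0// sumr_ge0.
Qed.

Lemma coord_le_norm m n (A : 'M[R]_(m, n)) i j : `|A i j| <= `|A|.
Proof.
rewrite [leRHS]/Num.norm/= mx_normrE; apply/bigmax_geP; right => /=.
by exists (i, j).
Qed.

Lemma norm_le_coord m n (A : 'M[R]_(m, n)) c : 0 <= c ->
  (forall i j, `|A i j| <= c) -> `|A| <= c.
Proof.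
move=> c0 Ac; rewrite [leLHS]/Num.norm/= mx_normrE; apply/bigmax_leP; split => //.
Qed.

Lemma norm_le_enorm x : `|x| <= enorm x.
Proof. by apply: norm_le_coord => // i j; rewrite ord1 coord_le_enorm. Qed.

Lemma enorm_le_norm x : enorm x <= d%:R * `|x|.
Proof.
apply: (le_trans (enorm_le_sum x)).
apply: (@le_trans _ _ (\sum_(i < d) `|x|)).
  by apply: ler_sum => i _; exact: coord_le_norm.
by rewrite sumr_const card_ord mulr_natl.
Qed.

End euclid.
#[global] Hint Extern 0 (is_true (0 <= enorm _)) => (exact: enorm_ge0) : core.

Section matrix_bounds.
Variable (R : realType).

(** A crude bound for the operator norm, in both directions of transposition. *)
Definition mxsum n d (A : 'M[R]_(n, d)) : R := \sum_i \sum_j `|A i j|.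

Lemma mxsum_ge0 n d (A : 'M[R]_(n, d)) : 0 <= mxsum A.
Proof. by apply: sumr_ge0 => i _; apply: sumr_ge0. Qed.

Lemma enorm_mulmx n d (v : 'rV[R]_n) (A : 'M[R]_(n, d)) :
  enorm (v *m A) <= mxsum A * enorm v.
Proof.
apply: (le_trans (enorm_le_sum _)).
rewrite /mxsum exchange_big/= mulr_suml; apply: ler_sum => j _.
rewrite mxE (le_trans (ler_norm_sum _ _ _))// mulr_suml.
by apply: ler_sum => i _; rewrite normrM mulrC ler_wpM2l// coord_le_enorm.
Qed.

(** A right inverse of [A] is bounded. *)
Lemma row_free_lower n d (A : 'M[R]_(n, d)) : row_free A ->
  exists2 c, 0 < c & forall v, c * enorm v <= enorm (v *m A).
Proof.
move=> /row_freeP[B AB]; have B0 := mxsum_ge0 B.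
exists (mxsum B + 1)^-1; first by rewrite invr_gt0; lra.
move=> v; rewrite mulrC ler_pdivrMr; last lra.
rewrite -[in leLHS](mulmx1 v) -AB mulmxA (le_trans (enorm_mulmx _ _))//.
by rewrite mulrDr mulr1 [enorm _ * _]mulrC lerDl enorm_ge0.
Qed.

Lemma lower_row_free n d (A : 'M[R]_(n, d)) c : 0 < c ->
  (forall v : 'rV_n, c * enorm v <= enorm (v *m A)) -> row_free A.
Proof.
move=> c0 h; apply/row_freeP; apply/row_freeP.
rewrite -kermx_eq0; apply/eqP/row_matrixP => i; rewrite row0.
apply: enorm_eq0; apply/eqP; rewrite eq_le enorm_ge0 andbT -(ler_pM2l c0) mulr0.
by rewrite (le_trans (h _))// -row_mul mulmx_ker row0 enorm0.
Qed.

(** Every real matrix is a limit of rational matrices; the countable family of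
    matrices with entries in [k^-1 Z] is used to reduce arguments depending on
    a plane to countably many planes. *)
Definition ratmx n d (k : nat) (M : 'M[int]_(n, d)) : 'M[R]_(n, d) :=
  \matrix_(i, j) ((M i j)%:~R / k.+1%:R).

Lemma ratmx_approx n d (A : 'M[R]_(n, d)) e : 0 < e ->
  exists k (M : 'M[int]_(n, d)), mxsum (A - ratmx k M) <= e.
Proof.
move=> e0.
set s : R := \sum_(i < n) \sum_(j < d) 1.
have s0 : 0 <= s by apply: sumr_ge0 => ? _; apply: sumr_ge0.
pose k := `|Num.ceil (s / e)|%N.
exists k, (\matrix_(i, j) Num.floor (A i j * k.+1%:R)).
have kp : 0 < k.+1%:R :> R by [].
have ke : s / e <= k.+1%:R.
  apply: (le_trans (ceil_ge _)).
  rewrite -natr1 (@le_trans _ _ k%:R) ?lerDl//.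
  by rewrite /k natr_absz ler_int ler_norm.
have se : s / k.+1%:R <= e.
  by rewrite ler_pdivrMr// mulrC -ler_pdivrMr.
apply: le_trans se; rewrite /mxsum /s !mulr_suml; apply: ler_sum => i _.
apply: ler_sum => j _; rewrite !mxE mul1r.
rewrite -{1}[A i j](@mulfK _ k.+1%:R)// -mulrBl normrM normfV.
rewrite (ger0_norm (ltW kp)) ler_pdivrMr// mulVf//.
set t := A i j * _; have := floor_le t; have := floorD1_gt t.
rewrite intrD ler_norml; lra.
Qed.

End matrix_bounds.

(** * Balls and Vitali's covering lemma *)
Section balls.
Variables (R : realType) (d : nat).
Implicit Types (x y z : 'rV[R]_d) (r : R).

Lemma ball_rV x r : ball x r = [set y | `|x - y| < r].
Proof. by rewrite mx_norm_ball. Qed.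

Lemma ball_rV0 x r : r <= 0 -> ball x r = set0.
Proof.
move=> r0; rewrite ball_rV -subset0 => y /= /lt_le_trans /(_ r0).
by rewrite ltNge normr_ge0.
Qed.

(** Balls with centres in [ratmx] form a countable base. *)
Definition base_ball (c : nat * 'rV[int]_d * nat) : set 'rV[R]_d :=
  ball (ratmx R c.1.1 c.1.2) (c.2.+1%:R^-1).

Lemma exists_invS_lt (e : R) : 0 < e -> exists k : nat, k.+1%:R^-1 < e.
Proof.
move=> e0; have [k] := ltr_add_invr e0.
by rewrite add0r; exists k.
Qed.

Lemma ratmx_dense x (e : R) : 0 < e -> exists k M, `|x - ratmx R k M| < e.
Proof.
move=> e0; have [k [M h]] := ratmx_approx x (divr_gt0 e0 (ltr0Sn R 1)).
exists k, M; rewrite (@le_lt_trans _ _ (e / 2)) ?gtr_pMr ?invf_lt1 ?ltr1n//.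
apply: (le_trans _ h); apply: norm_le_coord; first exact: mxsum_ge0.
move=> i j; rewrite /mxsum (bigD1 i)//= (bigD1 j)//= -addrA lerDl.
by rewrite addr_ge0// sumr_ge0// => *; rewrite sumr_ge0.
Qed.

Lemma base_ballP (U : set 'rV[R]_d) x : open U -> U x ->
  exists c, base_ball c x /\ base_ball c `<=` U.
Proof.
move=> oU Ux; have : nbhs x U by rewrite nbhsE; exists U.
rewrite -nbhs_ballE => -[e /= e0 xeU].
have [j je] := exists_invS_lt (divr_gt0 e0 (ltr0Sn R 1)).
have j0 : 0 < j.+1%:R^-1 :> R by [].
have [k [M kM]] := ratmx_dense x j0.
exists (k, M, j); rewrite /base_ball !ball_rV /=; split; first by rewrite distrC.
move=> y /= yB; apply: xeU; rewrite ball_rV/=.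
rewrite (le_lt_trans (ler_distD (ratmx R k M) _ _))//.
rewrite (lt_trans (ltrD kM yB))// (lt_le_trans (ltrD je je))//; lra.
Qed.

Lemma measurable_open_rV (U : set (borel_rV R d)) :
  open (U : set 'rV[R]_d) -> measurable U.
Proof. by move=> oU; apply: sub_gen_smallest. Qed.

Lemma measurable_closed_rV (U : set (borel_rV R d)) :
  closed (U : set 'rV[R]_d) -> measurable U.
Proof.
move=> cU; rewrite -[U]setCK; apply: measurableC; apply: measurable_open_rV.
exact: closed_openC.
Qed.

Lemma lip_open (phi : 'rV[R]_d -> R) K c :
  (forall x y, phi x - phi y <= K * `|x - y|) -> open [set x | c < phi x].
Proof.
move=> hphi; rewrite openE => x /= cx.
have K0 : 0 < `|K| + 1 by rewrite ltr_wpDl.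
pose e := (phi x - c) / (`|K| + 1).
have e0 : 0 < e by rewrite divr_gt0// subr_gt0.
rewrite /interior -nbhs_ballE; exists e => //= y; rewrite ball_rV/= => xy.
have : phi x - phi y < phi x - c.
  apply: (le_lt_trans (hphi x y)); apply: (@le_lt_trans _ _ ((`|K| + 1) * `|x - y|)).
    by rewrite ler_wpM2r//; have := ler_norm K; lra.
  by move: xy; rewrite ltr_pdivlMr// mulrC.
lra.
Qed.

Lemma lip_closed (phi : 'rV[R]_d -> R) K c :
  (forall x y, phi x - phi y <= K * `|x - y|) -> closed [set x | phi x <= c].
Proof.
move=> hphi; rewrite (_ : mkset _ = ~` [set x | c < phi x]).
  exact: open_closedC (lip_open hphi).
by apply/seteqP; split => x /=; rewrite leNgt => /negP.
Qed.

End balls.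

(** An open set of a product is a countable union of rectangles of base sets;
    this puts it in the product sigma-algebra. *)
Lemma measurable_prod_base d1 d2 (T1 : measurableType d1) (T2 : measurableType d2)
    (I1 I2 : countType) (B1 : I1 -> set T1) (B2 : I2 -> set T2) (O : set (T1 * T2)) :
  (forall i, measurable (B1 i)) -> (forall i, measurable (B2 i)) ->
  (forall x y, O (x, y) -> exists i j, [/\ B1 i x, B2 j y & B1 i `*` B2 j `<=` O]) ->
  measurable O.
Proof.
move=> m1 m2 h.
rewrite (_ : O = \bigcup_(c in [set c : I1 * I2 | B1 c.1 `*` B2 c.2 `<=` O])
                   (B1 c.1 `*` B2 c.2)); last first.
  apply/seteqP; split => [[x y] Oxy|z [c cO]]; last exact: cO.
  by have [i [j [ix jy ij]]] := h _ _ Oxy; exists (i, j).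
rewrite bigcup_mkcond; apply: countable_bigcupT_measurable => [|c].
  exact: countableP.
by case: ifPn => _ //; exact: measurableX.
Qed.

Section greedy.

(** Greedy selection along a well-founded order: keep an index when it is not
    in conflict with any earlier kept index. *)
Lemma greedy_selection (I : Type) (lt : I -> I -> Prop) (conf : I -> I -> Prop) :
  well_founded lt ->
  exists D : I -> Prop, forall i, D i <-> forall j, lt j i -> D j -> ~ conf j i.
Proof.
move=> wf.
pose F (i : I) (rec : forall j, lt j i -> Prop) : Prop :=
  forall j (h : lt j i), rec j h -> ~ conf j i.
exists (Fix wf (fun=> Prop) F) => i.
rewrite Fix_eq//= => x f g fg; congr (F x _).
by apply: functional_extensionality_dep => y; apply: functional_extensionality_dep.
Qed.

End greedy.

Section vitali.
Variables (R : realType) (d : nat).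
Implicit Types (x y z : 'rV[R]_d).

(** Indices for the greedy choice of balls: a dyadic scale of the radius, and the
    number of a lattice point near the centre. Smaller codes have larger radii. *)
Definition code : Type := nat * nat.
Definition code_lt (a b : code) : Prop :=
  (a.1 < b.1)%N \/ a.1 = b.1 /\ (a.2 < b.2)%N.

Lemma code_lt_wf : well_founded code_lt.
Proof.
suff h : forall n m, Acc code_lt (n, m) by case.
elim/ltn_ind => n IHn; elim/ltn_ind => m IHm; constructor => -[a b] [/=|/=[->]].
  by move=> /IHn.
exact: IHm.
Qed.

Lemma code_lt_total a b : a <> b -> code_lt a b \/ code_lt b a.
Proof.
case: a b => [a1 a2] [b1 b2] ab; rewrite /code_lt/=.
have [?|?|e1] := ltngtP a1 b1; [by left; left|by right; left|].
have [?|?|e2] := ltngtP a2 b2; [by left; right|by right; right|].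
by case: ab; rewrite e1 e2.
Qed.

Lemma scaleP (rmax r : R) : 0 < r -> r <= rmax ->
  exists k : nat, rmax / 2 ^+ k.+1 < r <= rmax / 2 ^+ k.
Proof.
move=> r0 rm.
have rm0 : 0 < rmax by rewrite (lt_le_trans r0).
have ex : exists k : nat, rmax / 2 ^+ k.+1 < r.
  have [k hk] := exists_invS_lt (divr_gt0 r0 rm0); exists k.
  rewrite ltr_pdivrMr ?exprn_gt0//; move: hk.
  rewrite ltr_pdivlMr// mulrC ltr_pdivrMr// => /lt_le_trans; apply.
  rewrite ler_pM2l//; move: (ltn_expl k.+1 (isT : 1 < 2)%N).
  by rewrite -natrX ler_nat; exact: ltnW.
case: (ex_minnP ex) => k hk kmin; exists k; rewrite hk/=.
case: k hk kmin => [|k] hk kmin; first by rewrite expr0 divr1.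
rewrite leNgt; apply/negP => h.
by have := kmin _ h; rewrite ltnn.
Qed.

(** Vitali's covering lemma. Balls with the same code have comparable radii and
    nearby centres, so that one representative per code suffices; a representative
    that is not selected meets a selected one of at least half its radius. The
    entries of radius 0 (empty balls) are placeholders. *)
Lemma vitali_covering (P : set 'rV[R]_d) (r : 'rV[R]_d -> R) (rmax : R) :
  (forall x, P x -> 0 < r x <= rmax) ->
  exists (c : nat -> 'rV[R]_d) (s : nat -> R),
  [/\ forall i, s i = 0 \/ (P (c i) /\ s i = r (c i)),
      trivIset setT (fun i => ball (c i) (s i)) &
      P `<=` \bigcup_i ball (c i) (5 * s i)].
Proof.
move=> rP.
pose Q (a : code) x := [/\ P x, rmax / 2 ^+ a.1.+1 < r x <= rmax / 2 ^+ a.1 &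
  exists c, unpickle a.2 = Some c /\
    `|x - ratmx R c.1 c.2| < rmax / 2 ^+ a.1.+2].
have Qex x : P x -> exists a, Q a x.
  move=> Px; have /andP[r0 rm] := rP _ Px.
  have [k hk] := scaleP r0 rm.
  have e0 : 0 < rmax / 2 ^+ k.+2 by rewrite divr_gt0 ?exprn_gt0// (lt_le_trans r0).
  have [q [M qM]] := ratmx_dense x e0.
  exists (k, pickle (q, M)); split => //; exists (q, M); split => //.
  by rewrite pickleK.
pose pt a : 'rV[R]_d := get (Q a).
pose conf a b := Q a (pt a) /\ Q b (pt b) /\
  ball (pt a) (r (pt a)) `&` ball (pt b) (r (pt b)) !=set0.
have [D DP] := greedy_selection conf code_lt_wf.
pose ok a := D a /\ Q a (pt a).
pose dec (i : nat) : code := odflt (0%N, 0%N) (pickle_inv i).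
pose good i := pickle_inv i <> None :> option code /\ ok (dec i).
exists (fun i => pt (dec i)), (fun i => if `[< good i >] then r (pt (dec i)) else 0).
split.
- move=> i; case: ifPn => [/asboolP[_ [_ [? _ _]]]|_]; [by right|by left].
- apply/trivIsetP => i j _ _ ij.
  case: ifPn => [/asboolP gi|_]; last by rewrite ball_rV0// set0I.
  case: ifPn => [/asboolP gj|_]; last by rewrite [X in _ `&` X]ball_rV0// setI0.
  have dij : dec i <> dec j.
    move: gi gj => [ui _] [uj _]; rewrite /dec.
    have := @pickle_invK code i; have := @pickle_invK code j.
    case: (pickle_inv i) ui => [a|]// _; case: (pickle_inv j) uj => [b|]// _ /=.
    by move=> bj ai ab; move: ij; rewrite -ai -bj ab eqxx.
  have nconf a b : ok a -> ok b -> code_lt a b ->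
      ball (pt a) (r (pt a)) `&` ball (pt b) (r (pt b)) = set0.
    move=> [Da Qa] [Db Qb] ab; have /DP /(_ _ ab Da) h := Db.
    by apply: contrapT => /eqP/set0P n0; apply: h; split.
  have [ok1 ok2] := (gi.2, gj.2).
  have [lt|lt] := code_lt_total dij; first exact: nconf.
  by rewrite setIC; exact: nconf.
- move=> x Px; have [a Qax] := Qex _ Px.
  have Qap : Q a (pt a) by apply: getPex; exists x.
  (* the point representing the code of [x] is at distance less than its radius *)
  have [_ /andP[_ rx] [c [uc xc]]] := Qax.
  have [Pp /andP[lp rp] [c' [uc' pc]]] := Qap.
  move: uc'; rewrite uc => -[ec]; subst c'.
  have xp : `|x - pt a| < r (pt a).
    rewrite (le_lt_trans (ler_distD (ratmx R c.1 c.2) _ _))//.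
    rewrite [X in _ + X]distrC; apply: lt_trans lp.
    rewrite (_ : rmax / 2 ^+ a.1.+1 = rmax / 2 ^+ a.1.+2 + rmax / 2 ^+ a.1.+2).
      exact: ltrD.
    rewrite [2 ^+ a.1.+2]exprS; field.
    by rewrite expf_neq0.
  have [b [okb rb [z [zb za]]]] : exists b, [/\ ok b, r (pt a) <= 2 * r (pt b) &
      ball (pt b) (r (pt b)) `&` ball (pt a) (r (pt a)) !=set0].
    have r0 : 0 < r (pt a) by have /andP[] := rP _ Pp.
    have [Da|nDa] := pselect (D a).
      exists a; split => //; first lra.
      by exists (pt a); split; rewrite ball_rV/= subrr normr0.
    have : ~ (forall j, code_lt j a -> D j -> ~ conf j a).
      by move=> h; apply: nDa; apply/DP.
    move=> /existsNP[b /not_implyP[ba /not_implyP[Db /contrapT[Qb [_ n0]]]]].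
    exists b; split => //.
    have [_ /andP[rb _] _] := Qb.
    have k_le : (b.1 <= a.1)%N by case: ba => [/ltnW//|[->]].
    have h : rmax / 2 ^+ a.1 <= rmax / 2 ^+ b.1.
      rewrite ler_pM2l ?(lt_le_trans r0)//; last by have /andP[] := rP _ Pp.
      by rewrite lef_pV2 ?posrE ?exprn_gt0// ler_weXn2l// ler1n.
    rewrite (le_trans rp)// (le_trans h)//.
    rewrite (_ : rmax / 2 ^+ b.1 = 2 * (rmax / 2 ^+ b.1.+1)).
      by rewrite ler_pM2l// ltW.
    by rewrite exprS; field; rewrite expf_neq0.
  exists (pickle b) => //; rewrite /dec pickleK_inv/=.
  have -> : `[< good (pickle b) >] by apply/asboolP; split; rewrite /dec pickleK_inv.
  move: zb za; rewrite !ball_rV/= => zb za.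
  rewrite (le_lt_trans (ler_distD z _ _))// (le_lt_trans (lerD (lexx _) (ler_distD (pt a) _ _)))//.
  rewrite [X in _ + (X + _)]distrC [X in _ + (_ + X)]distrC.
  lra.
Qed.

End vitali.

(** * Outer measures and regularity *)
Section outer_regularity.
Variables (R : realType) (d : nat).
Implicit Types (m : {measure set (borel_rV R d) -> \bar R}) (A P U : set 'rV[R]_d).
Local Open Scope ereal_scope.

Definition outer_regular m := forall A : set (borel_rV R d), measurable A -> m A < +oo ->
  forall e : R, (0 < e)%R -> exists U : set 'rV[R]_d, [/\ open U, A `<=` U & m U <= m A + e%:E].

Definition locally_finite m := forall N : R, m (ball (0%R : 'rV[R]_d) N) < +oo.

Lemma measure_lt_small d0 (T : measurableType d0) (m : {measure set T -> \bar R})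
    (F : (set T)^nat) (e : R) : (forall i, measurable (F i)) ->
  (forall n p, (n <= p)%N -> F p `<=` F n) -> m (F 0%N) < +oo -> \bigcap_n F n = set0 ->
  (0 < e)%R -> exists n, m (F n) <= e%:E.
Proof.
move=> mF ndF F0 capF e0.
have : m \o F @ \oo --> m (\bigcap_n F n).
  apply: nonincreasing_cvg_mu => //; first by rewrite capF; exact: measurable0.
  by move=> n p np; apply/subsetPset; exact: ndF.
rewrite capF measure0 => /fine_cvgP[/= fF] /cvgrPdist_le /(_ _ e0) h.
have [n _ hn] : \forall n \near \oo, (`|0 - fine (m (F n))| <= e)%R /\ m (F n) \is a fin_num.
  near=> n; split; last by near: n.
  by near: n.
exists n; have [] := hn n (leqnn n).
rewrite sub0r normrN => h1 h2; rewrite -(fineK h2) lee_fin.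
by rewrite (le_trans (ler_norm _)).
Unshelve. all: by end_near. Qed.

Lemma geo_split (e : R) : (0 < e)%R ->
  exists g : nat -> R, (forall i, (0 < g i)%R) /\ \sum_(0 <= i <oo) (g i)%:E <= e%:E.
Proof.
move=> e0; exists (fun i => (e / (2 ^ i.+1)%:R)%R); split.
  by move=> i; rewrite divr_gt0// ltr0n expn_gt0.
have := @epsilon_trick R (fun=> 0) e xpredT (fun=> lexx 0) (ltW e0).
under eq_eseriesr do rewrite add0e.
by move=> h; rewrite (le_trans h)// eseries0// ?add0e//; move=> *; exact: add0e.
Qed.

Let approx m (A : set (borel_rV R d)) := forall e : R, (0 < e)%R ->
  exists U F : set 'rV[R]_d, [/\ open U, closed F, F `<=` A, A `<=` U & m (U `\` F) <= e%:E].

Let mD (U F : set 'rV[R]_d) : open U -> closed F -> measurable (U `\` F : set (borel_rV R d)).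
Proof.
by move=> oU cF; apply: measurableD; [exact: measurable_open_rV|exact: measurable_closed_rV].
Qed.

Let approx_closed m (F : set 'rV[R]_d) : m setT < +oo -> closed F -> approx m F.
Proof.
move=> mfin cF e e0.
pose U n : set 'rV[R]_d := \bigcup_(x in F) ball x (n.+1%:R^-1).
have oU n : open (U n) by apply: bigcup_open => x _; exact: ball_open.
have FU n : F `<=` U n.
  by move=> x Fx; exists x => //; apply: ballxx; rewrite invr_gt0.
have [n hn] : exists n, m (U n `\` F) <= e%:E.
  apply: measure_lt_small => //.
  - by move=> i; exact: mD.
  - move=> n p np x [[y Fy yx] nFx]; split => //; exists y => //.
    by apply: le_ball yx; rewrite lef_pV2 ?posrE// ler_nat.
  - by apply: le_lt_trans mfin; apply: le_measure; rewrite ?inE//; exact: mD.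
  - rewrite -subset0 => x hx; have [_ nFx] := hx 0%N Logic.I; apply: nFx.
    rewrite ((closure_id F).1 cF) => B; rewrite -nbhs_ballE => -[r /= r0 rB].
    have [n nr] := exists_invS_lt r0.
    have [[y Fy yx] _] := hx n Logic.I; exists y; split => //; apply: rB.
    by apply: le_ball (ball_sym yx); exact: ltW.
by exists (U n), F; split => //; exact: subset_refl.
Qed.

Let approxC m A : approx m A -> approx m (~` A).
Proof.
move=> aA e e0; have [U [F [oU cF FA AU h]]] := aA e e0.
exists (~` F), (~` U); split => //; [exact: closed_openC|exact: open_closedC|
  exact: subsetC|exact: subsetC|].
by rewrite setDE setCK setIC -setDE.
Qed.

Let approx_bigcup m (A : nat -> set (borel_rV R d)) : m setT < +oo ->
  (forall i, approx m (A i)) -> approx m (\bigcup_i A i).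
Proof.
move=> mfin aA e e0.
have e20 : (0 < e / 2)%R by lra.
have [g [g0 sg]] := geo_split e20.
have /choice[UF hUF] : forall i, exists UF : set 'rV[R]_d * set 'rV[R]_d,
    [/\ open UF.1, closed UF.2, UF.2 `<=` A i, A i `<=` UF.1 & m (UF.1 `\` UF.2) <= (g i)%:E].
  by move=> i; have [U [F h]] := aA i _ (g0 i); exists (U, F).
pose U := \bigcup_i (UF i).1; pose F := \bigcup_i (UF i).2.
pose Fn n := \bigcup_(i in `I_n) (UF i).2.
have oU : open U by apply: bigcup_open => i _; have [] := hUF i.
have cFn n : closed (Fn n).
  by rewrite /Fn bigcup_mkord; apply: closed_bigsetU => i _; have [] := hUF i.
have mU : measurable (U : set (borel_rV R d)) by exact: measurable_open_rV.
have mF : measurable (F : set (borel_rV R d)).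
  by apply: bigcupT_measurable => i; apply: measurable_closed_rV; have [] := hUF i.
have FnF n : Fn n `<=` F.
  by move=> x [i /= _ hx]; exists i.
have mUF : m (U `\` F) <= (e / 2)%:E.
  apply: le_trans sg; apply: (@le_trans _ _ (\sum_(0 <= i <oo) m ((UF i).1 `\` (UF i).2))).
    apply: measure_sigma_subadditive.
    - by move=> i; have [oi ci _ _ _] := hUF i; exact: mD.
    - exact: measurableD.
    - move=> x [[i _ Ui] nF]; exists i => //; split => // Fi; apply: nF; by exists i.
  by apply: lee_nneseries => // i _; have [] := hUF i.
have [n hn] : exists n, m (F `\` Fn n) <= (e / 2)%:E.
  apply: measure_lt_small => //.
  - by move=> i; apply: measurableD => //; exact: measurable_closed_rV.
  - move=> n p np x [Fx nFp]; split => // Fnx; apply: nFp.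
    move: Fnx => [i /= ni ?]; exists i => //=; exact: leq_trans np.
  - apply: le_lt_trans mfin; apply: le_measure; rewrite ?inE//.
    by apply: measurableD => //; exact: measurable_closed_rV.
  - rewrite -subset0 => x hx; have [[i _ Fi] _] := hx 0%N Logic.I.
    have [_] := hx i.+1 Logic.I; apply.
    by exists i => /=.
exists U, (Fn n); split => //.
- by apply: (subset_trans (FnF n)); apply: subset_bigcup => i _; have [] := hUF i.
- by apply: subset_bigcup => i _; have [] := hUF i.
rewrite (_ : U `\` Fn n = (U `\` F) `|` (F `\` Fn n)); last first.
  apply/seteqP; split => [x [Ux nx]|x [[Ux nF]|[Fx nx]]].
  - by have [Fx|nF] := pselect (F x); [right|left].
  - by split => // /FnF.
  - split => //; have [i _ Fi] := Fx; exists i => //.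
    by have [_ _ h1 h2 _] := hUF i; exact/h2/h1.
have mFn : measurable (F `\` Fn n : set (borel_rV R d)).
  by apply: measurableD => //; exact: measurable_closed_rV.
rewrite (le_trans (measureU2 _ _ _))//; first exact: measurableD.
by rewrite (le_trans (leeD mUF hn))// -EFinD lee_fin; lra.
Qed.

(** The sets that open sets approximate from outside and closed sets from inside
    form a sigma-algebra, which contains the closed sets. *)
Lemma finite_measure_approx m (A : set (borel_rV R d)) : m setT < +oo ->
  measurable A -> forall e : R, (0 < e)%R ->
  exists U : set 'rV[R]_d, [/\ open U, A `<=` U & m (U `\` A) <= e%:E].
Proof.
move=> mfin mA.
suff h : approx m A.
  move=> e /h[U [F [oU cF FA AU he]]]; exists U; split => //.
  apply: le_trans he; apply: le_measure; rewrite ?inE.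
  - by apply: measurableD => //; exact: measurable_open_rV.
  - exact: mD.
  - exact: setDS.
move: A mA; apply: smallest_sub => [|U oU].
  split.
  - by apply: approx_closed => //; exact: closed0.
  - by move=> A /= aA; rewrite setTD; exact: approxC.
  - by move=> F /= aF; exact: approx_bigcup.
rewrite -[U]setCK; apply: approxC; apply: approx_closed => //.
exact: open_closedC.
Qed.

(** The balls [B N] reduce the claim to finite measures, with errors [g N]. *)
Lemma locally_finite_outer_regular m : locally_finite m -> outer_regular m.
Proof.
move=> lf A mA Afin e e0.
pose B (N : nat) : set (borel_rV R d) := ball (0%R : 'rV[R]_d) N%:R.
have mB N : measurable (B N) by apply: measurable_open_rV; exact: ball_open.
have [g [g0 sg]] := geo_split e0.
have /choice[U hU] : forall N, exists U : set 'rV[R]_d,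
    [/\ open U, A `&` B N `<=` U, U `<=` B N & m (U `\` A) <= (g N)%:E].
  move=> N.
  have fin : mfrestr (mB N) (lf N%:R) setT < +oo.
    by rewrite /mfrestr/= /mrestr setTI; exact: lf.
  have [U [oU AU h]] := finite_measure_approx fin mA (g0 N).
  exists (U `&` B N); split.
  - by apply: openI => //; exact: ball_open.
  - by move=> x [Ax Bx]; split => //; exact: AU.
  - by move=> x [].
  - by move: h; rewrite /mfrestr/= /mrestr/= !setDE setIAC.
exists (\bigcup_N U N); split.
- by apply: bigcup_open => i _; have [] := hU i.
- move=> x Ax; pose N := Num.bound `|x|; exists N => //.
  have [_ AU _ _] := hU N; apply: AU; split => //.
  rewrite /B ball_rV/= sub0r normrN.
  by rewrite (lt_le_trans (archi_boundP _)).
have mUi i : measurable (U i : set (borel_rV R d)).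
  by apply: measurable_open_rV; have [] := hU i.
have mUU : measurable (\bigcup_N U N : set (borel_rV R d)) by exact: bigcupT_measurable.
apply: (@le_trans _ _ (m A + m (\bigcup_N U N `\` A))).
  apply: (@le_trans _ _ (m (A `|` (\bigcup_N U N `\` A)))).
    apply: le_measure; rewrite ?inE//; first by apply: measurableU => //; exact: measurableD.
    by move=> x Ux; have [?|?] := pselect (A x); [left|right].
  by apply: measureU2 => //; exact: measurableD.
apply: leeD => //; apply: le_trans sg.
apply: (@le_trans _ _ (\sum_(0 <= i <oo) m (U i `\` A))).
  apply: measure_sigma_subadditive.
  - by move=> i; apply: measurableD.
  - exact: measurableD.
  - by rewrite setD_bigcupl.
by apply: lee_nneseries => // i _; have [] := hU i.
Qed.

Lemma mu_ext_cover m P (e : R) : (m^*)%mu P < +oo -> (0 < e)%R ->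
  exists A : set (borel_rV R d), [/\ measurable A, P `<=` A & m A <= (m^*)%mu P + e%:E].
Proof.
move=> Pfin e0.
have Pf : (m^*)%mu P \is a fin_num by rewrite ge0_fin_numE// mu_ext_ge0.
have [_ [F [mF PF] <-] h] := lb_ereal_inf_adherent e0 Pf.
exists (\bigcup_i F i); split => //; first exact: bigcupT_measurable.
apply: le_trans (ltW h); apply: measure_sigma_subadditive => //.
exact: bigcupT_measurable.
Qed.

Lemma mu_ext_open m P (e : R) : outer_regular m -> (m^*)%mu P < +oo -> (0 < e)%R ->
  exists U : set 'rV[R]_d, [/\ open U, P `<=` U & m U <= (m^*)%mu P + e%:E].
Proof.
move=> rm Pfin e0; have e20 : (0 < e / 2)%R by lra.
have [A [mA PA hA]] := mu_ext_cover Pfin e20.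
have Afin : m A < +oo by rewrite (le_lt_trans hA)// lte_add_pinfty// ltry.
have [U [oU AU hU]] := rm A mA Afin _ e20.
exists U; split => //; first exact: subset_trans AU.
rewrite (le_trans hU)// (le_trans (leeD hA (lexx _)))// -addeA -EFinD.
by rewrite leeD2l// lee_fin; lra.
Qed.

Lemma mu_ext0_negligible m P : (m^*)%mu P = 0 -> m.-negligible P.
Proof.
move=> P0.
have /choice[A hA] : forall k : nat, exists A : set (borel_rV R d),
    [/\ measurable A, P `<=` A & m A <= (k.+1%:R^-1)%:E].
  move=> k; have k0 : (0 < k.+1%:R^-1 :> R)%R by rewrite invr_gt0.
  have fin : (m^*)%mu P < +oo by rewrite P0.
  have [A [mA PA h]] := mu_ext_cover fin k0.
  by exists A; split => //; rewrite (le_trans h)// P0 add0e.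
have mA : measurable (\bigcap_k A k).
  by apply: bigcapT_measurable => k; have [] := hA k.
exists (\bigcap_k A k); split => //; last by move=> x Px k _; have [_ + _] := hA k; exact.
apply/eqP; rewrite eq_le measure_ge0 andbT; apply/lee_addgt0Pr => e e0.
have [k ke] := exists_invS_lt e0; rewrite add0e.
have [mk _ h] := hA k.
apply: (@le_trans _ _ (m (A k))); last by rewrite (le_trans h)// lee_fin ltW.
by apply: le_measure; rewrite ?inE//; exact: bigcap_inf.
Qed.

Lemma negligible_mu_ext0 m P : m.-negligible P -> (m^*)%mu P = 0.
Proof.
move=> [A [mA A0 PA]]; apply/eqP; rewrite eq_le; apply/andP; split; last exact: mu_ext_ge0.
rewrite -A0.
by rewrite -(measurable_mu_extE m mA) le_mu_ext.
Qed.

(** Regularity provides neighbourhoods of almost the same measure as [P], which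
    leaves no room for losing a fixed proportion. In the covering arguments below
    this plays the part of Lebesgue's density theorem. *)
Lemma proportion_negligible m P (q : R) : outer_regular m -> (m^*)%mu P < +oo ->
  (0 <= q < 1)%R ->
  (forall U : set 'rV[R]_d, open U -> P `<=` U -> (m^*)%mu P <= q%:E * m U) ->
  m.-negligible P.
Proof.
move=> rm Pfin /andP[q0 q1] h; apply: mu_ext0_negligible.
have Pf : (m^*)%mu P \is a fin_num by rewrite ge0_fin_numE// mu_ext_ge0.
apply/eqP; rewrite eq_le; apply/andP; split; last exact: mu_ext_ge0.
apply/lee_addgt0Pr => e e0; rewrite add0e.
have eq0 : (0 < e * (1 - q))%R by rewrite mulr_gt0// subr_gt0.
have [U [oU PU hU]] := mu_ext_open rm Pfin eq0.
have {}h := h U oU PU; move: hU h; rewrite -(fineK Pf).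
set p := fine _ => hU h.
have : p%:E <= q%:E * (p%:E + (e * (1 - q))%:E).
  by rewrite (le_trans h)// lee_wpmul2l// lee_fin.
rewrite -EFinD -EFinM !lee_fin => {}h.
have q10 : (0 < 1 - q)%R by rewrite subr_gt0.
rewrite -(ler_pM2r q10); apply: (@le_trans _ _ (q * (e * (1 - q)))%R); first lra.
by rewrite ler_piMl ?ltW.
Qed.

Lemma negligible_bounded m P :
  (forall N : R, m.-negligible (P `&` ball (0%R : 'rV[R]_d) N)) -> m.-negligible P.
Proof.
move=> h; apply: (negligibleS _ (negligible_bigcup (fun k : nat => h k%:R))).
move=> x Px; exists (Num.bound `|x|) => //; split => //; rewrite ball_rV/= sub0r normrN.
by rewrite (lt_le_trans (archi_boundP _)).
Qed.

Lemma mu_ext_bounded m P (N : R) : locally_finite m ->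
  P `<=` ball (0%R : 'rV[R]_d) N -> (m^*)%mu P < +oo.
Proof.
move=> lf PN; apply: (le_lt_trans _ (lf N)).
rewrite -(measurable_mu_extE m) ?le_mu_ext//.
by apply: measurable_open_rV; exact: ball_open.
Qed.

End outer_regularity.

Lemma radon_locally_finite (R : realType) (d : nat)
    (mu : {measure set (borel_rV R d) -> \bar R}) : (0 < d)%N -> radon mu -> locally_finite mu.
Proof.
case: d mu => // d mu _ [cK _ _] N.
apply: (@le_lt_trans _ _ (mu (closed_ball (0 : 'rV[R]_d.+1) (`|N| + 1)))).
  apply: le_measure; rewrite ?inE.
  - by apply: measurable_open_rV; exact: ball_open.
  - by apply: measurable_closed_rV; exact: closed_ball_closed.
  - apply: (subset_trans _ (@subset_closed_ball _ _ _ _)); apply: le_ball.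
    by rewrite (le_trans (ler_norm _))// lerDl.
apply: cK; apply: bounded_closed_compact; last exact: closed_ball_closed.
have N1 : 0 < `|N| + 1 by rewrite ltr_wpDl.
rewrite closed_ballE//; exists (`|N| + 1); split; first exact: num_real.
by move=> M hM x; rewrite /closed_ball_/= sub0r normrN => /le_trans; apply; exact: ltW.
Qed.

(** * Lebesgue measure on the rows *)

(** A copy of [m] that carries its sigma-finiteness as a structure, to serve as a
    factor of a product measure. *)
Definition sf_measure d (T : measurableType d) (R : realType)
  (m : {measure set T -> \bar R}) & sigma_finite setT m : set T -> \bar R := m.

Section sf_measure.
Context d (T : measurableType d) (R : realType) (m : {measure set T -> \bar R}).
Hypothesis sf : sigma_finite setT m.

HB.instance Definition _ := Measure.on (sf_measure sf).
HB.instance Definition _ := Measure_isSigmaFinite.Build d T R (sf_measure sf) sf.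

End sf_measure.

Section push.
Context d d' (T : measurableType d) (T' : measurableType d') (R : realType).
Variables (m : {measure set T -> \bar R}) (f : T -> T').
Hypothesis mf : measurable_fun setT f.

Lemma pushforward_exists : exists m' : {measure set T' -> \bar R},
  forall A, m' A = m (f @^-1` A).
Proof.
by exists (measure_function_pushforward__canonical__measure_function_Measure m mf).
Qed.
End push.

Section lebesgue_rV.
Variable R : realType.

Definition rowcons n (z : measurableTypeR R * borel_rV R n) : borel_rV R n.+1 :=
  (\row_(j < n.+1) if unlift 0 j is Some k then (z.2 : 'rV[R]_n) 0 k else (z.1 : R)).

Lemma rowcons0 n (t : R) (v : 'rV[R]_n) : (rowcons (t, v) : 'rV[R]_n.+1) 0 0 = t.
Proof. by rewrite mxE unlift_none. Qed.

Lemma rowconsS n (t : R) (v : 'rV[R]_n) k :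
  (rowcons (t, v) : 'rV[R]_n.+1) 0 (lift 0 k) = v 0 k.
Proof. by rewrite mxE liftK. Qed.

Lemma rowcons_ball n (x : 'rV[R]_n.+1) (r : R) : 0 < r ->
  (@rowcons n) @^-1` (ball x r) =
  ball (x 0 0) r `*` ball (\row_j x 0 (lift 0 j)) r.
Proof.
move=> r0; apply/seteqP; split => [[t v] [_ /= h]|[t v] [/= ht [_ hv]]].
- split => /=; last (split => // i j); first by have := h 0 0; rewrite rowcons0.
  by have := h 0 (lift 0 j); rewrite rowconsS ord1 mxE.
- split => //= i j; rewrite ord1 {i}; case: (unliftP 0 j) => [k ->|->].
    by rewrite rowconsS; have := hv 0 k; rewrite mxE.
  by rewrite rowcons0.
Qed.

Lemma rat_base (t e : R) : 0 < e -> exists (q : rat) (j : nat),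
  ball (ratr q : R) (j.+1%:R^-1) t /\ ball (ratr q : R) (j.+1%:R^-1) `<=` ball t e.
Proof.
move=> e0; have [j je] := exists_invS_lt (divr_gt0 e0 (ltr0Sn R 1)).
have j0 : 0 < j.+1%:R^-1 :> R by rewrite invr_gt0.
move: j0 je; set s0 := j.+1%:R^-1 => j0 je.
have ts : t - s0 < t + s0 by lra.
have [q] := rat_in_itvoo ts.
rewrite in_itv/= => /andP[q1 q2]; exists q, j; rewrite -/s0; split.
  by rewrite /ball/= ltr_distl; apply/andP; split; lra.
by move=> s; rewrite /ball/= !ltr_distl => /andP[s1 s2]; apply/andP; split; lra.
Qed.

Lemma measurable_rowcons n : measurable_fun setT (@rowcons n).
Proof.
refine (@measurability _ _ _ (borel_rV R n.+1) _ _ (@open 'rV[R]_(n.+1)) _ _); first by [].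
move=> _ [W oW <-].
rewrite setTI.
apply: (@measurable_prod_base _ _ (measurableTypeR R) (borel_rV R n) (rat * nat)%type _
  (fun c => ball (ratr c.1 : R) (c.2.+1%:R^-1)) (@base_ball R n)) => //.
- by move=> c; exact: measurable_ball.
- by move=> c; apply: measurable_open_rV; exact: ball_open.
move=> t v Otv; have : nbhs (rowcons (t, v) : 'rV[R]_n.+1) W by rewrite nbhsE; exists W.
rewrite -nbhs_ballE => -[e /= e0 hO].
have [q [j [h1 h2]]] := rat_base t e0.
have [c [h3 h4]] := base_ballP (ball_open (v : 'rV[R]_n) e) (ballxx (v : 'rV[R]_n) e0).
exists (q, j), c; split => // -[s w] [/= /h2 hs /h4 hw].
apply: hO; have := @rowcons_ball n (rowcons (t, v)) e e0.
move=> /seteqP[_]; apply; split => /=.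
  by rewrite rowcons0.
by move: hw; congr (ball _ _ _); apply/rowP => k; rewrite mxE rowconsS.
Qed.

Lemma rowcons_shift0 n (t : R) (v : 'rV[R]_n) :
  rowcons (t, v) = rowcons (0, v) + t *: delta_mx 0 0 :> 'rV[R]_n.+1.
Proof.
apply/rowP => j; case: (unliftP 0 j) => [k ->|->].
  by rewrite rowconsS !mxE liftK/= mulr0 addr0.
by rewrite rowcons0 !mxE unlift_none eqxx/= mulr1 add0r.
Qed.

Lemma rowcons_shiftS n (t s : R) (v : 'rV[R]_n) (i : 'I_n) :
  rowcons (t, v + s *: delta_mx 0 i) = rowcons (t, v) + s *: delta_mx 0 (lift 0 i) :> 'rV[R]_n.+1.
Proof.
apply/rowP => j; case: (unliftP 0 j) => [k ->|->].
  by rewrite rowconsS !mxE liftK/= (inj_eq (@lift_inj _ 0)).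
by rewrite rowcons0 !mxE unlift_none /= mulr0 addr0.
Qed.

(** Iterated products of the Lebesgue measure of the line. Covering arguments only
    use the measure of balls, which are cubes for the sup norm; the second clause,
    the null-set part of Fubini's theorem in every coordinate direction, follows
    from the two orders of integration. *)
Lemma lebesgue_rV_exists n : exists m : {measure set (borel_rV R n) -> \bar R},
  (forall x r, 0 < r -> m (ball x r) = ((2 * r) ^+ n)%:E) /\
  (forall (i : 'I_n) (A : set (borel_rV R n)), measurable A ->
     (forall x : 'rV[R]_n,
       (@lebesgue_measure R).-negligible [set t | A (x + t *: delta_mx 0 i)]) ->
     m A = 0%E).
Proof.
elim: n => [|n [m [mB mS]]].
  exists (dirac (0 : borel_rV R 0)); split => [x r r0|[]//].
  rewrite expr0 /= /dirac indicE mem_set// ball_rV/=.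
  by rewrite (_ : x - 0 = 0) ?normr0//; apply/rowP => -[].
have sfm : sigma_finite setT m.
  exists (fun k : nat => ball (0 : 'rV[R]_n) k.+1%:R).
    apply/seteqP; split => // x _; exists (Num.bound `|x : 'rV[R]_n|) => //.
    rewrite ball_rV/= sub0r normrN (lt_le_trans (archi_boundP _))//.
    by rewrite ler_nat.
  move=> k; split; first by apply: measurable_open_rV; exact: ball_open.
  by rewrite mB// ltry.
pose l : {sigma_finite_measure set (borel_rV R n) -> \bar R} := sf_measure sfm.
pose L : {sigma_finite_measure set (measurableTypeR R) -> \bar R} := lebesgue_measure.
have [m' m'E] := pushforward_exists (L \x l)%E (@measurable_rowcons n).
exists m'; split => [x r r0|i A mA hA]; rewrite m'E.
  rewrite rowcons_ball//.
  pose B1 : set (measurableTypeR R) := ball (x 0 0) r.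
  pose B2 : set (borel_rV R n) := ball (\row_j x 0 (lift 0 j)) r.
  transitivity (L B1 * l B2)%E; rewrite /B1 /B2.
    apply: product_measure1E; first exact: measurable_ball.
    by apply: measurable_open_rV; exact: ball_open.
  rewrite /L /l /= /sf_measure mB// (lebesgue_measure_ball _ (ltW r0)) -EFinM.
  by rewrite exprS mulr_natl.
have mB' : measurable ((@rowcons n) @^-1` A).
  by rewrite -[X in measurable X]setTI; exact: measurable_rowcons.
have [j ij|i0] := unliftP 0 i; last first.
  transitivity ((L \x^ l)%E ((@rowcons n) @^-1` A)).
    apply: (product_measure_unique (m1 := L) (m2 := l)) => //.
    by move=> *; exact: product_measure2E.
  rewrite /= /product_measure2 integral0_eq// => v _.
  apply: measure_negligible; first exact: measurable_ysection.
  apply: negligibleS (hA (rowcons (0, v))) => t /=; rewrite i0 -rowcons_shift0 => h.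
  by move/ysectionP: h.
rewrite /= /product_measure1 integral0_eq// => t _.
apply: (mS j); first exact: measurable_xsection.
move=> v; apply: negligibleS (hA (rowcons (t, v))) => s /=.
by rewrite ij -rowcons_shiftS => /xsectionP.
Qed.

End lebesgue_rV.

(** * Vitali families, content and porosity *)
Section covering.
Variables (R : realType) (d : nat).
Implicit Types (P U : set 'rV[R]_d).

(** Admissible radii exist at all scales, hence so small that the balls stay
    inside [U]. *)
Lemma vitali_open P U (Q : 'rV[R]_d -> R -> Prop) (rmax : R) : open U -> P `<=` U ->
  0 < rmax ->
  (forall x, P x -> forall e, 0 < e -> exists r, 0 < r < e /\ Q x r) ->
  exists (c : nat -> 'rV[R]_d) (s : nat -> R),
  [/\ forall i, s i = 0 \/ [/\ P (c i), 0 < s i < rmax & Q (c i) (s i)],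
      trivIset setT (fun i => ball (c i) (s i)),
      \bigcup_i ball (c i) (s i) `<=` U &
      P `<=` \bigcup_i ball (c i) (5 * s i)].
Proof.
move=> oU PU r0 hQ.
have /choice[rad hrad] : forall x, exists r, P x ->
    [/\ 0 < r < rmax, Q x r & ball x r `<=` U].
  move=> x; have [Px|nPx] := pselect (P x); last by exists 0.
  have : nbhs x U by rewrite nbhsE; exists U => //; split => //; exact: PU.
  rewrite -nbhs_ballE => -[e /= e0 xeU].
  have me0 : 0 < Num.min e rmax by rewrite lt_min e0.
  have [r [/andP[r1 r2] Qr]] := hQ x Px _ me0.
  move: r2; rewrite lt_min => /andP[re rr].
  exists r => _; split => //; first by rewrite r1.
  by apply: subset_trans xeU; apply: le_ball; exact: ltW.
have [c [s [hs tr cov]]] := @vitali_covering R d P rad rmax (fun x Px => let: And3 h _ _ := hrad x Px in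
   ltac:(case/andP: h => -> /ltW ->; reflexivity)).
exists c, s; split => //.
- move=> i; have [|[Pc ->]] := hs i; [by left|right].
  by have [h1 h2 _] := hrad _ Pc.
- move=> x [i _]; have [->|[Pc ->]] := hs i; first by rewrite ball_rV0.
  by have [_ _] := hrad _ Pc; apply.
Qed.

End covering.

Section packing.
Variables (R : realType) (n : nat) (lam : {measure set (borel_rV R n) -> \bar R}).
Hypothesis n0 : (0 < n)%N.
Hypothesis lamB : forall x r, 0 < r -> lam (ball x r) = ((2 * r) ^+ n)%:E.

Lemma lamB0 (x : 'rV[R]_n) r : 0 <= r -> lam (ball x r) = ((2 * r) ^+ n)%:E.
Proof.
rewrite le_eqVlt => /predU1P[<-|]; last exact: lamB.
by rewrite ball_rV0// measure0 mulr0 expr0n gtn_eqF.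
Qed.

Lemma lam_locally_finite : locally_finite lam.
Proof.
move=> N; have [N0|N0] := leP N 0; first by rewrite ball_rV0// measure0 ltry.
by rewrite lamB// ltry.
Qed.

Lemma lam_outer_regular : outer_regular lam.
Proof. exact: locally_finite_outer_regular lam_locally_finite. Qed.

(** Volume comparison; the finite sums stay in the field [R]. *)
Lemma packing (c : nat -> 'rV[R]_n) (s : nat -> R) (U : set 'rV[R]_n) (M : R) :
  (forall i, 0 <= s i) -> trivIset setT (fun i => ball (c i) (s i)) -> open U ->
  \bigcup_i ball (c i) (s i) `<=` U -> (lam U <= M%:E)%E ->
  forall N, \sum_(i < N) (2 * s i) ^+ n <= M.
Proof.
move=> s0 tr oU cU lU N; rewrite -lee_fin (le_trans _ lU)//.
pose B i : set (borel_rV R n) := ball (c i) (s i).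
have mB i : measurable (B i) by apply: measurable_open_rV; exact: ball_open.
rewrite -sumEFin.
have -> : (\sum_(i < N) ((2 * s i) ^+ n)%:E)%E = lam (\big[setU/set0]_(i < N) B i).
  rewrite (measure_bigsetU lam (F := B))//; first by apply: eq_bigr => i _; exact/esym/lamB0.
apply: le_measure; rewrite ?inE.
- by apply: bigsetU_measurable.
- exact: measurable_open_rV.
- by rewrite -bigcup_mkord => x [i _ Bx]; apply: cU; exists i.
Qed.

End packing.

Section content_zero.
Variable R : realType.

(** Sets of zero [n]-dimensional Hausdorff content; see
    [content_zero_hausdorff] for the link with the Hausdorff measure. *)
Definition content_zero (n d : nat) (N : set 'rV[R]_d) := forall e : R, 0 < e ->
  exists (c : nat -> 'rV[R]_d) (s : nat -> R),
  [/\ forall i, 0 <= s i, N `<=` \bigcup_i ball (c i) (s i) &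
      forall k, \sum_(i < k) s i ^+ n <= e].

Lemma content_zeroS n d (A B : set 'rV[R]_d) : A `<=` B -> content_zero n B -> content_zero n A.
Proof.
move=> AB cB e e0; have [c [s [h1 h2 h3]]] := cB e e0; exists c, s; split => //.
exact: subset_trans h2.
Qed.

(** The images of Vitali balls of small total volume lie in balls of comparable
    radii. *)
Lemma lipschitz_content_zero n d (lam : {measure set (borel_rV R n) -> \bar R})
    (f : 'rV[R]_n -> 'rV[R]_d) (L : R) (P : set 'rV[R]_n) : (0 < n)%N ->
  (forall x r, 0 < r -> lam (ball x r) = ((2 * r) ^+ n)%:E) ->
  0 < L -> (forall x y, `|f x - f y| <= L * `|x - y|) ->
  lam.-negligible P -> content_zero n (f @` P).
Proof.
move=> n0 lamB L0 fL nP e e0.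
have P0 := negligible_mu_ext0 nP.
have C0 : 0 < (5 * L / 2) ^+ n by rewrite exprn_gt0// divr_gt0// mulr_gt0.
have e'0 : 0 < e / (5 * L / 2) ^+ n by rewrite divr_gt0.
have [] := @mu_ext_open _ _ lam P _ (lam_outer_regular lamB) _ e'0; first by rewrite P0.
move=> U [oU PU]; rewrite P0 add0e => lU.
have fine_radii (x : 'rV[R]_n) : P x -> forall e1 : R, 0 < e1 -> exists r, 0 < r < e1 /\ True.
  by move=> _ e1 e10; exists (e1 / 2); split => //; apply/andP; split; lra.
have [c [s [h1 h2 h3 h4]]] := vitali_open oU PU ltr01 fine_radii.
have s0 i : 0 <= s i by have [->|[_ /andP[/ltW]]] := h1 i.
exists (fun i => f (c i)), (fun i => 5 * L * s i); split.
- by move=> i; rewrite mulr_ge0// mulr_ge0// ltW.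
- move=> _ [x /h4[i _] hx <-]; exists i => //; move: hx; rewrite !ball_rV/= => hx.
  rewrite (le_lt_trans (fL _ _))// (mulrC 5) -mulrA ltr_pM2l//.
- move=> k; have := packing n0 lamB s0 h2 oU h3 lU k.
  rewrite ler_pdivlMr// mulr_suml; congr (_ <= _); apply: eq_bigr => i _.
  by rewrite -exprMn; congr (_ ^+ _); field.
Qed.


Lemma ediam_ge0 d (A : set 'rV[R]_d) : (0 <= ediam A)%E.
Proof. by apply: ereal_sup_ubound; left. Qed.

Lemma ediam_ub d (A : set 'rV[R]_d) x y : A x -> A y -> ((enorm (x - y))%:E <= ediam A)%E.
Proof. by move=> Ax Ay; apply: ereal_sup_ubound; right; exists (x, y). Qed.

Lemma ediam_le d (A : set 'rV[R]_d) r : 0 <= r ->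
  (forall x y, A x -> A y -> enorm (x - y) <= r) -> (ediam A <= r%:E)%E.
Proof.
move=> r0 h; apply: ge_ereal_sup => _ [->|[[x y] [/= Ax Ay] <-]]; rewrite lee_fin//.
exact: h.
Qed.

Lemma expe_le (x : \bar R) r n : (0 <= x)%E -> (x <= r%:E)%E -> (x ^+ n <= (r ^+ n)%:E)%E.
Proof.
move: x => [x| |]//; rewrite !lee_fin => x0 xr; rewrite -EFin_expe lee_fin.
by apply: lerXn2r; rewrite ?nnegrE// (le_trans x0).
Qed.

Lemma nneseries_le_partial (u : nat -> R) e : (forall i, 0 <= u i) ->
  (forall k, \sum_(i < k) u i <= e) -> (\sum_(0 <= i <oo) (u i)%:E <= e%:E)%E.
Proof.
move=> u0 h; apply: lime_le; first by apply: is_cvg_nneseries => *; rewrite lee_fin.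
by apply: nearW => k; rewrite big_mkord sumEFin lee_fin.
Qed.

(** All balls of a covering of small total content are small, so that the
    constraint on diameters costs nothing. *)
Lemma content_zero_hausdorff n d (N : set (borel_rV R d)) : (0 < n)%N ->
  content_zero n (N : set 'rV[R]_d) -> hausdorff_measure n N = 0%E.
Proof.
move=> n0 cN; apply/eqP; rewrite eq_le; apply/andP; split; last first.
  apply: (le_trans _ (ereal_sup_ubound _)); last by exists 1 => //=.
  by apply: le_ereal_inf_tmp => _ [F _ <-]; apply: nneseries_ge0 => i _ _; exact/expe_ge0/ediam_ge0.
apply: ge_ereal_sup => _ [delta /= delta0 <-].
apply/lee_addgt0Pr => e e0; rewrite add0e.
pose D : R := 2 * d.+1%:R.
have D0 : 0 < D by rewrite mulr_gt0.
pose e' := Num.min (e / D ^+ n) ((delta / D) ^+ n).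
have e'0 : 0 < e' by rewrite lt_min !(divr_gt0, exprn_gt0).
have [c [s [h1 h2 h3]]] := cN _ e'0.
have sD i : D * s i <= delta.
  rewrite mulrC -ler_pdivlMr// -(@ler_pXn2r _ n) ?nnegrE ?h1 ?(ltW (divr_gt0 delta0 D0))//.
  apply: (@le_trans _ _ e'); last by rewrite ge_min lexx orbT.
  apply: le_trans (h3 i.+1); rewrite big_ord_recr/= lerDr sumr_ge0// => j _.
  by rewrite exprn_ge0.
have dF i : (ediam (ball (c i) (s i) : set 'rV[R]_d) <= (D * s i)%:E)%E.
  apply: ediam_le; first by rewrite mulr_ge0// ltW.
  move=> x y; rewrite !ball_rV/= => hx hy; rewrite (le_trans (enorm_le_norm _))//.
  have xy : `|x - y| <= 2 * s i.
    by rewrite (le_trans (ler_distD (c i) _ _))// [X in X + _]distrC; lra.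
  rewrite /D (mulrC 2) -mulrA (le_trans (ler_wpM2l _ xy))// ler_wpM2r ?mulr_ge0 ?h1//.
  by rewrite ler_nat.
apply: (@le_trans _ _ (\sum_(0 <= i <oo) ((D * s i) ^+ n)%:E)%E).
  apply: (@le_trans _ _ (\sum_(0 <= i <oo) ediam (ball (c i) (s i) : set 'rV[R]_d) ^+ n)%E).
    apply: ereal_inf_lbound; exists (fun i => ball (c i) (s i)) => //; split => // i.
    by rewrite (le_trans (dF i))// lee_fin.
  apply: lee_nneseries => i *; first exact/expe_ge0/ediam_ge0.
  by apply: expe_le; [exact: ediam_ge0|exact: dF].
apply: nneseries_le_partial => k; first by rewrite exprn_ge0// mulr_ge0// ltW.
under eq_bigr do rewrite exprMn.
rewrite -mulr_sumr (le_trans (ler_wpM2l _ (h3 k)))//; first by rewrite exprn_ge0// ltW.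
rewrite mulrC -ler_pdivlMr ?exprn_gt0//.
by rewrite ge_min lexx.
Qed.

(** A set of diameter [D] lies in a ball of radius slightly larger than [D]; the
    summable excess [h i] accounts for sets of diameter 0. *)
Lemma hausdorff_content_zero n d (N : set (borel_rV R d)) : (0 < n)%N ->
  hausdorff_measure n N = 0%E -> content_zero n (N : set 'rV[R]_d).
Proof.
move=> n0 HN e e0.
pose e' := e / (2 ^+ n * 2).
have e'0 : 0 < e' by rewrite divr_gt0// mulr_gt0// exprn_gt0.
have c1 : (hausdorff_content n 1 (N : set 'rV[R]_d) < e'%:E)%E.
  apply: (@le_lt_trans _ _ 0%E); last by rewrite lte_fin.
  by rewrite -HN; apply: ereal_sup_ubound; exists 1; first exact: ltr01.
have [_ [F [NF F1] <-] hF] := ereal_inf_lt c1.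
pose D i := fine (ediam (F i)).
have DE i : ediam (F i) = (D i)%:E.
  rewrite /D fineK// ge0_fin_numE ?ediam_ge0//.
  by rewrite (le_lt_trans (F1 i))// ltry.
have D0 i : 0 <= D i by rewrite -lee_fin -DE ediam_ge0.
have [g [g0 sg]] := geo_split e'0.
pose h i := Num.min 1 (g i).
have h0 i : 0 < h i by rewrite lt_min ltr01 g0.
pose s i := if `[< F i !=set0 >] then D i + h i else 0.
exists (fun i => get (F i)), s; split.
- by move=> i; rewrite /s; case: ifP => // _; rewrite addr_ge0// ltW.
- move=> x /NF[i _ Fx]; exists i => //; rewrite /s.
  have Fi : F i !=set0 by exists x.
  have -> : `[< F i !=set0 >] by apply/asboolP.
  rewrite ball_rV/= (le_lt_trans (norm_le_enorm _))//.
  apply: (@le_lt_trans _ _ (D i)); last by rewrite ltrDl.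
  by rewrite -lee_fin -DE; apply: ediam_ub => //; exact: getPex.
- move=> k.
  apply: (@le_trans _ _ (\sum_(i < k) (2 ^+ n * D i ^+ n + 2 ^+ n * g i))).
    apply: ler_sum => i _; apply: (@le_trans _ _ ((D i + h i) ^+ n)).
      rewrite /s; case: ifP => // _; rewrite expr0n gtn_eqF//.
      by rewrite exprn_ge0// addr_ge0// ltW.
    apply: (@le_trans _ _ (2 ^+ n * D i ^+ n + 2 ^+ n * h i ^+ n)).
      have hi := ltW (h0 i); rewrite -!exprMn.
      have [Dh|hD] := leP (D i) (h i).
        apply: (@le_trans _ _ ((2 * h i) ^+ n)).
          by rewrite ler_pXn2r ?nnegrE ?addr_ge0 ?mulr_ge0//; lra.
        by rewrite lerDr exprn_ge0// mulr_ge0.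
      apply: (@le_trans _ _ ((2 * D i) ^+ n)).
        by rewrite ler_pXn2r ?nnegrE ?addr_ge0 ?mulr_ge0//; lra.
      by rewrite lerDl exprn_ge0// mulr_ge0.
    rewrite lerD2l ler_pM2l ?exprn_gt0//.
    apply: (@le_trans _ _ (h i)); last by rewrite ge_min lexx orbT.
    rewrite -[leRHS]expr1; apply: ler_wiXn2l => //; first exact: ltW.
    by rewrite /h ge_min lexx.
  rewrite big_split/= -!mulr_sumr.
  have p1 : \sum_(i < k) D i ^+ n <= e'.
    rewrite -lee_fin -sumEFin; apply: le_trans (ltW hF).
    apply: le_trans (nneseries_lim_ge k _); last by move=> *; exact/expe_ge0/ediam_ge0.
    by rewrite big_mkord; apply: lee_sum => i _; rewrite DE EFin_expe.
  have p2 : \sum_(i < k) g i <= e'.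
    rewrite -lee_fin -sumEFin; apply: le_trans sg.
    apply: le_trans (nneseries_lim_ge k _); last by move=> *; rewrite lee_fin ltW.
    by rewrite big_mkord.
  rewrite -mulrDr (le_trans (ler_wpM2l _ (lerD p1 p2))) ?exprn_ge0//.
  rewrite le_eqVlt; apply/orP; left; apply/eqP; rewrite /e'; field.
  by rewrite expf_neq0.
Qed.

(** Coverings of content tending to 0 enclose the set in a Borel set of zero
    content, to which absolute continuity applies. *)
Lemma content_zero_negligible n d (mu : {measure set (borel_rV R d) -> \bar R})
    (N : set 'rV[R]_d) : (0 < n)%N -> mu `<< @hausdorff_measure R d n ->
  content_zero n N -> mu.-negligible N.
Proof.
move=> n0 dom cN.
have /choice[cs hcs] : forall k : nat, exists cs : (nat -> 'rV[R]_d) * (nat -> R),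
    [/\ forall i, 0 <= cs.2 i, N `<=` \bigcup_i ball (cs.1 i) (cs.2 i) &
      forall m, \sum_(i < m) cs.2 i ^+ n <= k.+1%:R^-1].
  move=> k; have k0 : 0 < k.+1%:R^-1 :> R by rewrite invr_gt0.
  by have [c [s h]] := cN _ k0; exists (c, s).
pose A : set (borel_rV R d) := \bigcap_k \bigcup_i ball ((cs k).1 i) ((cs k).2 i).
have mA : measurable A.
  apply: bigcapT_measurable => k; apply: bigcupT_measurable => i.
  by apply: measurable_open_rV; exact: ball_open.
have cA : content_zero n (A : set 'rV[R]_d).
  move=> e e0; have [k ke] := exists_invS_lt e0; have [h1 h2 h3] := hcs k.
  exists (cs k).1, (cs k).2; split => //; first by move=> x; exact.
  by move=> m; rewrite (le_trans (h3 m))// ltW.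
exists A; split => //; last by move=> x Nx k _; have [_ h _] := hcs k; exact: h.
apply: (dom A) => //; move=> B mB BA; apply: content_zero_hausdorff => //.
exact: content_zeroS cA.
Qed.

End content_zero.

Section porosity.
Variables (R : realType) (n : nat) (lam : {measure set (borel_rV R n) -> \bar R}).
Hypothesis n0 : (0 < n)%N.
Hypothesis lamB : forall x r, 0 < r -> lam (ball x r) = ((2 * r) ^+ n)%:E.
Local Open Scope ereal_scope.

Definition porous_at (E : set 'rV[R]_n) (k : nat) (x : 'rV[R]_n) :=
  forall e : R, (0 < e)%R -> exists2 t : R, (0 < t < e)%R &
    exists2 y, (`|y - x| <= t)%R & E `&` ball y (k.+1%:R^-1 * t)%R = set0.

(** Each Vitali ball contains a hole of proportional size, so that the set loses a
    fixed proportion of the measure of each of its neighbourhoods. *)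
Lemma porous_negligible E : lam.-negligible [set x | E x /\ exists k, porous_at E k x].
Proof.
suff h k : lam.-negligible [set x | E x /\ porous_at E k x].
  apply: (negligibleS _ (negligible_bigcup h)).
  by move=> x [Ex [k hk]]; exists k.
apply: negligible_bounded => N.
set P := _ `&` _.
have Pfin : (lam^*)%mu P < +oo.
  by apply: (mu_ext_bounded (lam_locally_finite lamB)); exact: subIsetr.
pose a : R := ((k.+1%:R^-1 / 10) ^+ n)%R.
have a0 : (0 < a)%R by rewrite exprn_gt0// divr_gt0// invr_gt0.
apply: (proportion_negligible (lam_outer_regular lamB) Pfin (q := (1 + a)^-1)).
  by rewrite invr_ge0 invf_lt1 ?ltrDl ?addr_ge0 ?ler01 ?(ltW a0) ?addr_gt0.
move=> U oU PU.
pose Q (x : 'rV[R]_n) (r : R) := exists2 y, (`|y - x| <= r / 2)%R &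
  E `&` ball y (k.+1%:R^-1 * (r / 2))%R = set0.
have fine_radii x : P x -> forall e : R, (0 < e)%R -> exists r, (0 < r < e)%R /\ Q x r.
  move=> [[_ px] _] e e0; have e20 : (0 < e / 2)%R by rewrite divr_gt0.
  have [t /andP[t0 te] [y yx hy]] := px _ e20.
  exists (2 * t)%R; split; first by apply/andP; split; lra.
  by exists y; rewrite (_ : 2 * t / 2 = t)%R//; field.
have [c [s [h1 h2 h3 h4]]] := vitali_open oU PU ltr01 fine_radii.
have s0 i : (0 <= s i)%R by have [->|[_ /andP[/ltW]]] := h1 i.
have /choice[y hy] : forall i, exists y, ball y (k.+1%:R^-1 * (s i / 2))%R `<=` ball (c i) (s i)
    /\ E `&` ball y (k.+1%:R^-1 * (s i / 2))%R = set0.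
  move=> i; have [->|[_ /andP[si _] [y yx hy]]] := h1 i.
    exists 0%R; rewrite mul0r mulr0 (ball_rV0 _ (lexx 0%R)) (ball_rV0 _ (lexx 0%R)) setI0.
    by split.
  exists y; split => // z; rewrite !ball_rV/= => hz.
  rewrite (le_lt_trans (ler_distD y _ _))// [X in (X + _)%R]distrC.
  have : (k.+1%:R^-1 * (s i / 2) <= s i / 2)%R.
    by rewrite ler_piMl ?divr_ge0 ?invf_le1 ?ler1n// ltW.
  move: hz; set w := (_ * _)%R => hz ws.
  by rewrite (lt_le_trans (ler_ltD yx hz))//; lra.
pose B i : set (borel_rV R n) := ball (y i) (k.+1%:R^-1 * (s i / 2))%R.
have mB i : measurable (B i) by apply: measurable_open_rV; exact: ball_open.
have mU : measurable (U : set (borel_rV R n)) by exact: measurable_open_rV.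
have mH : measurable (\bigcup_i B i) by exact: bigcupT_measurable.
have HU : \bigcup_i B i `<=` U.
  by move=> x [i _ Bx]; apply: h3; exists i => //; apply: (hy i).1.
have lB i : lam (B i) = a%:E * lam (ball (c i) (5 * s i))%R.
  rewrite (lamB0 n0 lamB) ?mulr_ge0 ?invr_ge0// (lamB0 n0 lamB) ?mulr_ge0//.
  by rewrite -EFinM -exprMn; congr (_ ^+ _)%:E; field.
have lP : a%:E * (lam^*)%mu P <= lam (\bigcup_i B i).
  rewrite measure_semi_bigcup//; last first.
    apply/trivIsetP => i j _ _ ij; rewrite -subset0 => x [Bi Bj].
    move/trivIsetP : h2 => /(_ i j Logic.I Logic.I ij); rewrite -subset0; apply.
    by split; apply: (hy _).1.
  rewrite (eq_eseriesr (fun i _ => lB i)) nneseriesZl//.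
  apply: lee_wpmul2l; first by rewrite lee_fin ltW.
  apply: (le_trans (le_mu_ext lam h4)).
  apply: (le_trans (outer_measure_sigma_subadditive (lam^*)%mu _)).
  apply: lee_nneseries => i *; first exact: mu_ext_ge0.
  rewrite le_eqVlt; apply/orP; left; apply/eqP; apply: (measurable_mu_extE lam).
  by apply: measurable_open_rV; exact: ball_open.
have lU : (lam^*)%mu P + lam (\bigcup_i B i) <= lam U.
  have -> : lam U = lam (U `\` \bigcup_i B i) + lam (\bigcup_i B i).
    rewrite -measureU//; [by rewrite setUC setDUK|exact: measurableD|exact: setDKI].
  apply: leeD => //; rewrite -(measurable_mu_extE lam); last exact: measurableD.
  apply: le_mu_ext => x Px; split; first exact: PU.
  move=> [i _ Bx]; have [_] := hy i; rewrite -subset0; apply; split; last exact: Bx.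
  by case: Px => [[]].
rewrite muleC lee_pdivlMr; last by rewrite addr_gt0.
rewrite muleC EFinD ge0_muleDl ?mul1e ?lee_fin ?(ltW a0)//.
by rewrite (le_trans (leeD (lexx _) lP)).
Qed.

End porosity.

(** * Lipschitz functions of one variable *)
Section slope.
Variable R : realType.
Implicit Types (h : R -> R) (t l : R).

Definition slope h t l := forall e : R, 0 < e -> exists2 r : R, 0 < r &
  forall s, `|s| < r -> `|h (t + s) - h t - s * l| <= e * `|s|.

Lemma derivable_slope h t : derivable h t 1 -> exists l, slope h t l.
Proof.
move=> /cvg_ex[/= l /cvgrPdist_le hl]; exists l => e e0.
have := hl e e0; rewrite /dnbhs /within/= -nbhs_ballE => -[r /= r0 hr].
exists r => // s sr; have [->|s0] := eqVneq s 0.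
  by rewrite addr0 subrr mul0r subrr normr0 mulr0.
have := hr s; rewrite /ball/= sub0r normrN => /(_ sr s0).
rewrite /GRing.scale/= mulr1 (addrC s) => hs.
have -> : h (t + s) - h t - s * l = - (s * (l - s^-1 * (h (t + s) - h t))).
  by field.
by rewrite normrN normrM mulrC ler_pM2r ?normr_gt0.
Qed.

Section monotone.
Variables (g : R -> R) (L : R).
Hypothesis L0 : 0 < L.
Hypothesis g_nd : forall x y, x <= y -> 0 <= g y - g x <= L * (y - x).

Let g_nondecreasing : nondecreasing g.
Proof. by move=> x y /g_nd/andP[+ _]; rewrite subr_ge0. Qed.

Let g_lip x y : `|g x - g y| <= L * `|x - y|.
Proof.
wlog xy : x y / x <= y.
  by move=> h; have [/h//|/ltW/h] := leP x y; rewrite distrC [X in L * X]distrC.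
have /andP[h1 h2] := g_nd xy.
by rewrite distrC ger0_norm// [X in L * X]distrC [X in L * X]ger0_norm// subr_ge0.
Qed.

Let g_continuous : continuous g.
Proof.
move=> x; apply/cvgrPdist_lt => e e0; near=> y.
rewrite (le_lt_trans (g_lip x y))// mulrC -ltr_pdivlMr//.
by near: y; apply: cvgr_dist_lt; rewrite ?divr_gt0.
Unshelve. all: by end_near. Qed.

Let g_rc : right_continuous g.
Proof. by move=> x; apply: cvg_within_filter; exact: g_continuous. Qed.

#[local] HB.instance Definition _ := isCumulative.Build R _ R g g_nondecreasing g_rc.

Let nu := lebesgue_stieltjes_measure (g : cumulative R R).

Let wlength_le (A : set R) : ocitv A -> (wlength g A <= L%:E * wlength idfun A)%E.
Proof.
move=> /ocitvP[->|[[a b] /= ab ->]]; first by rewrite !wlength0 mule0.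
rewrite !wlength_itv/= lte_fin ab -!EFinB -EFinM lee_fin.
by have /andP[] := g_nd (ltW ab).
Qed.

Let nu_null (A : set R) : @lebesgue_measure R A = 0%E -> nu A = 0%E.
Proof.
move=> A0; apply/eqP; rewrite eq_le measure_ge0 andbT; apply/lee_addgt0Pr => e e0.
rewrite add0e.
have fin : (wlength idfun)^*%mu A \is a fin_num.
  by rewrite [X in X \is a fin_num](_ : _ = lebesgue_measure A)// A0.
have eL : 0 < e / L by rewrite divr_gt0.
have [_ [F [mF AF] <-] h] := lb_ereal_inf_adherent eL fin.
have {}h : (\sum_(0 <= k <oo) wlength idfun (F k) < (wlength idfun)^*%mu A + (e / L)%:E)%E := h.
rewrite [X in (_ < X + _)%E](_ : _ = @lebesgue_measure R A)// A0 add0e in h.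
apply: (@le_trans _ _ (\sum_(0 <= k <oo) wlength g (F k))%E).
  by apply: ereal_inf_lbound; exists F.
apply: (@le_trans _ _ (\sum_(0 <= k <oo) (L%:E * wlength idfun (F k)))%E).
  apply: lee_nneseries => [i *|i *]; first exact: (wlength_ge0 (g : cumulative R R)).
  exact: (wlength_le (mF i)).
rewrite nneseriesZl//.
rewrite (le_trans (lee_wpmul2l _ (ltW h)))//; first by rewrite lee_fin ltW.
by rewrite -EFinM lee_fin mulrCA divff ?mulr1// gt_eqF.
Qed.

Let LR : {sigma_finite_measure set (measurableTypeR R) -> \bar R} := lebesgue_measure.

Let local_derivable (N : R) : 0 <= N ->
  (@lebesgue_measure R).-negligible [set t | - N < t < N /\ ~ derivable g t 1].
Proof.
move=> N0; pose I : set (measurableTypeR R) := `]- N, N]%classic.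
have mI : measurable I by exact: measurable_itv.
have nuE (a b : R) : a <= b -> nu `]a, b]%classic = (g b - g a)%:E.
  move=> ab; rewrite /nu /lebesgue_stieltjes_measure /measure_extension.
  rewrite measurable_mu_extE; last exact: is_ocitv.
  exact: wlength_itv_bnd.
have nuI : (nu I < +oo)%E.
  by rewrite /I nuE ?ltry//; lra.
pose nuN : {finite_measure set (measurableTypeR R) -> \bar R} := mfrestr mI nuI.
have dom : nuN `<< LR.
  apply/null_content_dominatesP => A mA A0.
  rewrite /nuN/= /mfrestr /mrestr; apply/eqP; rewrite eq_le measure_ge0 andbT.
  rewrite -(nu_null A0); apply: le_measure; rewrite ?inE//.
  exact: measurableI.
have [f [f0 ffin fint fE]] := radon_nikodym_sigma_finite dom.
pose fr t := fine (f t).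
have frE : EFin \o fr = f by apply/funext => t /=; rewrite /fr fineK.
have fint' : LR.-integrable setT (EFin \o fr) by rewrite frE.
have loc : locally_integrable setT fr by apply: open_integrable_locally => //; exact: openT.
have intf y : LR.-integrable [set` Interval (BRight (- N)) (BRight y)] (EFin \o fr).
  by apply: integrableS fint' => //; exact: measurable_itv.
have := FTC1 intf loc.
move=> [Z [mZ Z0 hZ]]; exists Z; split => // t [/andP[t1 t2] nd]; apply: hZ => /= h.
apply: nd; have [] := h _; first by rewrite lte_fin.
set F := fun y => _ => dF _.
have near_t : \forall y \near t, F y + g (- N) = g y.
  near=> y.
  have yN : - N < y by near: y; exact: lt_nbhsr.
  have yN' : y < N by near: y; exact: lt_nbhsl.
  rewrite /F /Rintegral.
  pose J : set (measurableTypeR R) := `]- N, y]%classic.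
  have mJ : measurable J by exact: measurable_itv.
  have intE : (\int[LR]_(x in J) (fr x)%:E)%E = nuN J.
    by rewrite fE//; apply: eq_integral => s _; rewrite /fr fineK.
  have JI : J `&` I = J.
    by apply/setIidl => s; rewrite /J /I /= !in_itv/= => /andP[-> /le_trans]; apply; exact: ltW.
  transitivity (fine (nuN J) + g (- N)); first by rewrite -intE.
  have -> : nuN J = (g y - g (- N))%:E.
    by rewrite /nuN/= /mfrestr /mrestr JI; exact: (nuE _ _ (ltW yN)).
  by rewrite /= subrK.
apply: (@near_eq_derivable _ _ _ (F \+ cst (g (- N))) g (t : R) 1); first exact: near_t.
by apply: derivableD; [exact: dF|exact: derivable_cst].
Unshelve. all: by end_near. Qed.

(** The Stieltjes measure of [g] is absolutely continuous because [g] is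
    Lipschitz; [g] is then an integral of its Radon-Nikodym density, and the
    fundamental theorem of calculus applies. *)
Lemma monotone_ae_derivable :
  (@lebesgue_measure R).-negligible [set t | ~ derivable g t 1].
Proof.
apply: (negligibleS _ (negligible_bigcup (fun k : nat => local_derivable (ler0n R k)))).
move=> t /= nd; exists (Num.bound `|t|) => //; split => //.
by rewrite -ltr_norml archi_boundP.
Qed.
End monotone.

(** Adding a linear function makes [h] nondecreasing. *)
Lemma lipschitz_ae_slope h (L : R) : (forall x y, `|h x - h y| <= L * `|x - y|) ->
  (@lebesgue_measure R).-negligible [set t | ~ exists l, slope h t l].
Proof.
move=> hL.
pose K := `|L| + 1.
have K0 : 0 < K by rewrite /K; have := normr_ge0 L; lra.
have hK x y : `|h x - h y| <= K * `|x - y|.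
  rewrite (le_trans (hL x y))// ler_wpM2r// /K.
  by have := ler_norm L; lra.
pose g x := h x + K * x.
have g_nd x y : x <= y -> 0 <= g y - g x <= (2 * K) * (y - x).
  move=> xy; have := hK y x; rewrite [X in K * X]ger0_norm ?subr_ge0// ler_norml.
  by rewrite /g => /andP[h1 h2]; apply/andP; split; lra.
have K20 : 0 < 2 * K by lra.
apply: negligibleS (monotone_ae_derivable K20 g_nd).
move=> t /= nl /derivable_slope[l hl]; apply: nl; exists (l - K) => e e0.
have [r r0 hr] := hl e e0; exists r => // s /hr; rewrite /g.
by congr (`|_| <= _); ring.
Qed.

End slope.

(** * Rademacher's theorem *)
Section rademacher.
Variables (R : realType) (n d : nat) (lam : {measure set (borel_rV R n) -> \bar R}).
Hypothesis n0 : (0 < n)%N.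
Hypothesis lamB : forall x r, 0 < r -> lam (ball x r) = ((2 * r) ^+ n)%:E.
Hypothesis lamS : forall (i : 'I_n) (A : set (borel_rV R n)), measurable A ->
  (forall x : 'rV[R]_n,
     (@lebesgue_measure R).-negligible [set t | A (x + t *: delta_mx 0 i)]) ->
  lam A = 0%E.
Variables (f : 'rV[R]_n -> 'rV[R]_d) (L : R).
Hypothesis L0 : 0 < L.
Hypothesis fL : forall x y, `|f x - f y| <= L * `|x - y|.
Implicit Types (x y v : 'rV[R]_n).

Local Notation e_ i := (delta_mx 0 i : 'rV[R]_n).

Definition quot (i : 'I_n) (j : 'I_d) (s : R) x : R :=
  (f (x + s *: e_ i) 0 j - f x 0 j) / s.

Lemma coord_lip j x y : `|f x 0 j - f y 0 j| <= L * `|x - y|.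
Proof.
by apply: le_trans (fL x y); have := coord_le_norm (f x - f y) 0 j; rewrite !mxE.
Qed.

Lemma quot_lip i j s x y : `|quot i j s x - quot i j s y| <= 2 * L / `|s| * `|x - y|.
Proof.
rewrite /quot -mulrBl normrM normfV mulrAC ler_wpM2r ?invr_ge0//.
rewrite opprD opprK addrACA (le_trans (ler_normD _ _))// [- _ + _]addrC.
rewrite -mulrA mulr_natl mulr2n lerD//; last by rewrite distrC; exact: coord_lip.
apply: le_trans (coord_lip _ _ _) _; rewrite opprD addrACA subrr addr0//.
Qed.

(** The Cauchy criterion for the difference quotients; unlike the existence of a
    derivative it is visibly a Borel condition. *)
Definition cauchy_quot i j (k m : nat) : set 'rV[R]_n :=
  [set x | forall s t, 0 < `|s| < m.+1%:R^-1 -> 0 < `|t| < m.+1%:R^-1 ->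
     `|quot i j s x - quot i j t x| <= k.+1%:R^-1].

Definition has_partial i j : set 'rV[R]_n := \bigcap_k \bigcup_m cauchy_quot i j k m.

Lemma measurable_has_partial i j : measurable (has_partial i j : set (borel_rV R n)).
Proof.
apply: bigcapT_measurable => k; apply: bigcupT_measurable => m.
apply: measurable_closed_rV.
rewrite (_ : cauchy_quot i j k m = \bigcap_(st in [set st : R * R |
    0 < `|st.1| < m.+1%:R^-1 /\ 0 < `|st.2| < m.+1%:R^-1])
    [set x | `|quot i j st.1 x - quot i j st.2 x| <= k.+1%:R^-1]); last first.
  apply/seteqP; split => [x hx [s t] [/= hs ht]|x hx s t hs ht]; first exact: hx.
  by apply: (hx (s, t)).
apply: closed_bigI => -[s t] _ /=.
apply: (@lip_closed _ _ _ (2 * L / `|s| + 2 * L / `|t|)) => x y.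
rewrite (le_trans (lerB_dist _ _))// mulrDl.
rewrite (_ : _ - _ - _ = (quot i j s x - quot i j s y) - (quot i j t x - quot i j t y)); last ring.
by rewrite (le_trans (ler_normB _ _))// lerD//; exact: quot_lip.
Qed.

Lemma shift_slope i j x t l : slope (fun s => f (x + s *: e_ i) 0 j) t l ->
  has_partial i j (x + t *: e_ i).
Proof.
move=> hl k _.
have k0 : 0 < k.+1%:R^-1 / 2 :> R by rewrite divr_gt0// invr_gt0.
have [r r0 hr] := hl _ k0.
have [m mr] := exists_invS_lt r0; exists m => // s s' hs hs'.
have H u : 0 < `|u| < m.+1%:R^-1 -> `|quot i j u (x + t *: e_ i) - l| <= k.+1%:R^-1 / 2.
  move=> /andP[u0 um]; have := hr u (lt_trans um mr).
  rewrite /quot (_ : x + t *: e_ i + u *: e_ i = x + (t + u) *: e_ i); last by rewrite scalerDl addrA.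
  set A := f _ 0 j; set B := f _ 0 j => hAB.
  have u0' : u != 0 by rewrite -normr_gt0.
  rewrite -(ler_pM2r u0) -normrM mulrBl (mulrC l); apply: le_trans hAB.
  by rewrite -mulrA mulVf// mulr1 mulrC.
have h1 := H _ hs; have h2 := H _ hs'.
rewrite (le_trans (ler_distD l _ _))// [X in _ + X]distrC.
by rewrite (le_trans (lerD h1 h2))// -splitr.
Qed.

(** The restrictions of [f] to lines are Lipschitz functions of one variable, and
    a set with null slices is null. *)
Lemma partial_ae i j : lam.-negligible (~` has_partial i j).
Proof.
have mG := measurable_has_partial i j.
apply/negligibleP; first exact: measurableC.
apply: (lamS (i := i)); first exact: measurableC.
move=> x; pose h s := f (x + s *: e_ i) 0 j.
have hL s t : `|h s - h t| <= L * `|s - t|.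
  rewrite (le_trans (coord_lip _ _ _))// ler_pM2l// opprD addrACA subrr add0r -scalerBl.
  rewrite normrZ ler_piMr//; apply: norm_le_coord => // a b; rewrite mxE.
  by case: (_ && _); rewrite ?normr1 ?normr0.
apply: negligibleS (lipschitz_ae_slope hL) => t /= nG [l hl]; apply: nG.
exact: shift_slope hl.
Qed.

Lemma has_partial_slope i j x : has_partial i j x ->
  exists l, slope (fun s => f (x + s *: e_ i) 0 j) 0 l.
Proof.
move=> hx.
have : cvg (quot i j s x @[s --> 0^']).
  apply: cauchy_cvg; apply: cauchy_exP => e e0.
  have [k ke] := exists_invS_lt e0; have [m _ hm] := hx k Logic.I.
  have m0 : 0 < m.+1%:R^-1 :> R by rewrite invr_gt0.
  pose t : R := m.+1%:R^-1 / 2.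
  have t0 : 0 < `|t| < m.+1%:R^-1.
    rewrite ger0_norm ?divr_ge0 ?ltW// ; apply/andP; split; first by rewrite divr_gt0.
    by rewrite /t; move: m0; set w := _^-1; lra.
  exists (quot i j t x).
  have : \forall s \near (0 : R)^', ball (quot i j t x) e (quot i j s x); last by [].
  near=> s; rewrite /ball/= (le_lt_trans _ ke)//; apply: hm => //.
  apply/andP; split; first by rewrite normr_gt0; near: s; exact: nbhs_dnbhs_neq.
  by near: s; apply: dnbhs0_lt.
move=> /cvg_ex[/= l /cvgrPdist_le hl]; exists l => e e0.
have := hl e e0; rewrite /dnbhs /within/= -nbhs_ballE => -[r /= r0 hr].
exists r => // s sr; rewrite scale0r addr0 add0r.
have [->|s0] := eqVneq s 0.
  by rewrite scale0r addr0 subrr mul0r subrr normr0 mulr0.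
have := hr s; rewrite /ball/= sub0r normrN => /(_ sr s0) hs.
have -> : f (x + s *: e_ i) 0 j - f x 0 j - s * l = - (s * (l - quot i j s x)).
  by rewrite /quot; field.
by rewrite normrN normrM mulrC ler_pM2r ?normr_gt0.
Unshelve. all: by end_near. Qed.

(** [A] is the (transposed) Jacobian matrix of [f] at [x]. *)
Definition frechet x (A : 'M[R]_(n, d)) := forall e : R, 0 < e ->
  exists2 r : R, 0 < r & forall v, `|v| < r -> `|f (x + v) - f x - v *m A| <= e * `|v|.

(** With [Z] among the countably many rational matrices, these sets cover the
    points having all partial derivatives. *)
Definition near_linear (k m : nat) (Z : 'M[R]_(n, d)) : set 'rV[R]_n :=
  [set x | forall i t, `|t| < m.+1%:R^-1 ->
     `|f (x + t *: e_ i) - f x - t *: row i Z| <= k.+1%:R^-1 * `|t|].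

Lemma good_near_linear x (A : 'M[R]_(n, d)) (k : nat) :
  (forall i j, slope (fun s => f (x + s *: e_ i) 0 j) 0 (A i j)) ->
  exists m q M, `|ratmx R q M - A| <= k.+1%:R^-1 /\ near_linear k m (ratmx R q M) x.
Proof.
move=> hA; have k0 : 0 < k.+1%:R^-1 / 2 :> R by rewrite divr_gt0// invr_gt0.
have [q [M qM]] := ratmx_approx A k0.
have AZ : `|ratmx R q M - A| <= k.+1%:R^-1 / 2.
  rewrite distrC (le_trans _ qM)//; apply: norm_le_coord; first exact: mxsum_ge0.
  move=> i j; rewrite /mxsum (bigD1 i)//= (bigD1 j)//= -addrA lerDl.
  by rewrite addr_ge0// sumr_ge0// => *; rewrite sumr_ge0.
have /choice[r hr] : forall ij : 'I_n * 'I_d, exists r, 0 < r /\ forall s, `|s| < r ->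
    `|f (x + s *: e_ ij.1) 0 ij.2 - f x 0 ij.2 - s * A ij.1 ij.2| <= k.+1%:R^-1 / 2 * `|s|.
  move=> [i j]; have [r r0 h] := hA i j _ k0; exists r; split => // s /h.
  by rewrite scale0r addr0 add0r.
have [r0 r00 r0r] : exists2 r0, 0 < r0 & forall ij, r0 <= r ij.
  exists (\big[Num.min/1]_ij r ij).
    by apply/bigmin_gtP; split => // ij _; have [] := hr ij.
  by move=> ij; exact: bigmin_le_cond.
have [m mr] := exists_invS_lt r00.
exists m, q, M; split; first by rewrite (le_trans AZ)// ler_piMr ?invr_ge0// invf_le1 ?ler1n.
move=> i t tm; apply: norm_le_coord; first by rewrite mulr_ge0// invr_ge0.
move=> a j; rewrite ord1 !mxE.
have tr : `|t| < r (i, j) by rewrite (lt_le_trans (lt_trans tm mr)).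
have /= h1 := (hr (i, j)).2 t tr.
have h2 : `|t * (M i j)%:~R / q.+1%:R - t * A i j| <= k.+1%:R^-1 / 2 * `|t|.
  rewrite -mulrA -mulrBr normrM mulrC ler_wpM2r//; apply: le_trans AZ.
  by have := coord_le_norm (ratmx R q M - A) i j; rewrite !mxE.
rewrite [leRHS](_ : _ = k.+1%:R^-1 / 2 * `|t| + k.+1%:R^-1 / 2 * `|t|); last by field.
rewrite (_ : _ - _ = (f (x + t *: e_ i) 0 j - f x 0 j - t * A i j) -
  (t * (M i j)%:~R / q.+1%:R - t * A i j)); last by rewrite -!mulrA; ring.
by rewrite (le_trans (ler_normB _ _))// lerD.
Qed.

(** The vertices of the path from 0 to [v] that follows the coordinate axes. *)
Definition pvec v (j : nat) : 'rV[R]_n := \row_i (if (i < j)%N then v 0 i else 0).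

Lemma pvec_norm v j : `|pvec v j| <= `|v|.
Proof.
apply: norm_le_coord => // a i; rewrite ord1 mxE.
by case: ifP => _; rewrite ?normr0//; exact: coord_le_norm.
Qed.

Lemma pvecS v (j : 'I_n) : pvec v j.+1 = pvec v j + v 0 j *: e_ j.
Proof.
apply/rowP => i; rewrite !mxE ltnS leq_eqVlt eqxx /= val_eqE.
have [->|ij] := eqVneq i j; first by rewrite ltnn add0r mulr1.
by rewrite mulr0 addr0.
Qed.

(** The increment in the direction [e_ j] is known at [y], which is close to the
    current vertex. *)
Lemma nonporous_step x y v (j : 'I_n) k m Z (eta : R) :
  near_linear k m Z y -> `|v| < m.+1%:R^-1 -> `|x + pvec v j - y| <= eta * `|v| ->
  `|f (x + pvec v j.+1) - f (x + pvec v j) - v 0 j *: row j Z| <=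
    (2 * L * eta + k.+1%:R^-1) * `|v|.
Proof.
move=> hy vm xy; have vj : `|v 0 j| <= `|v| by exact: coord_le_norm.
have := hy j (v 0 j) (le_lt_trans vj vm) => h.
rewrite pvecS addrA; set x' := x + pvec v j.
rewrite (_ : _ - _ - _ = (f (x' + v 0 j *: e_ j) - f (y + v 0 j *: e_ j)) - (f x' - f y) +
  (f (y + v 0 j *: e_ j) - f y - v 0 j *: row j Z)); last first.
  by apply/rowP => i; rewrite !mxE; ring.
rewrite (le_trans (ler_normD _ _))// mulrDl lerD//; last first.
  by rewrite (le_trans h)// ler_wpM2l ?invr_ge0.
rewrite (le_trans (ler_normB _ _))//.
have h1 : `|f (x' + v 0 j *: e_ j) - f (y + v 0 j *: e_ j)| <= L * (eta * `|v|).
  by rewrite (le_trans (fL _ _))// ler_pM2l// opprD addrACA subrr addr0.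
have h2 : `|f x' - f y| <= L * (eta * `|v|) by rewrite (le_trans (fL _ _))// ler_pM2l.
by rewrite (le_trans (lerD h1 h2))// -!mulrA; lra.
Qed.

(** Partial derivatives at [x] alone do not control [f] off the axes. If the set
    of points with nearly the same partial derivatives as [x] is not porous at [x],
    it has points close to each vertex of the path from [x] to [x + v], and the
    increments along the path add up to [v *m A] with a small error. *)
Lemma nonporous_frechet x (A : 'M[R]_(n, d)) :
  (forall i j, slope (fun s => f (x + s *: e_ i) 0 j) 0 (A i j)) ->
  (forall k m q M, near_linear k m (ratmx R q M) x ->
     forall k', ~ porous_at (near_linear k m (ratmx R q M)) k' x) ->
  frechet x A.
Proof.
move=> hA np e e0.
(* [C] bounds the number of error terms in one coordinate step. *)
pose C : R := n%:R * (2 * L + 2).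
have C0 : 0 < C by rewrite mulr_gt0 ?ltr0n// addr_gt0// mulr_gt0.
have [k ke] := exists_invS_lt (divr_gt0 e0 C0).
have [m [q [M [AZ xE]]]] := good_near_linear k hA.
have := np _ _ _ _ xE k; rewrite /porous_at => /existsNP[r /not_implyP[r0 hr]].
have m0 : 0 < m.+1%:R^-1 :> R by rewrite invr_gt0.
exists (Num.min r m.+1%:R^-1); first by rewrite lt_min r0.
move=> v; rewrite lt_min => /andP[vr vm].
have [->|v0] := eqVneq v 0.
  by rewrite addr0 subrr mul0mx subrr !normr0 mulr0.
have {}v0 : 0 < `|v| by rewrite normr_gt0.
have step (j : 'I_n) : `|f (x + pvec v j.+1) - f (x + pvec v j) - v 0 j *: row j A| <=
    (2 * L + 2) * k.+1%:R^-1 * `|v|.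
  have [y [Ey xy]] : exists y, near_linear k m (ratmx R q M) y /\
      `|x + pvec v j - y| <= k.+1%:R^-1 * `|v|.
    apply: contrapT => ny; apply: hr; exists `|v|; first by rewrite v0.
    exists (x + pvec v j); first by rewrite addrAC subrr add0r pvec_norm.
    rewrite -subset0 => y [Ey]; rewrite ball_rV/= => /ltW xy; apply: ny.
    by exists y.
  have h := nonporous_step Ey vm xy.
  rewrite (_ : _ - _ - _ = (f (x + pvec v j.+1) - f (x + pvec v j) - v 0 j *: row j (ratmx R q M))
     + v 0 j *: row j (ratmx R q M - A)); last first.
    by apply/rowP => i; rewrite !mxE; ring.
  rewrite (le_trans (ler_normD _ _))//.
  have h' : `|v 0 j *: row j (ratmx R q M - A)| <= `|v| * k.+1%:R^-1.
    rewrite normrZ ler_pM//; first exact: coord_le_norm.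
    apply: le_trans AZ; apply: norm_le_coord => // a b; rewrite [in leLHS]mxE.
    exact: coord_le_norm.
  rewrite (le_trans (lerD h h'))//.
  by rewrite le_eqVlt; apply/orP; left; apply/eqP; ring.
have -> : f (x + v) - f x - v *m A =
    \sum_(j < n) (f (x + pvec v j.+1) - f (x + pvec v j) - v 0 j *: row j A).
  rewrite sumrB -mulmx_sum_row; congr (_ - _).
  rewrite -(big_mkord xpredT (fun j => f (x + pvec v j.+1) - f (x + pvec v j))).
  rewrite telescope_sumr//; congr (f _ - f _).
    by congr (_ + _); apply/rowP => i; rewrite mxE ltn_ord.
  by rewrite (_ : pvec v 0 = 0) ?addr0//; apply/rowP => i; rewrite !mxE.
rewrite (le_trans (ler_norm_sum _ _ _))// (le_trans (ler_sum _ (fun j _ => step j)))//.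
rewrite sumr_const card_ord -[leLHS]mulr_natl !mulrA -/C ler_wpM2r//.
by move: ke; rewrite ltr_pdivlMr// mulrC => /ltW.
Qed.

(** Almost every point has all its partial derivatives, and belongs to none of the
    porous parts of the countably many sets [near_linear]. *)
Theorem rademacher : lam.-negligible [set x | ~ exists A, frechet x A].
Proof.
pose E (c : nat * nat * (nat * 'M[int]_(n, d))) :=
  near_linear c.1.1 c.1.2 (ratmx R c.2.1 c.2.2).
have h1 : lam.-negligible (\bigcup_(i : nat) (if unpickle i is Some c then
    [set x | E c x /\ exists k, porous_at (E c) k x] else set0)).
  apply: negligible_bigcup => i; case: (unpickle i) => [c|]; last exact: negligible_set0.
  exact: porous_negligible.
have h2 : lam.-negligible (\bigcup_(i : nat) (if unpickle i is Some c then
    ~` has_partial c.1 c.2 else set0)).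
  apply: negligible_bigcup => i; case: (unpickle i) => [c|]; last exact: negligible_set0.
  exact: partial_ae.
apply: (negligibleS _ (negligibleU h1 h2)) => x /= nx.
apply: contrapT => /not_orP[n1 n2]; apply: nx.
have /choice[a ha] : forall ij : 'I_n * 'I_d, exists a,
    slope (fun s => f (x + s *: e_ ij.1) 0 ij.2) 0 a.
  move=> ij; apply: has_partial_slope; apply: contrapT => hn; apply: n2.
  by exists (pickle ij) => //; rewrite pickleK.
exists (\matrix_(i, j) a (i, j)); apply: nonporous_frechet.
  by move=> i j; rewrite mxE; exact: (ha (i, j)).
move=> k m q M hx k' hp; apply: n1.
exists (pickle ((k, m), (q, M))) => //; rewrite pickleK; split; first exact: hx.
by exists k'.
Qed.

End rademacher.

(** * Cones and planes *)
Section cones.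
Variables (R : realType) (d : nat).
Implicit Types (x y z u v w : 'rV[R]_d) (V : {vspace 'rV[R]_d}) (alpha : R).

(** Cones around an arbitrary set of directions; the distance to a plane is
    replaced by a witness. *)
Definition wcone (S : set 'rV[R]_d) x alpha : set 'rV[R]_d :=
  [set y | exists2 v, S v & enorm (y - x - v) < alpha * enorm (x - y)].

Lemma coneE x V alpha : cone x V alpha = wcone [set` V] x alpha.
Proof.
have hasinf y : has_inf [set enorm (y - a) | a in [set v + x | v in [set` V]]].
  split; first by exists (enorm (y - (0 + x))), (0 + x) => //; exists 0 => //=; exact: mem0v.
  by exists 0 => _ [a _ <-].
apply/seteqP; split => y /=.
  have [ne _] := hasinf y.
  move=> /(inf_lt ne)[_ [_ [v Vv <-] <-]] h; exists v => //.
  by rewrite -addrA -opprD (addrC x).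
move=> [v Vv h]; apply: le_lt_trans h; apply: ge_inf; first by have [] := hasinf y.
by exists (v + x); [exists v|rewrite -addrA -opprD (addrC v)].
Qed.

Lemma wconeS (S T : set 'rV[R]_d) x a b : S `<=` T -> a <= b -> wcone S x a `<=` wcone T x b.
Proof.
move=> ST ab y [v Sv h]; exists v; first exact: ST.
by rewrite (lt_le_trans h)// ler_wpM2r.
Qed.

Lemma enorm_lip x y : enorm x - enorm y <= d%:R * `|x - y|.
Proof. by rewrite (le_trans (enorm_lerB _ _))// enorm_le_norm. Qed.

Lemma open_wcone S x alpha : 0 <= alpha -> open (wcone S x alpha).
Proof.
move=> a0.
rewrite (_ : wcone _ _ _ = \bigcup_(v in S)
    [set y | 0 < alpha * enorm (x - y) - enorm (y - x - v)]); last first.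
  by apply/seteqP; split => y [v Sv] /= h; exists v => //=; move: h; rewrite subr_gt0.
apply: bigcup_open => v _; apply: (@lip_open _ _ _ (alpha * d%:R + d%:R)) => y z.
have h1 : enorm (x - y) - enorm (x - z) <= d%:R * `|y - z|.
  rewrite (le_trans (enorm_lip _ _))// opprD addrACA subrr add0r opprK addrC.
  by rewrite -normrN opprB.
have h2 : enorm (z - x - v) - enorm (y - x - v) <= d%:R * `|y - z|.
  rewrite (le_trans (enorm_lip _ _))// (_ : _ - _ = z - y) ?[`|z - y|]distrC//.
  by rewrite opprB addrA subrK opprB addrA subrK.
rewrite mulrDl -mulrA; have := ler_wpM2l a0 h1; rewrite mulrBr; lra.
Qed.

Lemma open_eball x r : open (eball x r).
Proof.
rewrite (_ : eball x r = [set y | - r < - enorm (x - y)]); last first.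
  by apply/seteqP; split => y; rewrite /eball/= ltrN2.
apply: (@lip_open _ _ _ d%:R) => y z.
rewrite opprK addrC (le_trans (enorm_lip _ _))// opprD addrACA subrr add0r opprK addrC.
by [].
Qed.

Lemma eball_ball x r : eball x r `<=` ball x r.
Proof. by move=> y; rewrite ball_rV /eball/=; exact: le_lt_trans (norm_le_enorm _). Qed.

End cones.

Section planes.
Variables (R : realType) (n d : nat).
Implicit Types (L : 'M[R]_(n, d)) (c : R).

(** Planes of codimension [n] are given by matrices, which vary in a separable
    space. *)
Definition perp L : set 'rV[R]_d := [set v | v *m L^T = 0].

(** A quantitative form of [row_free], stable under perturbation. *)
Definition lower_bound_mx L c := forall q : 'rV[R]_n, c * enorm q <= enorm (q *m L).

Lemma dotp_mulmx m k (x : 'rV[R]_m) (y : 'rV[R]_k) (A : 'M[R]_(m, k)) :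
  dotp (x *m A) y = dotp x (y *m A^T).
Proof.
have dE p (u v : 'rV[R]_p) : dotp u v = (u *m v^T) 0 0.
  by rewrite mxE; apply: eq_bigr => i _; rewrite mxE.
by rewrite !dE trmx_mul trmxK mulmxA.
Qed.

Lemma gram_unit L c : 0 < c -> lower_bound_mx L c -> L *m L^T \in unitmx.
Proof.
move=> c0 hL; rewrite -row_free_unit.
have c20 : 0 < c ^+ 2 by rewrite exprn_gt0.
apply: (lower_row_free c20) => v.
have [->|v0] := eqVneq v 0; first by rewrite enorm0 mulr0.
have ev : 0 < enorm v.
  by rewrite lt_neqAle enorm_ge0 andbT eq_sym; apply: contra_neq v0; exact: enorm_eq0.
rewrite -(ler_pM2r ev) (le_trans _ (dotp_le _ _))//.
rewrite mulmxA dotp_mulmx trmxK -enorm_sqr -mulrA -expr2 -exprMn.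
by rewrite lerXn2r ?nnegrE ?mulr_ge0 ?(ltW c0).
Qed.

(** The minimum norm solution, from the invertible Gram matrix [L *m L^T]. *)
Lemma lift_perp L c (u : 'rV[R]_n) : 0 < c -> lower_bound_mx L c ->
  exists z : 'rV[R]_d, z *m L^T = u /\ c * enorm z <= enorm u.
Proof.
move=> c0 hL; have Gu := gram_unit c0 hL.
pose q := u *m invmx (L *m L^T).
exists (q *m L); split; first by rewrite -mulmxA mulmxKV.
have [z0|z0] := eqVneq (q *m L) 0; first by rewrite z0 enorm0 mulr0.
have ez : 0 < enorm (q *m L).
  by rewrite lt_neqAle enorm_ge0 andbT eq_sym; apply: contra_neq z0; exact: enorm_eq0.
rewrite -(ler_pM2r ez) -mulrA -expr2 enorm_sqr.
rewrite dotp_mulmx -[_ *m L *m L^T]mulmxA mulmxKV// dotpC.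
rewrite (le_trans (ler_wpM2l (ltW c0) (dotp_le _ _)))//.
by rewrite mulrCA ler_wpM2l.
Qed.

(** Subtract from [v] a short vector with the same image under [L']. *)
Lemma perp_perturb L L' c v : 0 < c -> lower_bound_mx L' c -> perp L v ->
  exists2 v', perp L' v' & c * enorm (v - v') <= mxsum (L - L')^T * enorm v.
Proof.
move=> c0 hL' Lv; have [z [zL' hz]] := lift_perp (v *m L'^T) c0 hL'.
exists (v - z); first by rewrite /perp/= mulmxBl zL' subrr.
rewrite opprB addrC subrK (le_trans hz)//.
have -> : v *m L'^T = - (v *m (L - L')^T).
  by rewrite linearB/= mulmxBr Lv sub0r opprK.
by rewrite enormN enorm_mulmx.
Qed.

(** This reduces arbitrary planes and apertures to countably many. *)
Lemma wcone_perturb L L' c x a b : 0 < c -> lower_bound_mx L' c -> 0 <= a ->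
  a + mxsum (L - L')^T / c * (1 + a) <= b -> wcone (perp L) x a `<=` wcone (perp L') x b.
Proof.
move=> c0 hL' a0 ab y [v Lv h].
have [v' L'v' hv] := perp_perturb c0 hL' Lv; exists v' => //.
rewrite (lt_le_trans _ (ler_wpM2r (enorm_ge0 _) ab))// mulrDl.
have -> : y - x - v' = (y - x - v) + (v - v') by rewrite addrA subrK.
rewrite (le_lt_trans (enormD _ _))// ltr_leD//.
have {}hv : enorm (v - v') <= mxsum (L - L')^T / c * enorm v.
  by rewrite mulrAC ler_pdivlMr// mulrC.
rewrite (le_trans hv)// -[leRHS]mulrA ler_wpM2l ?divr_ge0 ?mxsum_ge0 ?(ltW c0)//.
rewrite (_ : v = (y - x) - (y - x - v)); last by rewrite opprB addrC subrK.
rewrite (le_trans (enormD _ _))// enormN mulrDl mul1r lerD//; last exact: ltW.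
by rewrite enormBC.
Qed.

(** Subtracting from [y - x] the lift of its projection gives a vector of the
    plane, which is too far from [y - x] when [y] is outside the cone. *)
Lemma notin_wcone L c x y a : 0 < c -> lower_bound_mx L c -> ~ wcone (perp L) x a y ->
  a * enorm (x - y) <= enorm ((y - x) *m L^T) / c.
Proof.
move=> c0 hL nh; rewrite leNgt; apply/negP => h; apply: nh.
have [z [zL hz]] := lift_perp ((y - x) *m L^T) c0 hL.
exists (y - x - z); first by rewrite /perp/= mulmxBl zL subrr.
rewrite opprB addrC subrK (le_lt_trans _ h)//.
by rewrite ler_pdivlMr// mulrC.
Qed.

Lemma perp_grassmannian L : (n <= d)%N -> row_free L ->
  exists2 V : {vspace 'rV[R]_d}, grassmannian (d - n) V & [set` V] `<=` perp L.
Proof.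
move=> nd rL; pose phi : 'Hom('rV[R]_d, 'rV[R]_n) := linfun (mulmxr L^T).
exists (lker phi); last by move=> v; rewrite /perp/= memv_ker lfunE/= => /eqP.
have [c c0 hc] := row_free_lower rL.
have full : limg phi = fullv.
  apply/eqP; rewrite eqEsubv subvf/=; apply/subvP => u _.
  have [z [<- _]] := lift_perp u c0 hc.
  by apply/memv_imgP; exists z; rewrite ?memvf// lfunE.
rewrite /grassmannian/=; have := limg_ker_dim phi fullv.
rewrite capfv full !dimvf !dim_matrix !mul1r => /= hd.
by rewrite -[in RHS]hd addnK.
Qed.

End planes.

(** The columns of the cokernel of a basis of [V] are linear equations of [V]. *)
Lemma grassmannian_perp (R : realType) (n d : nat) (V : {vspace 'rV[R]_d}) :
  (n <= d)%N -> grassmannian (d - n) V ->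
  exists2 L : 'M[R]_(n, d), row_free L & perp L `<=` [set` V].
Proof.
move=> nd dV; pose B : 'M[R]_(\dim V, d) := \matrix_(i < \dim V) (vbasis V)`_i.
have rB : \rank B = \dim V.
  apply/eqP; rewrite -/(row_free B) -kermx_eq0; apply/eqP/row_matrixP => k; rewrite row0.
  have := row_matrixP _ _; have : row k (kermx B) *m B = 0 by rewrite -row_mul mulmx_ker row0.
  rewrite mulmx_sum_row => h _; have /freeP fr := basis_free (vbasisP V).
  apply/rowP => i; rewrite [RHS]mxE; apply: (fr (fun i => row k (kermx B) 0 i)).
  by rewrite -[RHS]h; apply: eq_bigr => j _; rewrite rowK.
pose C := cokermx B.
have rC : \rank C = n by rewrite mxrank_coker rB dV subKn.
rewrite -rC; exists (col_base C)^T.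
  by rewrite /row_free mxrank_tr; have := col_base_full C; rewrite /row_full.
move=> w; rewrite /perp/= trmxK => wC.
have : (w <= B)%MS by rewrite submxE -/C -(mulmx_base C) mulmxA wC mul0mx.
move=> /submxP[D ->]; rewrite mulmx_sum_row; apply: memv_suml => i _.
by apply: memvZ; rewrite rowK; apply: vbasis_mem; apply: mem_nth; rewrite size_tuple.
Qed.

(** * Densities and conical energies *)

(** The integral of a nonnegative function is a supremum over simple functions
    below it, hence monotone; this allows the integrands of conical energies to be
    compared with step functions directly. *)
Lemma ge0_le_integral_any d (T : measurableType d) (R : realType)
    (m : {measure set T -> \bar R}) (D : set T) (f g : T -> \bar R) :
  (forall x, D x -> 0 <= f x)%E -> (forall x, D x -> f x <= g x)%E ->
  (\int[m]_(x in D) f x <= \int[m]_(x in D) g x)%E.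
Proof.
move=> f0 fg; have g0 x : D x -> (0 <= g x)%E by move=> Dx; rewrite (le_trans (f0 _ Dx))// fg.
rewrite !(integral_mkcond D) !ge0_integralTE; last 2 first.
- by apply: erestrict_ge0 => x; exact: g0.
- by apply: erestrict_ge0 => x; exact: f0.
apply: le_ereal_sup => _ [h hf <-]; exists h => // x.
apply: (le_trans (hf x)); rewrite /patch; case: ifP => //; rewrite inE; exact: fg.
Qed.

Section densities.
Variables (R : realType) (d n : nat) (mu : {measure set (borel_rV R d) -> \bar R}).
Implicit Types x : 'rV[R]_d.

Lemma right_nbhs0 (delta : R) : 0 < delta -> (0%R : R)^'+ [set r : R | 0 < r < delta].
Proof.
move=> d0; near=> r; apply/andP; split; first by near: r; exact: nbhs_right_gt.
by near: r; exact: nbhs_right_lt.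
Unshelve. all: by end_near. Qed.

Lemma upper_density_pos x : (0 < upper_density n mu x)%E ->
  exists2 k : nat, True & forall delta : R, 0 < delta ->
    exists2 r, 0 < r < delta & ((k.+1%:R^-1 * r ^+ n)%:E < mu (eball x r))%E.
Proof.
move=> up.
have [k ke] : exists k : nat, (k.+1%:R^-1%:E < upper_density n mu x)%E.
  case: (upper_density n mu x) up => [u| |]//=; rewrite ?lte_fin.
    by move=> /exists_invS_lt[k ?]; exists k; rewrite lte_fin.
  by move=> _; exists 0%N; rewrite ltry.
exists k => // delta d0.
have h : (k.+1%:R^-1%:E < ereal_sup ((fun r : R => mu (eball x r) * ((r ^+ n)^-1)%:E) @` [set r : R | (0 < r < delta)%R]))%E.
  apply: (lt_le_trans ke); rewrite /upper_density /limf_esup.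
  by apply: ereal_inf_lbound; exists [set r : R | (0 < r < delta)%R] => //; exact: right_nbhs0.
have [_ [r hr <-] {}h] := ereal_sup_gt h; exists r => //.
have /andP[r0 _] := hr; have rn0 : 0 < r ^+ n by rewrite exprn_gt0.
by move: h; rewrite lte_pdivlMr// EFinM.
Qed.

Lemma lower_density_fin x : (lower_density n mu x < +oo)%E ->
  exists2 k : nat, True & forall delta : R, 0 < delta ->
    exists2 r, 0 < r < delta & (mu (eball x r) < (k%:R * r ^+ n)%:E)%E.
Proof.
move=> lo.
have [k ke] : exists k : nat, (lower_density n mu x < k%:R%:E)%E.
  case: (lower_density n mu x) lo => [u| |]//= _.
    exists (Num.bound `|u|); rewrite lte_fin (le_lt_trans (ler_norm _))//.
    exact: archi_boundP.
  by exists 0%N; rewrite ltNyr.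
exists k => // delta d0.
have h : (ereal_inf ((fun r : R => mu (eball x r) * ((r ^+ n)^-1)%:E) @` [set r : R | (0 < r < delta)%R]) < k%:R%:E)%E.
  apply: le_lt_trans ke; rewrite /lower_density /limf_einf leeNr.
  apply: le_trans (ereal_inf_lbound _) _; first by exists [set r : R | (0 < r < delta)%R] => //; exact: right_nbhs0.
  apply: ge_ereal_sup => _ [r hr <-]; rewrite leeN2.
  by apply: ereal_inf_lbound; exists r.
have [_ [r hr <-] {}h] := ereal_inf_lt h; exists r => //.
have /andP[r0 _] := hr; have rn0 : 0 < r ^+ n by rewrite exprn_gt0.
by move: h; rewrite lte_pdivrMr// EFinM.
Qed.

End densities.

Section energy.
Variables (R : realType) (d n : nat) (mu : {measure set (borel_rV R d) -> \bar R}).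
Variable (T : R -> set 'rV[R]_d) (p : R).
Hypothesis p0 : 0 < p.
Hypothesis T_nd : forall r s, r <= s -> T r `<=` T s.
Hypothesis T_open : forall r, open (T r).
Local Open Scope ereal_scope.

Let g (r : R) : \bar R := (mu (T r) * ((r ^+ n)^-1)%:E) `^ p * (r^-1)%:E.

Let mT r : measurable (T r : set (borel_rV R d)).
Proof. by apply: measurable_open_rV. Qed.

Let g_lower (l r s : R) : (0 < r)%R -> (0 < l)%R -> (l * r ^+ n)%:E < mu (T r) -> (r <= s < 2 * r)%R ->
  ((l / 2 ^+ n) `^ p / (2 * r))%:E <= g s.
Proof.
move=> r0 l0 lr /andP[rs sr]; have s0 : (0 < s)%R by rewrite (lt_le_trans r0).
have sn : (0 < s ^+ n)%R by rewrite exprn_gt0.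
rewrite /g EFinM; apply: lee_pmul => //.
- by rewrite lee_fin powR_ge0.
- by rewrite lee_fin invr_ge0 mulr_ge0// ltW.
- rewrite -poweR_EFin; apply: gt0_ler_poweR; first exact: ltW.
  + by rewrite in_itv/= leey lee_fin divr_ge0 ?exprn_ge0 ?ltW.
  + by rewrite in_itv/= leey mule_ge0// lee_fin invr_ge0 ltW.
  + rewrite lee_pdivlMr// -EFinM.
    apply: (@le_trans _ _ (l * r ^+ n)%:E).
      rewrite lee_fin -mulrA ler_pM2l// mulrC ler_pdivrMr ?exprn_gt0// -exprMn.
      by rewrite lerXn2r ?nnegrE ?mulr_ge0 ?(ltW r0) ?(ltW s0)// mulrC ltW.
    rewrite (le_trans (ltW lr))//; apply: le_measure; rewrite ?inE//.
    exact: T_nd.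
- by rewrite lee_fin lef_pV2 ?posrE ?mulr_gt0// ltW.
Qed.

(** If the densities along [T] do not tend to 0, every scale at which they are
    large contributes a fixed amount to the energy. *)
Lemma energy_density : \int[lebesgue_measure]_(r in `]0%R, 1%R[) g r < +oo ->
  forall l : R, (0 < l)%R -> exists2 delta : R, (0 < delta)%R &
    forall r, (0 < r < delta)%R -> mu (T r) <= (l * r ^+ n)%:E.
Proof.
move=> fin l l0; apply: contrapT => nex.
have bad (delta : R) : (0 < delta)%R -> exists2 r, (0 < r < delta)%R & (l * r ^+ n)%:E < mu (T r).
  move=> d0; apply: contrapT => nr; apply: nex; exists delta => // r rd.
  by rewrite leNgt; apply/negP => h; apply: nr; exists r.
pose k : R := ((l / 2 ^+ n) `^ p)%R.
have k0 : (0 < k)%R by rewrite powR_gt0// divr_gt0// exprn_gt0.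
(* each step [h'] lives on [r, 2 r) and has integral [k / 2]; the next one is
   chosen to the left of it *)
have steps (N : nat) : forall delta : R, (0 < delta <= 1)%R -> exists h : R -> \bar R,
    [/\ measurable_fun setT h, forall x, 0 <= h x, forall x, ~ (0 < x < delta)%R -> h x = 0,
      forall x, (0 < x < delta)%R -> h x <= g x &
      (N%:R * (k / 2))%:E <= \int[lebesgue_measure]_x h x].
  elim: N => [delta _|N IH delta /andP[d0 d1]].
    exists (cst 0); split => //.
    - by move=> x /andP[x0 _]; rewrite /g mule_ge0 ?poweR_ge0// lee_fin invr_ge0 ltW.
    - by rewrite integral0 mul0r.
  have d20 : (0 < delta / 2)%R by rewrite divr_gt0.
  have [r /andP[r0 rd] lr] := bad _ d20.
  have rdelta : (0 < r <= 1)%R by rewrite r0/=; lra.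
  have [h [mh h0 hout hg hint]] := IH r rdelta.
  pose J : set (measurableTypeR R) := `[r, (2 * r)%R[%classic.
  have mJ : measurable J by exact: measurable_itv.
  have c0 : (0 <= k / (2 * r))%R by rewrite divr_ge0 ?mulr_ge0 ?ltW.
  pose h' x := (k / (2 * r))%:E * (\1_J x)%:E.
  have h'0 x : 0 <= h' x by rewrite mule_ge0 ?lee_fin.
  have mh' : measurable_fun setT h'.
    apply: measurable_funeM; apply/measurable_EFinP; exact: measurable_indic.
  exists (fun x => h x + h' x); split.
  - exact: emeasurable_funD.
  - by move=> x; rewrite adde_ge0.
  - move=> x nx; rewrite hout; last by move=> /andP[x0 xr]; apply: nx; rewrite x0/=; lra.
    rewrite /h' indicE memNset ?mule0 ?adde0//.
    by rewrite /J/= in_itv/= => /andP[x1 x2]; apply: nx; apply/andP; split; lra.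
  - move=> x /andP[x0 xd]; have [xr|rx] := ltP x r.
      rewrite /h' indicE memNset ?mule0 ?adde0//; first by apply: hg; rewrite x0.
      by rewrite /J/= in_itv/= leNgt xr.
    rewrite hout ?add0e; last by move=> /andP[_]; rewrite ltNge rx.
    rewrite /h' indicE; have [xJ|xJ] := boolP (x \in J).
      rewrite mule1; apply: (g_lower r0 l0 lr).
      by move: xJ; rewrite inE /J/= in_itv.
    by rewrite mule0 /g mule_ge0 ?poweR_ge0// lee_fin invr_ge0 ltW.
  - rewrite ge0_integralD// -natr1 mulrDl mul1r EFinD leeD//.
    rewrite ge0_integralZl//; last by apply/measurable_EFinP; exact: measurable_indic.
    have lJ : lebesgue_measure [set` `[r, (2 * r)%R[] = r%:E.
      rewrite lebesgue_measure_itv/= lte_fin ifT; last lra.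
      by rewrite -EFinB; congr _%:E; ring.
    rewrite integral_indic// setIT [X in _ * X]lJ -EFinM lee_fin le_eqVlt; apply/orP; left; apply/eqP; field.
    by rewrite gt_eqF.
have le_int (N : nat) : (N%:R * (k / 2))%:E <= \int[lebesgue_measure]_(r in `]0%R, 1%R[) g r.
  have d01 : (0 < (1 : R) <= 1)%R by rewrite ltr01 lexx.
  have [h [mh h0 hout hg hint]] := steps N _ d01.
  apply: (le_trans hint).
  rewrite [leLHS](_ : _ = \int[lebesgue_measure]_(x in `]0%R, 1%R[) h x); last first.
    rewrite [RHS]integral_mkcond; apply: eq_integral => x _; rewrite /patch.
    by case: ifPn => // /negP; rewrite inE/= in_itv/= => /hout.
  by apply: ge0_le_integral_any => // x; rewrite /= in_itv/=; exact: hg.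
move: fin le_int; set I := \int[_]_(_ in _) _ => fin le_int.
have If : I \is a fin_num.
  rewrite ge0_fin_numE// integral_ge0// => x; rewrite /= in_itv/= => /andP[x0 _].
  by rewrite /g mule_ge0 ?poweR_ge0// lee_fin invr_ge0 ltW.
have := le_int (Num.bound (`|fine I| / (k / 2))); rewrite -(fineK If) lee_fin; apply/negP.
rewrite -ltNge (le_lt_trans (ler_norm _))// -ltr_pdivrMr ?divr_gt0//.
by rewrite archi_boundP// divr_ge0// divr_ge0// ltW.
Qed.

End energy.

(** * Coverings by graphs *)
Section graph_covering.
Variables (R : realType) (n d : nat).
Variables (lam : {measure set (borel_rV R n) -> \bar R}).
Hypothesis n0 : (0 < n)%N.
Hypothesis lamB : forall x r, 0 < r -> lam (ball x r) = ((2 * r) ^+ n)%:E.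
Variable mu : {measure set (borel_rV R d) -> \bar R}.
Hypothesis mu_reg : outer_regular mu.
Hypothesis mu_lf : locally_finite mu.
Variables (L : 'M[R]_(n, d)) (c : R).
Hypothesis c0 : 0 < c.
Hypothesis hL : lower_bound_mx L c.
Variable a : R.
Hypothesis a0 : 0 < a.
Implicit Types (x y z : 'rV[R]_d) (A : set 'rV[R]_d).

Let K x b := wcone (perp L) x b.
Let TK x r := K x a `&` eball x r.
Let tau := c * a / 8.

Let tau0 : 0 < tau. Proof. by rewrite divr_gt0// mulr_gt0. Qed.

Let K_neq x b y : K x b y -> 0 < b -> 0 < enorm (x - y).
Proof.
move=> [v _ h] b0; have := le_lt_trans (enorm_ge0 _) h.
by rewrite pmulr_rgt0.
Qed.

(** The supremum of the distances to points in the narrow cone need not be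
    attained; half of it is. *)
Let far_point A x y0 rho q : A `<=` ball q rho -> A x -> A y0 -> K x (a / 2) y0 ->
  exists y, [/\ A y, K x (a / 2) y, 0 < enorm (x - y) <= 2 * d.+1%:R * rho &
    forall z, A z -> K x (a / 2) z -> enorm (x - z) <= 2 * enorm (x - y)].
Proof.
move=> Aq Ax Ay0 Ky0.
have a20 : 0 < a / 2 by rewrite divr_gt0.
pose E := [set enorm (x - y) | y in A `&` K x (a / 2)].
have bnd y : A y -> enorm (x - y) <= 2 * d.+1%:R * rho.
  move=> Ay; have := Aq _ Ax; have := Aq _ Ay; rewrite !ball_rV/= => h1 h2.
  rewrite (le_trans (enorm_le_norm _))//.
  apply: (@le_trans _ _ (d.+1%:R * (rho + rho))); last by rewrite mulrAC -mulrA mulrC mulrA mulrC; lra.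
  rewrite ler_pM ?ler_nat//.
  by rewrite (le_trans (ler_distD q _ _))// lerD ?[`|x - q|]distrC ?ltW.
have supE : has_sup E.
  split; first by exists (enorm (x - y0)), y0.
  by exists (2 * d.+1%:R * rho) => _ [y [Ay _] <-]; exact: bnd.
have sup0 : 0 < sup E.
  apply: (lt_le_trans (K_neq Ky0 a20)); apply: sup_upper_bound => //.
  by exists y0.
have sup20 : 0 < sup E / 2 by rewrite divr_gt0.
have [_ [y [Ay Ky] <-] hy] := sup_adherent sup20 supE.
exists y; split => //; first by rewrite (K_neq Ky)//= bnd.
move=> z Az Kz; have : enorm (x - z) <= sup E.
  by apply: sup_upper_bound => //; exists z.
by move: hy; lra.
Qed.

(** If [z] lies in the narrow cone at [x] then it is close to [x] by the choice of
    [y]. Otherwise [z] is much closer to [x] than [y] is, since their projections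
    nearly agree, and the direction from [y] to [z] is nearly that from [y] to [x]. *)
Let two_cones x y z : K x (a / 2) y -> 0 < enorm (x - y) ->
  (K x (a / 2) z -> enorm (x - z) <= 2 * enorm (x - y)) ->
  enorm ((z - x) *m L^T) <= tau * enorm (x - y) ->
  (TK x (3 * enorm (x - y)) `|` TK y (3 * enorm (x - y))) z.
Proof.
move=> [v Lv hv] k0 hz hpi; set k := enorm (x - y) in k0 hz hpi hv *.
have [Kz|nKz] := pselect (K x (a / 2) z).
  left; split; first by apply: wconeS Kz => //; rewrite ler_pdivrMr// ler_pMr//; lra.
  by rewrite /eball/= (le_lt_trans (hz Kz))//; lra.
right; have := notin_wcone c0 hL nKz => hxz.
have {}hxz : enorm (x - z) <= k / 4.
  have a20 : 0 < a / 2 by rewrite divr_gt0.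
  rewrite -(ler_pM2l a20) (le_trans hxz)// ler_pdivrMr// (le_trans hpi)//.
  by rewrite /tau le_eqVlt; apply/orP; left; apply/eqP; field.
have [w [wL hw]] := lift_perp ((z - x) *m L^T) c0 hL.
have {}hw : enorm w <= a * k / 8.
  rewrite -(ler_pM2l c0) (le_trans hw)// (le_trans hpi)// /tau.
  by rewrite le_eqVlt; apply/orP; left; apply/eqP; field.
have yz1 : enorm (y - z) <= 5 / 4 * k.
  rewrite (le_trans (enorm_dist x _ _))// (enormBC y x) -/k; lra.
have yz2 : 3 / 4 * k <= enorm (y - z).
  by have := enorm_dist z x y; rewrite (enormBC z y) -/k; lra.
split; last by rewrite /eball/= (le_lt_trans yz1)//; lra.
exists (z - x - w - v).
  by rewrite /perp/= mulmxBl Lv subr0 mulmxBl wL subrr.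
have -> : z - y - (z - x - w - v) = w - (y - x - v).
  by apply/rowP => i; rewrite !mxE; ring.
rewrite (le_lt_trans (enormD _ _))// enormN.
apply: (@lt_le_trans _ _ (a * k / 8 + a / 2 * k)); first by rewrite ler_ltD.
have ak : 0 < a * k by rewrite mulr_gt0.
have := ler_wpM2l (ltW a0) yz2; lra.
Qed.

(** Let [x] be in the wide part, [y] far from it in its narrow cone. By [two_cones]
    the points of [A] that project to a ball of radius proportional to [|x - y|]
    around the projection of [x] have measure at most [l] times the volume of that
    ball. Vitali's lemma in [R^n] adds up these bounds to [l] times the volume of
    the projection of [A]. *)
Lemma wide_part_small : exists2 C, 0 < C &
  forall (A : set 'rV[R]_d) (l delta rho : R) (q : 'rV[R]_d), 0 <= l -> 0 < rho ->
  A `<=` ball q rho -> 6 * d.+1%:R * rho < delta ->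
  (forall x, A x -> forall r, 0 < r < delta -> (mu (TK x r) <= (l * r ^+ n)%:E)%E) ->
  ((mu^*)%mu [set x | A x /\ exists2 y, A y & K x (a / 2) y] <= (C * l * rho ^+ n)%:E)%E.
Proof.
pose s0 := mxsum L^T; have s00 : 0 <= s0 by exact: mxsum_ge0.
pose b0 := s0 * d.+1%:R + 2 * tau * d.+1%:R + 1.
have b00 : 0 < b0.
  by rewrite /b0 -addrA ltr_wpDl ?mulr_ge0// ltr_wpDl ?mulr_ge0// ltW.
have nR : 0 < n%:R :> R by rewrite ltr0n.
pose C1 := 2 * (15 * n%:R / (2 * tau)) ^+ n.
have C10 : 0 < C1.
  by rewrite mulr_gt0// exprn_gt0// divr_gt0// mulr_gt0.
exists (C1 * (2 * b0) ^+ n); first by rewrite mulr_gt0// exprn_gt0// mulr_gt0.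
move=> A l delta rho q l0 rho0 Aq rdelta hA.
set A' := [set x | _].
have /choice[xy hxy] : forall p : 'rV[R]_n, exists xy : 'rV[R]_d * 'rV[R]_d,
    [set x *m L^T | x in A'] p ->
    [/\ A xy.1, xy.1 *m L^T = p, A xy.2 & [/\ K xy.1 (a / 2) xy.2,
      0 < enorm (xy.1 - xy.2) <= 2 * d.+1%:R * rho &
      forall z, A z -> K xy.1 (a / 2) z -> enorm (xy.1 - z) <= 2 * enorm (xy.1 - xy.2)]].
  move=> p; have [Pp|nP] := pselect ([set x *m L^T | x in A'] p); last by exists (0, 0).
  have [x [Ax [y0 Ay0 Ky0]] xp] := Pp.
  by have [y [Ay Ky hk hz]] := far_point Aq Ax Ay0 Ky0; exists (x, y) => _.
pose kk p := enorm ((xy p).1 - (xy p).2).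
pose rad p := tau * kk p / (5 * n%:R).
have rmax_ok p : [set x *m L^T | x in A'] p -> 0 < rad p <= tau * (2 * d.+1%:R * rho) / (5 * n%:R).
  move=> Pp; have [_ _ _ [_ /andP[k1 k2] _]] := hxy _ Pp.
  apply/andP; split; first by rewrite divr_gt0// mulr_gt0.
  by rewrite /rad ler_pM2r ?invr_gt0 ?mulr_gt0// ler_pM2l.
have [pp [s [hs tr cov]]] := vitali_covering rmax_ok.
have sge0 i : 0 <= s i.
  by have [->|[Pp ->]] := hs i => //; have /andP[/ltW] := rmax_ok _ Pp.
have pack k : \sum_(i < k) (2 * s i) ^+ n <= (2 * (b0 * rho)) ^+ n.
  apply: (packing n0 lamB sge0 tr (ball_open (q *m L^T) (b0 * rho))); last first.
    by rewrite lamB// mulr_gt0.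
  move=> w [i _]; have [->|[Pp si]] := hs i; first by rewrite ball_rV0.
  have /andP[_] := rmax_ok _ Pp; rewrite -si !ball_rV/= => sib wi.
  have [Ax xp _ _] := hxy _ Pp.
  rewrite (le_lt_trans (ler_distD (pp i) _ _))//.
  have h1 : `|q *m L^T - pp i| <= s0 * d.+1%:R * rho.
    rewrite -xp -mulmxBl (le_trans (norm_le_enorm _))// (le_trans (enorm_mulmx _ _))//.
    rewrite -mulrA ler_wpM2l// (le_trans (enorm_le_norm _))//.
    rewrite ler_pM ?ler_nat//.
    by have := Aq _ Ax; rewrite ball_rV => /ltW.
  have h2 : tau * (2 * d.+1%:R * rho) / (5 * n%:R) <= 2 * tau * d.+1%:R * rho.
    rewrite ler_pdivrMr ?mulr_gt0//.
    rewrite [X in X <= _](_ : _ = 2 * tau * d.+1%:R * rho * 1); last by ring.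
    rewrite ler_pM2l; last by rewrite !mulr_gt0.
    by rewrite -natrM ler1n muln_gt0.
  rewrite (le_lt_trans (lerD h1 (ltW (lt_le_trans wi (le_trans sib h2)))))//.
  rewrite [ltRHS](_ : _ = s0 * d.+1%:R * rho + 2 * tau * d.+1%:R * rho + rho).
    by rewrite ltrDl.
  by rewrite /b0; ring.
pose Z i := A' `&` [set z | ball (pp i) (5 * s i) (z *m L^T)].
have muZ i : ((mu^*)%mu (Z i) <= (C1 * l * (2 * s i) ^+ n)%:E)%E.
  have [si|[Pp si]] := hs i.
    have -> : Z i = set0 by rewrite -subset0 => z [_]/=; rewrite si mulr0 ball_rV0.
    apply: (@le_trans _ _ 0%E); first by rewrite [leLHS]mu_ext0.
    rewrite lee_fin; apply: mulr_ge0; first by apply: mulr_ge0 => //; exact: ltW.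
    by rewrite exprn_ge0// mulr_ge0.
  have [Ax xp Ay [Kxy /andP[k1 k2] hk]] := hxy _ Pp.
  set x := (xy (pp i)).1 in Ax xp Kxy k1 k2 hk; set y := (xy (pp i)).2 in Ay Kxy k1 k2 hk.
  have sE : kk (pp i) = 5 * n%:R / tau * s i.
    by rewrite si /rad; field; rewrite ?gt_eqF.
  have kE : kk (pp i) = enorm (x - y) by [].
  have r3 : 0 < 3 * enorm (x - y) < delta.
    rewrite mulr_gt0//=; apply: le_lt_trans rdelta.
    apply: (@le_trans _ _ (3 * (2 * d.+1%:R * rho))); first by rewrite ler_pM2l.
    by rewrite !mulrA -natrM.
  have mTK z r : measurable (TK z r : set (borel_rV R d)).
    apply: measurable_open_rV; apply: openI; last exact: open_eball.
    exact/open_wcone/ltW.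
  apply: (@le_trans _ _ ((mu^*)%mu (TK x (3 * enorm (x - y)) `|` TK y (3 * enorm (x - y))))).
    apply: le_mu_ext => z [[Az _]]; rewrite /= ball_rV/= => hz.
    apply: two_cones => //; first by move=> Kz; exact: hk.
    rewrite mulmxBl xp (le_trans (enorm_le_norm _))// distrC.
    rewrite (le_trans (ler_wpM2l _ (ltW hz)))// -kE sE.
    by rewrite le_eqVlt; apply/orP; left; apply/eqP; field; rewrite ?gt_eqF.
  rewrite (le_trans (outer_measureU2 _ _ _))//.
  have ext z : A z ->
      ((mu^*)%mu (TK z (3 * enorm (x - y))) <= (l * (3 * enorm (x - y)) ^+ n)%:E)%E.
    by move=> Az; rewrite (measurable_mu_extE mu)//; exact: hA.
  rewrite (le_trans (leeD (ext _ Ax) (ext _ Ay)))// -EFinD lee_fin.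
  rewrite -kE sE le_eqVlt; apply/orP; left; apply/eqP.
  rewrite /C1 (_ : 3 * (5 * n%:R / tau * s i) = (15 * n%:R / (2 * tau)) * (2 * s i)).
    by rewrite exprMn; ring.
  by field; rewrite ?gt_eqF.
apply: (@le_trans _ _ (\sum_(0 <= i <oo) (mu^*)%mu (Z i))%E).
  apply: le_trans (outer_measure_sigma_subadditive (mu^*)%mu _).
  apply: le_mu_ext => z A'z; have [|i _ hi] := cov (z *m L^T); first by exists z.
  by exists i.
apply: (@le_trans _ _ (\sum_(0 <= i <oo) (C1 * l * (2 * s i) ^+ n)%:E)%E).
  by apply: lee_nneseries => i * //; exact: mu_ext_ge0.
apply: nneseries_le_partial => [i|k].
  apply: mulr_ge0; first by apply: mulr_ge0 => //; exact: ltW.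
  by rewrite exprn_ge0// mulr_ge0.
have C1l : 0 <= C1 * l by apply: mulr_ge0 => //; exact: ltW.
rewrite -mulr_sumr (le_trans (ler_wpM2l C1l (pack k)))//.
by rewrite mulrA exprMn le_eqVlt; apply/orP; left; apply/eqP; ring.
Qed.

(** Cut [G] into countably many small sets [A] on which the cones have density at
    most [l] up to a fixed scale. In a Vitali ball, the wide part of [A] has measure
    at most a fraction of that of the ball, because the density of the ball is
    bounded below; hence what remains after removing all narrow parts is null. *)
Lemma graph_covering (k0 : nat) :
  let G := [set x | (forall l, 0 < l -> exists2 delta, 0 < delta &
                      forall r, 0 < r < delta -> (mu (TK x r) <= (l * r ^+ n)%:E)%E) /\
                    (forall delta, 0 < delta -> exists2 r, 0 < r < delta &
                      ((k0.+1%:R^-1 * r ^+ n)%:E < mu (eball x r))%E)] in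
  exists S : nat -> set 'rV[R]_d,
    (forall i x y, S i x -> S i y -> ~ K x (a / 2) y) /\
    mu.-negligible (G `\` \bigcup_i S i).
Proof.
move=> G; have [C C0 hC] := wide_part_small.
have k00 : 0 < k0.+1%:R^-1 :> R by rewrite invr_gt0.
(* [l] is such that the covering argument loses half of the measure *)
pose l : R := k0.+1%:R^-1 / (2 * C * 7 ^+ n).
have D0 : 0 < 2 * C * 7 ^+ n by rewrite mulr_gt0 ?exprn_gt0// mulr_gt0.
have l0 : 0 < l by rewrite divr_gt0.
pose E (m : nat) : set 'rV[R]_d :=
  [set x | forall r, 0 < r < m.+1%:R^-1 -> (mu (TK x r) <= (l * r ^+ n)%:E)%E].
pose A (i : nat * (nat * 'rV[int]_d) * rat) :=
  E i.1.1 `&` ball (ratmx R i.1.2.1 i.1.2.2) (ratr i.2).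
pose wide B := [set x | B x /\ exists2 y, B y & K x (a / 2) y].
pose S i : set 'rV[R]_d := if unpickle i is Some j then A j `\` wide (A j) else set0.
exists S; split.
  move=> i x y; rewrite /S; case: (unpickle i) => // j [Ax nW] [Ay _] Kxy.
  by apply: nW; split => //; exists y.
suff h (m : nat) : mu.-negligible ((G `&` E m) `\` \bigcup_i S i).
  apply: (negligibleS _ (negligible_bigcup h)) => x [Gx nS].
  have [delta d0 hd] := Gx.1 _ l0; have [m md] := exists_invS_lt d0.
  exists m => //; split => //; split => // r /andP[r1 r2].
  by apply: hd; rewrite r1 (lt_trans r2).
apply: negligible_bounded => N; set P := _ `&` _.
have Pfin : ((mu^*)%mu P < +oo)%E by apply: (mu_ext_bounded mu_lf); exact: subIsetr.
apply: (proportion_negligible mu_reg Pfin (q := 2^-1)).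
  by rewrite invr_ge0 ler0n invf_lt1 ?ltr1n.
move=> U oU PU.
pose rmax : R := m.+1%:R^-1 / (42 * d.+1%:R).
have rmax0 : 0 < rmax by rewrite divr_gt0 ?invr_gt0 ?mulr_gt0.
pose Q x (r : R) := ((k0.+1%:R^-1 * r ^+ n)%:E < mu (ball x r))%E.
have fine_radii x : P x -> forall e : R, 0 < e -> exists r, 0 < r < e /\ Q x r.
  move=> [[[[_ h] _] _] _] e e0; have [r re hr] := h _ e0; exists r; split => //.
  apply: (lt_le_trans hr); apply: le_measure; rewrite ?inE.
  - by apply: measurable_open_rV; exact: open_eball.
  - by apply: measurable_open_rV; exact: ball_open.
  - exact: eball_ball.
have [p [s [h1 h2 h3 h4]]] := vitali_open oU PU rmax0 fine_radii.
have s0 i : 0 <= s i by have [->|[_ /andP[/ltW]]] := h1 i.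
have local i : ((mu^*)%mu (P `&` ball (p i) (5 * s i)%R) <=
    (2^-1)%:E * mu (ball (p i) (s i)))%E.
  have [->|[Pp /andP[si sr] Qi]] := h1 i.
    rewrite [leLHS](_ : _ = 0%E) ?mule_ge0 ?lee_fin//.
    by rewrite mulr0 ball_rV0// setI0 mu_ext0.
  have [q [M qM]] := ratmx_dense (p i) si.
  have lt67 : 6 * s i < 7 * s i by rewrite ltr_pM2r// ltr_nat.
  have [rho] := rat_in_itvoo lt67; rewrite in_itv/= => /andP[rho1 rho2].
  pose j := (m, (q, M), rho).
  have rho0 : 0 < ratr rho :> R by rewrite (lt_trans _ rho1)// mulr_gt0.
  have sub : P `&` ball (p i) (5 * s i) `<=` wide (A j).
    move=> x [[[[Gx Ex] nS] _]]; rewrite ball_rV/= => px.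
    apply: contrapT => nW; apply: nS; exists (pickle j) => //; rewrite /S pickleK.
    split => //; split => //; rewrite ball_rV/=.
    rewrite (le_lt_trans (ler_distD (p i) _ _))// [X in X + _]distrC; lra.
  apply: (le_trans (le_mu_ext mu sub)).
  apply: (@le_trans _ _ (C * l * ratr rho ^+ n)%:E).
    apply: (hC (A j) l m.+1%:R^-1 (ratr rho) (ratmx R q M)) => //; first exact: ltW.
    - by move=> x [].
    - apply: (@lt_le_trans _ _ (42 * d.+1%:R * s i)).
        rewrite [ltRHS](_ : _ = 6 * d.+1%:R * (7 * s i)); last by ring.
        by rewrite ltr_pM2l ?mulr_gt0.
      by rewrite mulrC -ler_pdivlMr ?mulr_gt0// ltW.
    - by move=> x [Ex _]; exact: Ex.
  apply: (@le_trans _ _ ((2^-1)%:E * (k0.+1%:R^-1 * s i ^+ n)%:E)%E); last first.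
    by rewrite lee_pmul2l ?lte_fin ?invr_gt0// ltW.
  rewrite -EFinM lee_fin; apply: (@le_trans _ _ (C * l * (7 * s i) ^+ n)).
    apply: ler_wpM2l; first by rewrite ltW// mulr_gt0.
    by apply: lerXn2r; rewrite ?nnegrE ?(ltW rho0) ?(ltW rho2)// mulr_ge0.
  rewrite /l exprMn le_eqVlt; apply/orP; left; apply/eqP; field.
  by rewrite !gt_eqF ?exprn_gt0//= -[0](natrD _ 0 0)/= ?gt_eqF.
apply: (@le_trans _ _ (\sum_(0 <= i <oo) (2^-1)%:E * mu (ball (p i) (s i)))%E).
  apply: (@le_trans _ _ (\sum_(0 <= i <oo) (mu^*)%mu (P `&` ball (p i) (5 * s i)%R))%E).
    apply: le_trans (outer_measure_sigma_subadditive (mu^*)%mu _).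
    by apply: le_mu_ext => x Px; have [i _ hi] := h4 _ Px; exists i.
  by apply: lee_nneseries => i * //; exact: mu_ext_ge0.
rewrite nneseriesZl//; apply: lee_wpmul2l; first by rewrite lee_fin.
have mB i : measurable (ball (p i) (s i) : set (borel_rV R d)).
  by apply: measurable_open_rV; exact: ball_open.
rewrite -measure_semi_bigcup//; last exact: bigcupT_measurable.
apply: le_measure; rewrite ?inE//; first exact: bigcupT_measurable.
exact: measurable_open_rV.
Qed.

End graph_covering.

(** * Lipschitz graphs *)

Section graphs.
Variables (R : realType) (n d : nat).
Variables (S : set 'rV[R]_d) (L : 'M[R]_(n, d)) (kappa : R).
Hypothesis k0 : 0 < kappa.
Hypothesis SL : forall x y, S x -> S y -> kappa * enorm (x - y) <= enorm ((x - y) *m L^T).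

(** McShane's extension of the inverse of the projection, coordinate by
    coordinate. *)
Lemma graph_lipschitz : exists f : 'rV[R]_n -> 'rV[R]_d, lipschitz_map f /\ S `<=` range f.
Proof.
have [S0|/set0P[x0 Sx0]] := eqVneq S set0.
  exists (fun=> 0); split; last by rewrite S0.
  by exists 0 => x y; rewrite subrr enorm0 mul0r.
have K0 : 0 <= kappa^-1 by rewrite invr_ge0 ltW.
have SL' x y : S x -> S y -> enorm (x - y) <= kappa^-1 * enorm (x *m L^T - y *m L^T).
  by move=> Sx Sy; rewrite -mulmxBl ler_pdivlMl//; exact: SL.
pose E j q := [set x 0 j + kappa^-1 * enorm (q - x *m L^T) | x in S].
pose F j q := inf (E j q).
have hasinf j q : has_inf (E j q).
  split; first by exists (x0 0 j + kappa^-1 * enorm (q - x0 *m L^T)), x0.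
  exists (x0 0 j - kappa^-1 * enorm (q - x0 *m L^T)) => _ [x Sx <-].
  have h1 := SL' _ _ Sx0 Sx; have h2 := coord_le_enorm (x0 - x) j.
  have h3 := ler_wpM2l K0 (enorm_dist q (x0 *m L^T) (x *m L^T)).
  rewrite mulrDr (enormBC _ q) in h3; rewrite !mxE in h2.
  have := ler_norm (x0 0 j - x 0 j); lra.
have FL j q q' : F j q - F j q' <= kappa^-1 * enorm (q - q').
  rewrite lerBlDr addrC -lerBlDr; apply: lb_le_inf; first by have [] := hasinf j q'.
  move=> _ [x Sx <-]; rewrite lerBlDr.
  apply: (@le_trans _ _ (x 0 j + kappa^-1 * enorm (q - x *m L^T))).
    by apply: ge_inf; [have [] := hasinf j q|exists x].
  have := ler_wpM2l K0 (enorm_dist q' q (x *m L^T)); rewrite mulrDr; lra.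
exists (fun q => \row_j F j q); split.
  exists (d%:R * kappa^-1) => q q'; rewrite (le_trans (enorm_le_sum _))//.
  apply: (@le_trans _ _ (\sum_(j < d) kappa^-1 * enorm (q - q'))).
    apply: ler_sum => j _; rewrite !mxE ler_norml FL andbT lerNl opprB enormBC.
    exact: FL.
  by rewrite sumr_const card_ord -[leLHS]mulr_natl mulrA.
move=> x Sx; exists (x *m L^T) => //; apply/rowP => j; rewrite mxE.
apply/eqP; rewrite eq_le; apply/andP; split.
  apply: ge_inf; first by have [] := hasinf j (x *m L^T).
  by exists x => //; rewrite subrr enorm0 mulr0 addr0.
apply: lb_le_inf; first by have [] := hasinf j (x *m L^T).
move=> _ [y Sy <-]; have h1 := SL' _ _ Sx Sy; have h2 := coord_le_enorm (x - y) j.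
rewrite !mxE in h2; have := ler_norm (x 0 j - y 0 j); lra.
Qed.

Variables (lam : {measure set (borel_rV R n) -> \bar R}).
Hypothesis n0 : (0 < n)%N.
Hypothesis lamB : forall x r, 0 < r -> lam (ball x r) = ((2 * r) ^+ n)%:E.
Variable mu : {measure set (borel_rV R d) -> \bar R}.

(** A null set inside a graph projects to a null set of [R^n], which Vitali
    balls cover economically; the balls above them have controlled measure. *)
Lemma graph_content_negligible (k : R) : content_zero n S ->
  (forall x, S x -> forall delta, 0 < delta -> exists2 r, 0 < r < delta &
     (mu (eball x r) < (k * r ^+ n)%:E)%E) ->
  mu.-negligible S.
Proof.
move=> cS hS; have kp x : S x -> 0 < k.
  move=> Sx; have [r /andP[r0 _] h] := hS x Sx 1 ltr01.
  have := le_lt_trans (measure_ge0 mu _) h.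
  by rewrite lte_fin pmulr_lgt0// exprn_gt0.
have [S0|/set0P[x0 Sx0]] := eqVneq S set0; first by rewrite S0; exact: negligible_set0.
have {kp} kp := kp _ Sx0.
apply: mu_ext0_negligible; apply/eqP; rewrite eq_le; apply/andP; split; last exact: mu_ext_ge0.
apply/lee_addgt0Pr => e' e'0; rewrite add0e.
pose K := (mxsum L^T + 1) * d.+1%:R.
have K0 : 0 < K by rewrite mulr_gt0// ltr_wpDl ?mxsum_ge0.
have nR : 0 < n%:R :> R by rewrite ltr0n.
pose c' := 5 * n%:R / kappa.
have c'0 : 0 < c' by rewrite divr_gt0// mulr_gt0.
have D0 : 0 < k * (c' * K) ^+ n by rewrite mulr_gt0// exprn_gt0// mulr_gt0.
pose e := e' / (k * (c' * K) ^+ n).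
have e0 : 0 < e by rewrite divr_gt0.
have [c [s [s0 Sc hs]]] := cS _ e0.
pose U := \bigcup_i ball (c i *m L^T) (K * s i).
have oU : open U by apply: bigcup_open => i _; exact: ball_open.
pose P := [set x *m L^T | x in S].
have PU : P `<=` U.
  move=> _ [x Sx <-]; have [i _] := Sc _ Sx; rewrite ball_rV/= => hx; exists i => //.
  rewrite ball_rV/= -mulmxBl (le_lt_trans (norm_le_enorm _))//.
  rewrite (le_lt_trans (enorm_mulmx _ _))//.
  apply: (@le_lt_trans _ _ ((mxsum L^T + 1) * (d.+1%:R * `|c i - x|))).
    rewrite ler_pM ?mxsum_ge0 ?lerDl//.
    by rewrite (le_trans (enorm_le_norm _))// ler_wpM2r// ler_nat.
  by rewrite mulrA ltr_pM2l.
have lU : (lam U <= ((2 * K) ^+ n * e)%:E)%E.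
  apply: (@le_trans _ _ (\sum_(0 <= i <oo) lam (ball (c i *m L^T) (K * s i)%R))%E).
    apply: measure_sigma_subadditive; last exact: subset_refl.
    - by move=> i; apply: measurable_open_rV; exact: ball_open.
    - exact: measurable_open_rV.
  apply: (@le_trans _ _ (\sum_(0 <= i <oo) ((2 * K) ^+ n * s i ^+ n)%:E)%E).
    apply: lee_nneseries => i * //; have Ks : 0 <= K * s i.
      by apply: mulr_ge0 => //; exact: ltW.
    by rewrite (lamB0 n0 lamB)// mulrA exprMn.
  have KK : 0 <= (2 * K) ^+ n by rewrite exprn_ge0// mulr_ge0// ltW.
  apply: nneseries_le_partial => [i|m]; first by rewrite mulr_ge0// exprn_ge0.
  by rewrite -mulr_sumr ler_wpM2l.
have /choice[g hg] : forall p, exists x, P p -> S x /\ x *m L^T = p.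
  by move=> p; have [[x Sx <-]|nP] := pselect (P p); [exists x|exists 0].
pose Q p r := (mu (eball (g p) (c' * r)) < (k * (c' * r) ^+ n)%:E)%E.
have fine_radii p : P p -> forall e1 : R, 0 < e1 -> exists r, 0 < r < e1 /\ Q p r.
  move=> Pp e1 e10; have [Sg _] := hg _ Pp.
  have [r /andP[r0 re] hr] := hS _ Sg (c' * e1) (mulr_gt0 c'0 e10).
  exists (r / c'); split; first by rewrite divr_gt0//= ltr_pdivrMr// mulrC.
  by rewrite /Q mulrC divfK ?gt_eqF.
have [q [t [h1 h2 h3 h4]]] := vitali_open oU PU ltr01 fine_radii.
have t0 i : 0 <= t i by have [->|[_ /andP[/ltW]]] := h1 i.
have mE i : measurable (eball (g (q i)) (c' * t i) : set (borel_rV R d)).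
  by apply: measurable_open_rV; exact: open_eball.
have cov : S `<=` \bigcup_i eball (g (q i)) (c' * t i).
  move=> x Sx; have [|i _] := h4 (x *m L^T); first by exists x.
  have [->|[Pq _ _]] := h1 i; first by rewrite mulr0 ball_rV0.
  rewrite ball_rV/= => hx; exists i => //; have [Sg gq] := hg _ Pq.
  rewrite /eball/= /c' -(ltr_pM2l k0) (le_lt_trans (SL Sg Sx))//.
  rewrite mulmxBl gq (le_lt_trans (enorm_le_norm _))//.
  rewrite [ltRHS](_ : _ = n%:R * (5 * t i)); first by rewrite ltr_pM2l.
  by field; rewrite gt_eqF.
apply: (@le_trans _ _ (\sum_(0 <= i <oo) mu (eball (g (q i)) (c' * t i)%R))%E).
  apply: (le_trans (le_mu_ext mu cov)).
  rewrite (measurable_mu_extE mu); last exact: bigcupT_measurable.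
  by apply: measure_sigma_subadditive => //; exact: bigcupT_measurable.
apply: (@le_trans _ _ (\sum_(0 <= i <oo) (k * c' ^+ n / 2 ^+ n * (2 * t i) ^+ n)%:E)%E).
  apply: lee_nneseries => i * //; have [->|[_ _ hQ]] := h1 i.
    rewrite mulr0 (_ : eball _ _ = set0) ?measure0 ?lee_fin.
      by rewrite mulr0 expr0n gtn_eqF// mulr0.
    by rewrite -subset0 => y; rewrite /eball/= ltNge enorm_ge0.
  rewrite (le_trans (ltW hQ))// lee_fin !exprMn le_eqVlt; apply/orP; left; apply/eqP.
  by field; rewrite expf_neq0.
have DD : 0 <= k * c' ^+ n / 2 ^+ n.
  by rewrite divr_ge0 ?exprn_ge0// mulr_ge0 ?exprn_ge0 ?(ltW kp) ?(ltW c'0).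
apply: nneseries_le_partial => [i|m].
  by rewrite mulr_ge0// exprn_ge0// mulr_ge0.
rewrite -mulr_sumr (le_trans (ler_wpM2l DD (packing n0 lamB t0 h2 oU h3 lU m)))//.
have [cn0 Kn0] : c' ^+ n != 0 /\ K ^+ n != 0 by rewrite !expf_neq0 ?gt_eqF.
rewrite /e [(2 * K) ^+ n]exprMn [(c' * K) ^+ n]exprMn; move: (c' ^+ n) (K ^+ n) cn0 Kn0 => u v u0 v0.
rewrite le_eqVlt; apply/orP; left; apply/eqP; field.
by rewrite u0 v0 gt_eqF ?expf_neq0.
Qed.

End graphs.

Lemma mxsumN (R : realType) n d (A : 'M[R]_(n, d)) : mxsum (- A) = mxsum A.
Proof. by apply: eq_bigr => i _; apply: eq_bigr => j _; rewrite mxE normrN. Qed.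

Lemma mxsum_tr (R : realType) n d (A : 'M[R]_(n, d)) : mxsum A^T = mxsum A.
Proof.
by rewrite /mxsum exchange_big; apply: eq_bigr => i _; apply: eq_bigr => j _; rewrite mxE.
Qed.

Lemma rat_plane_approx (R : realType) n d (L : 'M[R]_(n, d)) c e : 0 < c ->
  lower_bound_mx L c -> 0 < e ->
  exists k (M : 'M[int]_(n, d)), lower_bound_mx (ratmx R k M) (c / 2) /\
    mxsum (L - ratmx R k M) <= e.
Proof.
move=> c0 hL e0; have m0 : 0 < Num.min e (c / 2) by rewrite lt_min e0 divr_gt0.
have [k [M]] := ratmx_approx L m0; rewrite le_min => /andP[h1 h2].
exists k, M; split => // v; have h3 := hL v.
have h4 := enorm_mulmx v (L - ratmx R k M).
have h5 := ler_wpM2r (enorm_ge0 v) h2.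
have : enorm (v *m L) <= enorm (v *m (L - ratmx R k M)) + enorm (v *m ratmx R k M).
  by rewrite (_ : v *m L = v *m (L - ratmx R k M) + v *m ratmx R k M) ?enormD// -mulmxDr subrK.
lra.
Qed.

(** Balls are relatively compact, so the range is a countable union of compact
    sets. *)
Lemma measurable_range_lipschitz (R : realType) (n d : nat) (f : 'rV[R]_n -> 'rV[R]_d) :
  (0 < n)%N -> (0 < d)%N -> lipschitz_map f -> measurable (range f : set (borel_rV R d)).
Proof.
case: n d f => // n [//|d] f _ _ [L fL].
have cf : continuous f.
  move=> x A; rewrite -!nbhs_ballE => -[e /= e0 eA].
  pose K := (`|L| + 1) * n.+1%:R; have K0 : 0 < K by rewrite mulr_gt0// ltr_wpDl.
  exists (e / K) => /=; first by rewrite divr_gt0.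
  move=> y; rewrite ball_rV/= => xy; apply: eA; rewrite ball_rV/=.
  rewrite (le_lt_trans (norm_le_enorm _))// (le_lt_trans (fL _ _))//.
  apply: (@le_lt_trans _ _ ((`|L| + 1) * enorm (x - y))).
    by rewrite ler_wpM2r// (le_trans (ler_norm _))// lerDl.
  apply: (@le_lt_trans _ _ (K * `|x - y|)); last by rewrite mulrC -ltr_pdivlMr.
  by rewrite /K -mulrA ler_wpM2l ?addr_ge0// enorm_le_norm.
have -> : range f = \bigcup_(N in [set: nat]) f @` closed_ball (0 : 'rV[R]_n.+1) N.+1%:R.
  apply/seteqP; split => [_ [x _ <-]|y [N _ [x _ <-]]]; last by exists x.
  exists (Num.bound `|x|) => //; exists x => //.
  rewrite closed_ballE// /closed_ball_/= sub0r normrN.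
  by rewrite (le_trans (ltW (archi_boundP _)))// ler_nat.
apply: bigcupT_measurable => N; apply: measurable_closed_rV; apply: compact_closed.
  exact: norm_hausdorff.
apply: continuous_compact; first exact: continuous_subspaceT.
apply: bounded_closed_compact; last exact: closed_ball_closed.
rewrite closed_ballE//; exists N.+1%:R; split; first exact: num_real.
by move=> M hM x; rewrite /closed_ball_/= sub0r normrN => /le_trans; apply; exact: ltW.
Qed.

(** * Sufficiency *)
Section sufficiency.
Variables (R : realType) (n d : nat) (p : R).
Hypotheses (n0 : (0 < n)%N) (nd : (n < d)%N) (p0 : 0 < p).
Variable mu : {measure set (borel_rV R d) -> \bar R}.
Hypothesis mu_lf : locally_finite mu.

(** A piece of the graph of a Lipschitz function over the row space of [L], with a
    uniform bound on the lower density. *)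
Definition graph_piece (W : set 'rV[R]_d) := exists (L : 'M[R]_(n, d)) (kappa k : R),
  [/\ 0 < kappa,
      forall x y, W x -> W y -> kappa * enorm (x - y) <= enorm ((x - y) *m L^T) &
      forall x, W x -> forall delta, 0 < delta -> exists2 r, 0 < r < delta &
        (mu (eball x r) < (k * r ^+ n)%:E)%E].

Let d0 : (0 < d)%N. Proof. exact: leq_ltn_trans nd. Qed.

Lemma narrow_rat_cone x V alpha : grassmannian (d - n) V -> 0 < alpha < 1 ->
  exists k (M : 'M[int]_(n, d)) (m : nat),
    row_free (ratmx R k M) /\ wcone (perp (ratmx R k M)) x m.+1%:R^-1 `<=` cone x V alpha.
Proof.
move=> gV /andP[a0 a1]; have [L rL LV] := grassmannian_perp (ltnW nd) gV.
have [c c0 hL] := row_free_lower rL.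
have a20 : 0 < alpha / 2 by rewrite divr_gt0.
have [m ma] := exists_invS_lt a20.
have ca : 0 < c * alpha / 4 by rewrite divr_gt0// mulr_gt0.
have [k [M [hM LM]]] := rat_plane_approx c0 hL ca.
exists k, M, m; split; first by apply: (lower_row_free _ hM); rewrite divr_gt0.
rewrite coneE; apply: (@subset_trans _ (wcone (perp L) x alpha)); last exact: wconeS.
have m0 : 0 < m.+1%:R^-1 :> R by rewrite invr_gt0.
apply: (wcone_perturb c0 hL); first exact: ltW.
rewrite mxsum_tr -mxsumN opprB.
set a := m.+1%:R^-1 in m0 ma *.
have h1 : mxsum (L - ratmx R k M) / c <= alpha / 4.
  by rewrite ler_pdivrMr// mulrAC [alpha * c]mulrC.
have h2 : mxsum (L - ratmx R k M) / c * (1 + a) <= alpha / 4 * 2.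
  by apply: ler_pM => //; [rewrite divr_ge0 ?mxsum_ge0 ?ltW|lra|lra].
lra.
Qed.

(** Countably many rational planes, apertures and density bounds account for almost
    every point: a finite energy forces the density of a rational cone to vanish,
    by [energy_density], and [graph_covering] applies to each of these cases. *)
Lemma graph_decomposition :
  {ae mu, forall x : 'rV[R]_d,
     (0 < upper_density n mu x)%E /\ (lower_density n mu x < +oo)%E} ->
  {ae mu, forall x : 'rV[R]_d,
     exists2 V, grassmannian (d - n) V &
     exists alpha : R, 0 < alpha < 1 /\
       (conical_energy n mu p x V alpha 1 < +oo)%E} ->
  exists W : nat -> set 'rV[R]_d, (forall j, graph_piece (W j)) /\
    mu.-negligible (~` \bigcup_j W j).
Proof.
move=> dens en; have [lam [lamB _]] := lebesgue_rV_exists R n.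
have mu_reg := locally_finite_outer_regular mu_lf.
pose code : countType := (nat * 'M[int]_(n, d) * nat * nat)%type.
pose LL (c : code) : 'M[R]_(n, d) := ratmx R c.1.1.1 c.1.1.2.
pose aa (c : code) : R := c.1.2.+1%:R^-1.
have aa0 c : 0 < aa c by rewrite invr_gt0.
pose G (c : code) := [set x |
  (forall l, 0 < l -> exists2 delta, 0 < delta & forall r, 0 < r < delta ->
     (mu (wcone (perp (LL c)) x (aa c) `&` eball x r) <= (l * r ^+ n)%:E)%E) /\
  (forall delta, 0 < delta -> exists2 r, 0 < r < delta &
     ((c.2.+1%:R^-1 * r ^+ n)%:E < mu (eball x r))%E)].
have /choice[S hS] : forall c : code, exists S : nat -> set 'rV[R]_d, row_free (LL c) ->
    (forall i, exists2 kappa, 0 < kappa &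
       forall x y, S i x -> S i y -> kappa * enorm (x - y) <= enorm ((x - y) *m (LL c)^T)) /\
    mu.-negligible (G c `\` \bigcup_i S i).
  move=> c; have [rL|] := boolP (row_free (LL c)); last by exists (fun=> set0).
  have [b b0 hb] := row_free_lower rL.
  have [S [hS nS]] := graph_covering n0 lamB mu_reg mu_lf b0 hb (aa0 c) c.2.
  exists S => _; split => // i; exists (b * (aa c / 2)); first by rewrite !mulr_gt0.
  move=> x y Sx Sy; have := notin_wcone b0 hb (hS i x y Sx Sy).
  rewrite ler_pdivlMr// -[y - x]opprB mulNmx enormN => h.
  by rewrite -mulrA mulrC.
pose D (k : nat) := [set x | forall delta : R, 0 < delta -> exists2 r, 0 < r < delta &
  (mu (eball x r) < (k%:R * r ^+ n)%:E)%E].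
pose W j := if unpickle j is Some (c, i, k) then
  (if row_free (LL c) then S c i `&` D k else set0) else set0 : set 'rV[R]_d.
have gp0 : graph_piece set0 by exists 0, 1, 0; split.
exists W; split.
  move=> j; rewrite /W; case: (unpickle j) => [[[c i] k]|//].
  case: ifP => // rL; have [/(_ i)[kappa k0 h] _] := hS _ rL.
  exists (LL c), kappa, k%:R; split => // [x y [Sx _] [Sy _]|x [_]]; [exact: h|exact].
pose rest j := if unpickle j is Some c then
  (if row_free (LL c) then G c `\` \bigcup_i S c i else set0) else set0 : set 'rV[R]_d.
have nrest : mu.-negligible (\bigcup_j rest j).
  apply: negligible_bigcup => j; rewrite /rest; case: (unpickle j) => [c|]; last exact: negligible_set0.
  by case: ifP => [/hS[]//|_]; exact: negligible_set0.
apply: negligibleS (negligibleU (negligibleU dens en) nrest) => x nW.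
apply: contrapT => /not_orP[/not_orP[/contrapT[up lo] /contrapT[V gV [alpha [a01 en_x]]]] nr].
have [k0 _ hk0] := upper_density_pos up; have [k _ hk] := lower_density_fin lo.
have [q [M [m [rL sub]]]] := narrow_rat_cone x gV a01.
pose c : code := (q, M, m, k0).
have Gx : G c x.
  split => // l l0.
  have oT r : open (tcone x V alpha r).
    apply: openI; last exact: open_eball.
    by rewrite coneE; apply: open_wcone; case/andP: a01 => /ltW.
  have mT r : measurable (tcone x V alpha r : set (borel_rV R d)) by exact: measurable_open_rV.
  have ndT r s : r <= s -> tcone x V alpha r `<=` tcone x V alpha s.
    by move=> rs y [Ky yr]; split => //; rewrite /eball/= (lt_le_trans yr).
  have [delta delta0 hd] := energy_density p0 ndT oT en_x l0.
  exists delta => // r rd; apply: le_trans (hd r rd).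
  apply: le_measure; rewrite ?inE//.
    by apply: measurable_open_rV; apply: openI; [exact/open_wcone/ltW|exact: open_eball].
  by move=> y [Ky yr]; split => //; exact: sub.
have [nS|] := pselect ((G c `\` \bigcup_i S c i) x).
  by apply: nr; exists (pickle c) => //; rewrite /rest pickleK rL.
move=> /not_andP[//|/contrapT[i _ Sx]].
have rLc : row_free (LL c) by [].
have Wx : W (pickle (c, i, k)) x by rewrite /W pickleK rLc; split; [exact: Sx|exact: hk].
by move: (pickle _) Wx => j Wx; apply: nW; exists j.
Qed.

(** Lipschitz extension covers the pieces with Lipschitz images, whose union is
    Borel; absolute continuity holds on each piece. *)
Theorem sufficiency :
  {ae mu, forall x : 'rV[R]_d,
     (0 < upper_density n mu x)%E /\ (lower_density n mu x < +oo)%E} ->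
  {ae mu, forall x : 'rV[R]_d,
     exists2 V, grassmannian (d - n) V &
     exists alpha : R, 0 < alpha < 1 /\
       (conical_energy n mu p x V alpha 1 < +oo)%E} ->
  rectifiable_measure n mu.
Proof.
move=> dens en; have [W [gW nW]] := graph_decomposition dens en.
have [lam [lamB _]] := lebesgue_rV_exists R n.
split.
  move=> A nA B mB BA; apply: measure_negligible => //.
  have cB := hausdorff_content_zero n0 (nA B mB BA).
  apply: (negligibleS _ (negligibleU nW (negligible_bigcup (F := fun j => B `&` W j) _))).
    move=> x Bx; have [[j _ Wx]|nx] := pselect ((\bigcup_j W j) x); last by left.
    by right; exists j.
  move=> j; have [L [kappa [k [k0 h1 h2]]]] := gW j.
  apply: (graph_content_negligible (L := L) (kappa := kappa) k0 _ n0 lamB (k := k)).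
  - by move=> x y [_ Wx] [_ Wy]; exact: h1.
  - by apply: content_zeroS cB => x [].
  - by move=> x [_ Wx]; exact: h2.
have /choice[f hf] : forall j, exists f : 'rV[R]_n -> 'rV[R]_d,
    lipschitz_map f /\ W j `<=` range f.
  by move=> j; have [L [kappa [k [k0 h1 _]]]] := gW j; exact: (graph_lipschitz k0 h1).
have mf : measurable (\bigcup_j range (f j) : set (borel_rV R d)).
  by apply: bigcupT_measurable => j; apply: measurable_range_lipschitz => //; case: (hf j).
exists (\bigcup_j range (f j)); split.
  split => //; exists f; split; first by move=> j; case: (hf j).
  rewrite setDv; apply: content_zero_hausdorff => // e e0.
  exists (fun=> 0), (fun=> 0); split => // k.
  by rewrite big1 ?ltW// => i _; rewrite expr0n gtn_eqF.
apply/negligibleP; first exact: measurableC.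
apply: negligibleS nW => x nx [j _ Wx]; apply: nx; exists j => //.
by have [_] := hf j; exact.
Qed.

End sufficiency.

(** * Upper densities and finiteness of the energy *)
Section upper_density.
Variables (R : realType) (n d : nat) (mu : {measure set (borel_rV R d) -> \bar R}).
Hypotheses (n0 : (0 < n)%N) (mu_lf : locally_finite mu).
Hypothesis dom : mu `<< @hausdorff_measure R d n.

(** Disjoint balls of density at least [M] inside a bounded set have total content
    at most a constant over [M]; enlarged, they cover. *)
Lemma infinite_density_negligible : mu.-negligible [set x | forall M : nat,
  forall delta, 0 < delta -> exists2 r, 0 < r < delta & ((M%:R * r ^+ n)%:E < mu (eball x r))%E].
Proof.
apply: negligible_bounded => N; set P := _ `&` _.
apply: (content_zero_negligible n0 dom) => e e0.
pose U := ball (0 : 'rV[R]_d) N.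
have oU : open U by exact: ball_open.
have muU : mu U \is a fin_num by rewrite ge0_fin_numE// mu_lf.
have D0 : 0 < 5 ^+ n :> R by rewrite exprn_gt0.
have u0 : 0 <= fine (mu U) by rewrite fine_ge0.
have [M hM] : exists M : nat, 5 ^+ n * (fine (mu U) / M.+1%:R) <= e.
  have c0 : 0 <= 5 ^+ n * fine (mu U) / e by rewrite divr_ge0 ?mulr_ge0// ltW.
  exists (Num.bound (5 ^+ n * fine (mu U) / e)).
  rewrite mulrA ler_pdivrMr// -ler_pdivrMl// [leLHS]mulrC.
  by rewrite (le_trans (ltW (archi_boundP c0)))// ler_nat.
pose Q x (r : R) := ((M.+1%:R * r ^+ n)%:E < mu (ball x r))%E.
have fine_radii x : P x -> forall e : R, 0 < e -> exists r, 0 < r < e /\ Q x r.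
  move=> [hx _] e1 e10; have [r re hr] := hx M.+1 _ e10; exists r; split => //.
  apply: (lt_le_trans hr); apply: le_measure; rewrite ?inE.
  - by apply: measurable_open_rV; exact: open_eball.
  - by apply: measurable_open_rV; exact: ball_open.
  - exact: eball_ball.
have PU : P `<=` U by exact: subIsetr.
have [c [s [h1 h2 h3 h4]]] := vitali_open oU PU ltr01 fine_radii.
have s0 i : 0 <= s i by have [->|[_ /andP[/ltW]]] := h1 i.
exists c, (fun i => 5 * s i); split => // [i|k]; first by rewrite mulr_ge0.
apply: le_trans hM; under eq_bigr do rewrite exprMn.
rewrite -mulr_sumr ler_pM2l// ler_pdivlMr// mulrC mulr_sumr.
pose B i : set (borel_rV R d) := ball (c i) (s i).
have mB i : measurable (B i) by apply: measurable_open_rV; exact: ball_open.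
rewrite -lee_fin fineK// -sumEFin.
apply: (@le_trans _ _ (\sum_(i < k) mu (B i))%E).
  apply: lee_sum => i _; have [->|[_ _ /ltW//]] := h1 i.
  by rewrite expr0n gtn_eqF// mulr0.
rewrite -(big_mkord xpredT (fun i => mu (B i))).
apply: le_trans (nneseries_lim_ge k _) _; first by [].
rewrite -measure_semi_bigcup//; last exact: bigcupT_measurable.
apply: le_measure; rewrite ?inE//; first exact: bigcupT_measurable.
exact: measurable_open_rV.
Qed.

(** Local finiteness takes care of the radii bounded away from 0. *)
Lemma upper_bound_ae : mu.-negligible [set x | ~ exists M : R,
  forall r, 0 < r <= 1 -> (mu (eball x r) <= (M * r ^+ n)%:E)%E].
Proof.
apply: (negligibleS _ infinite_density_negligible) => x nx M delta delta0.
apply: contrapT => nr; apply: nx.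
have fin : mu (eball x 1) \is a fin_num.
  rewrite ge0_fin_numE// (le_lt_trans _ (mu_lf (`|x| + 1)))//; apply: le_measure; rewrite ?inE.
  - by apply: measurable_open_rV; exact: open_eball.
  - by apply: measurable_open_rV; exact: ball_open.
  - move=> y /eball_ball; rewrite !ball_rV/= sub0r normrN => xy.
    by rewrite -(subrK x y) (le_lt_trans (ler_normD _ _))// addrC ltrD2l distrC.
have m0 : 0 <= fine (mu (eball x 1)) by rewrite fine_ge0.
have dn : 0 < delta ^+ n by rewrite exprn_gt0.
exists (M%:R + fine (mu (eball x 1)) / delta ^+ n).
move=> r /andP[r0 r1]; have rn : 0 <= r ^+ n by rewrite exprn_ge0// ltW.
have [rd|rd] := ltP r delta.
  rewrite leNgt; apply/negP => h; apply: nr; exists r; first by rewrite r0.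
  apply: le_lt_trans h; rewrite lee_fin ler_wpM2r// lerDl.
  by rewrite divr_ge0// ltW.
apply: (@le_trans _ _ (mu (eball x 1))).
  apply: le_measure; rewrite ?inE; try by apply: measurable_open_rV; exact: open_eball.
  by move=> y; rewrite /eball/= => /lt_le_trans; apply.
rewrite -(fineK fin) lee_fin.
apply: (@le_trans _ _ (fine (mu (eball x 1)) / delta ^+ n * r ^+ n)).
  rewrite -[leLHS]mulr1 -mulrA ler_wpM2l// ler_pdivlMl// mulr1.
  by apply: lerXn2r; rewrite ?nnegrE ?(ltW r0) ?(ltW delta0).
by rewrite ler_wpM2r// lerDr.
Qed.

End upper_density.

Lemma nneseries_ge_term (R : realType) (u : nat -> \bar R) (k : nat) :
  (forall i, 0 <= u i)%E -> (u k <= \sum_(0 <= i <oo) u i)%E.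
Proof.
move=> u0; apply: (le_trans _ (nneseries_lim_ge k.+1 _)) => //.
by rewrite big_nat_recr//= leeDr// sume_ge0.
Qed.

Section energy_finite.
Variables (R : realType) (d n : nat) (mu : {measure set (borel_rV R d) -> \bar R}).
Variable (T : R -> set 'rV[R]_d) (p M : R).
Hypothesis p1 : 1 <= p.
Hypothesis T_nd : forall r s, r <= s -> T r `<=` T s.
Hypothesis T_open : forall r, open (T r).
Hypothesis T_le : forall r, 0 < r <= 1 -> (mu (T r) <= (M * r ^+ n)%:E)%E.

Let I (k : nat) : set (measurableTypeR R) := `](2 ^+ k.+1)^-1, (2 ^+ k)^-1]%classic.

(** The density bound [M] turns the exponent [p] into 1 at the price of a factor
    [M ^ (p - 1)]; the integrand is then at most a step function, constant on the
    dyadic intervals. *)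
Lemma energy_finite :
  (\sum_(0 <= k <oo) ((2 ^+ k) ^+ n)%:E * mu (T (2 ^+ k)^-1) < +oo)%E ->
  (\int[lebesgue_measure]_(r in `]0%R, 1%R[)
     ((mu (T r) * ((r ^+ n)^-1)%:E) `^ p * (r^-1)%:E) < +oo)%E.
Proof.
move=> fin.
pose C : R := M `^ (p - 1) * 2 ^+ n.
have C0 : 0 <= C by rewrite mulr_ge0 ?powR_ge0 ?exprn_ge0.
pose w k : \bar R := (((2 ^+ k) ^+ n)%:E * mu (T (2 ^+ k)^-1))%E.
have w0 k : (0 <= w k)%E by rewrite mule_ge0// lee_fin !exprn_ge0.
pose h k r : \bar R := ((C * 2 ^+ k.+1)%:E * w k * (\1_(I k) r)%:E)%E.
have c0 k : (0 <= (C * 2 ^+ k.+1)%:E * w k)%E.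
  by rewrite mule_ge0// lee_fin mulr_ge0// exprn_ge0.
have h0 k r : (0 <= h k r)%E by rewrite mule_ge0// lee_fin.
have mI k : measurable (I k) by exact: measurable_itv.
have mh k : measurable_fun setT (h k).
  by apply: measurable_funeM; apply/measurable_EFinP; exact: measurable_indic.
have hint k : (\int[lebesgue_measure]_r h k r = C%:E * w k)%E.
  rewrite ge0_integralZl//; last by apply/measurable_EFinP; exact: measurable_indic.
  have p2 : 0 < 2 ^+ k :> R by rewrite exprn_gt0.
  have lI : lebesgue_measure (I k : set (measurableTypeR R)) = ((2 ^+ k.+1)^-1)%:E.
    rewrite lebesgue_measure_itv/= lte_fin ifT.
      by rewrite -EFinB exprS; congr _%:E; field; rewrite gt_eqF.
    by rewrite ltf_pV2 ?posrE ?exprn_gt0// exprS ltr_pMl// ltr1n.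
  rewrite integral_indic// setIT [X in (_ * X)%E]lI muleAC -EFinM mulfK//.
apply: (@le_lt_trans _ _ (\int[lebesgue_measure]_r \sum_(0 <= k <oo) h k r)%E); last first.
  rewrite integral_nneseries//.
  under eq_eseriesr do rewrite hint.
  by rewrite nneseriesZl// lte_mul_pinfty// ?lee_fin.
rewrite integral_mkcond; apply: ge0_le_integral_any => r _.
  by apply: erestrict_ge0 => s; rewrite /= in_itv/= => /andP[s0 _]; rewrite mule_ge0 ?poweR_ge0// lee_fin invr_ge0 ltW.
rewrite /patch; case: ifPn; last by move=> _; exact: nneseries_ge0.
rewrite inE/= in_itv/= => /andP[r0 r1].
have [k /andP[]] := scaleP r0 (ltW r1); rewrite !div1r => kr rk.
apply: le_trans (nneseries_ge_term k (fun k => h0 k r)).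
have Ir : (\1_(I k) r = 1 :> R) by rewrite indicE mem_set// /I/= in_itv/= kr.
rewrite /h Ir mule1.
have rn0 : 0 < r ^+ n by rewrite exprn_gt0.
have p2 : 0 < 2 ^+ k :> R by rewrite exprn_gt0.
have mT s : measurable (T s : set (borel_rV R d)) by exact: measurable_open_rV.
have mfin s : 0 < s <= 1 -> mu (T s) \is a fin_num.
  by move=> hs; rewrite ge0_fin_numE// (le_lt_trans (T_le hs))// ltry.
have k1 : 0 < ((2 ^+ k)^-1 : R) <= 1.
  by rewrite invr_gt0 p2 invf_le1// exprn_ege1// ler1n.
have r01 : 0 < r <= 1 by rewrite r0 ltW.
have le1 : fine (mu (T r)) <= fine (mu (T (2 ^+ k)^-1)).
  by apply: fine_le; rewrite ?mfin//; apply: le_measure; rewrite ?inE//; exact: T_nd.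
have le2 := T_le r01; move: le2 le1 (fine_ge0 (measure_ge0 mu (T r))).
have := fineK (mfin _ r01); have := fineK (mfin _ k1); rewrite /w.
set m' := fine (mu (T (2 ^+ k)^-1)); set m := fine (mu (T r)) => <- <-.
rewrite lee_fin => mM mm' m0; rewrite -[(m%:E * _)%E]EFinM poweR_EFin -!EFinM lee_fin.
pose t := m / r ^+ n; have t0 : 0 <= t by rewrite divr_ge0// ltW.
have tM : t <= M by rewrite ler_pdivrMr.
have rk2 : r^-1 <= 2 ^+ k.+1.
  by rewrite -[leRHS]invrK lef_pV2 ?posrE ?invr_gt0 ?exprn_gt0// ltW.
have p0 : 0 < p by rewrite (lt_le_trans ltr01).
rewrite -/t -(mulr_powRB1 t0 p0).
have h1 : t `^ (p - 1) <= M `^ (p - 1).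
  by apply: ge0_ler_powR; rewrite ?nnegrE ?subr_ge0// (le_trans t0).
have h2 : t <= m' * (2 ^+ k.+1) ^+ n.
  apply: ler_pM => //; first by rewrite invr_ge0 ltW.
  by rewrite -exprVn lerXn2r ?nnegrE ?invr_ge0 ?exprn_ge0// ltW.
apply: (@le_trans _ _ (m' * (2 ^+ k.+1) ^+ n * M `^ (p - 1) * 2 ^+ k.+1)).
  apply: ler_pM => //; first by rewrite mulr_ge0 ?powR_ge0.
    by rewrite invr_ge0 ltW.
  by apply: ler_pM => //; exact: powR_ge0.
rewrite /C exprS [(2 * _) ^+ n]exprMn le_eqVlt; apply/orP; left; apply/eqP.
by ring.
Qed.

End energy_finite.

(** * Degenerate points of a Lipschitz map *)

(** The same number [G.+1] of balls for all [i] makes Euclidean division a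
    numbering of the whole family. *)
Lemma content_zero_grid (R : realType) (n d : nat) (N : set 'rV[R]_d) :
  (forall e : R, 0 < e -> exists (G : nat) (c : nat -> nat -> 'rV[R]_d) (s : nat -> R),
     [/\ forall i, 0 <= s i,
         forall x, N x -> exists i g, (g < G.+1)%N /\ ball (c i g) (s i) x &
         forall k, \sum_(i < k) G.+1%:R * s i ^+ n <= e]) ->
  content_zero n N.
Proof.
move=> h e e0; have [G [c [s [s0 cov hs]]]] := h e e0.
exists (fun k => c (k %/ G.+1)%N (k %% G.+1)%N), (fun k => s (k %/ G.+1)%N); split => //.
  move=> x /cov[i [g [gG xb]]]; exists (i * G.+1 + g)%N => //.
  by rewrite divnMDl// divn_small// addn0 modnMDl modn_small.
move=> k; apply: le_trans (hs k).
rewrite -(big_mkord xpredT (fun i => s (i %/ G.+1)%N ^+ n)).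
apply: (@le_trans _ _ (\sum_(0 <= i < k * G.+1) s (i %/ G.+1)%N ^+ n)).
  rewrite [leRHS](@big_cat_nat _ _ _ k)//=; last by rewrite leq_pmulr.
  by rewrite lerDl sumr_ge0// => i _; rewrite exprn_ge0.
rewrite big_nat_mul -(big_mkord xpredT (fun i => G.+1%:R * s i ^+ n)).
apply: ler_sum => i _; rewrite mulSn (@eq_big_nat _ _ _ _ _ _ (fun=> s i ^+ n)).
  by rewrite sumr_const_nat addnK mulr_natl.
move=> j /andP[j1 j2]; rewrite (_ : (j %/ G.+1)%N = i)//.
by apply/eqP; rewrite eqn_leq -ltnS ltn_divLR// mulSn j2 leq_divRL.
Qed.

Section degenerate.
Variables (R : realType) (n d : nat) (lam : {measure set (borel_rV R n.+1) -> \bar R}).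
Hypothesis lamB : forall x r, 0 < r -> lam (ball x r) = ((2 * r) ^+ n.+1)%:E.
Variables (f : 'rV[R]_n.+1 -> 'rV[R]_d) (L : R).
Hypothesis L0 : 0 < L.
Hypothesis fL : forall x y, `|f x - f y| <= L * `|x - y|.

(** A direction of the kernel, normalised to be the graph direction of one
    coordinate. *)
Let kernel_direction (A : 'M[R]_(n.+1, d)) : ~~ row_free A ->
  exists (u : 'rV[R]_n.+1) j, [/\ u *m A = 0, u 0 j = 1 & `|u| <= 1].
Proof.
rewrite -kermx_eq0 => /rowV0Pn[v /sub_kermxP vA v0].
pose j := [arg max_(i > (ord0 : 'I_n.+1)) `|v 0 i|]%O.
have hj i : `|v 0 i| <= `|v 0 j|.
  by rewrite /j; case: arg_maxP => //= k _; apply.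
have vj : v 0 j != 0.
  apply: contra_neq v0 => vj; apply/rowP => i; rewrite mxE; apply/eqP.
  by rewrite -normr_le0 (le_trans (hj i))// vj normr0.
exists ((v 0 j)^-1 *: v), j; split.
- by rewrite -scalemxAl vA scaler0.
- by rewrite mxE mulVf.
- apply: norm_le_coord => // a i; rewrite ord1 mxE normrM normfV ler_pdivrMl ?normr_gt0//.
  by rewrite mulr1.
Qed.

Let gridpt (rho : R) (K : nat) (j : 'I_n.+1) (t : {ffun 'I_n -> 'I_(4 * K).+1}) : 'rV[R]_n.+1 :=
  \row_i (if unlift j i is Some i' then rho / K%:R * ((t i')%:R - (2 * K)%:R) else 0).

Let grid_near (rho : R) (K : nat) (j : 'I_n.+1) (w : 'rV[R]_n.+1) : 0 < rho -> (0 < K)%N ->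
  w 0 j = 0 -> `|w| <= 2 * rho -> exists t : {ffun 'I_n -> 'I_(4 * K).+1}, `|w - gridpt rho j t| <= rho / K%:R.
Proof.
move=> rho0 K0 wj wr; have KR : 0 < K%:R :> R by rewrite ltr0n.
have h0 : 0 < rho / K%:R by rewrite divr_gt0.
pose z (i' : 'I_n) := w 0 (lift j i') / (rho / K%:R) + (2 * K)%:R.
have hz i' : 0 <= z i' <= (4 * K)%:R.
  have := le_trans (coord_le_norm w 0 (lift j i')) wr; rewrite ler_norml => /andP[h1 h2].
  have e2 : 2 * rho = (2 * K)%:R * (rho / K%:R) by rewrite natrM; field; rewrite gt_eqF.
  rewrite /z; apply/andP; split.
    by rewrite -lerBlDr sub0r ler_pdivlMr// mulNr -e2.
  rewrite -lerBrDr ler_pdivrMr// -natrB; last by rewrite leq_mul2r orbT.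
  by rewrite -mulnBl -e2.
exists [ffun i' => inord (Num.truncn (z i'))].
apply: norm_le_coord => [|a i]; first exact: ltW.
rewrite ord1 !mxE; case: unliftP => [i' ->|->]; last by rewrite wj subrr normr0 ltW.
have /andP[z0 z4] := hz i'; have := truncn_itv z0 => /andP[t1 t2].
rewrite ffunE inordK; last by rewrite ltnS -(ler_nat R) (le_trans t1).
have -> : w 0 (lift j i') = rho / K%:R * (z i' - (2 * K)%:R).
  by rewrite /z addrK mulrC divfK ?gt_eqF.
rewrite -mulrBr normrM gtr0_norm// -[leRHS]mulr1 ler_pM2l//.
rewrite opprB addrA subrK ger0_norm ?subr_ge0//.
by rewrite lerBlDr addrC natr1 ltW.
Qed.

(** Near a point where the derivative is degenerate the function hardly
    depends on one coordinate, so that a grid of dimension [n] suffices. *)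
Let collapse_cover a (A : 'M[R]_(n.+1, d)) (K : nat) : frechet f a A -> ~~ row_free A -> (0 < K)%N ->
  exists2 r0, 0 < r0 & forall rho, 0 < rho < r0 ->
    exists j, forall b, ball a rho b -> exists t : {ffun 'I_n -> 'I_(4 * K).+1},
      `|f b - f (a + gridpt rho j t)| <= (3 + L) * rho / K%:R.
Proof.
move=> fA /kernel_direction[u [j [uA uj u1]]] K0; have KR : 0 < K%:R :> R by rewrite ltr0n.
have K'0 : 0 < K%:R^-1 :> R by rewrite invr_gt0.
have [r0 r00 hr] := fA _ K'0; exists (r0 / 2); first by rewrite divr_gt0.
move=> rho /andP[rho0 rr]; exists j => b; rewrite ball_rV/= => ab.
pose v := b - a; pose w := v - v 0 j *: u.
have vr : `|v| < rho by rewrite distrC.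
have wr : `|w| <= 2 * rho.
  rewrite (le_trans (ler_normB _ _))// mulr_natl mulr2n lerD ?(ltW vr)// normrZ.
  rewrite (le_trans _ (ltW vr))// -[leRHS]mulr1 ler_pM//.
  exact: coord_le_norm.
have wj : w 0 j = 0 by rewrite !mxE uj mulr1 subrr.
have [t ht] := grid_near rho0 K0 wj wr; exists t.
have h1 := hr v (lt_trans vr (lt_le_trans rr _)); have {}h1 := h1 ltac:(by rewrite ler_pdivrMr// ler_pMr//; lra).
have h2 := hr w (le_lt_trans wr _); have {}h2 := h2 ltac:(by rewrite mulrC -ltr_pdivlMr).
have h3 := fL (a + w) (a + gridpt rho j t).
have wA : w *m A = v *m A by rewrite mulmxBl -scalemxAl uA scaler0 subr0.
rewrite wA in h2; rewrite opprD addrACA subrr add0r in h3.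
have -> : b = a + v by rewrite addrC subrK.
set g := gridpt _ _ _ in ht h3 *.
rewrite (_ : f (a + v) - f (a + g) = (f (a + v) - f a - v *m A) -
   (f (a + w) - f a - v *m A) + (f (a + w) - f (a + g))); last first.
  by apply/rowP => i; rewrite !mxE; ring.
rewrite (le_trans (ler_normD _ _))//.
have h4 := ler_normB (f (a + v) - f a - v *m A) (f (a + w) - f a - v *m A).
apply: (@le_trans _ _ (K%:R^-1 * rho + K%:R^-1 * (2 * rho) + L * (rho / K%:R))).
  apply: lerD; last by rewrite (le_trans h3)// ler_pM2l.
  rewrite (le_trans h4)// lerD//; first by rewrite (le_trans h1)// ler_pM2l// ltW.
  by rewrite (le_trans h2)// ler_pM2l.
by rewrite le_eqVlt; apply/orP; left; apply/eqP; ring.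
Qed.

(** With mesh [K^-1] the image of a Vitali ball of radius [rho] is covered by a
    multiple of [K ^ n] balls of radius a multiple of [rho / K], of total content
    proportional to [rho ^ n.+1 / K]. *)
Lemma degenerate_content_zero_S (N : R) : content_zero n.+1
  (f @` ([set a | exists2 A, frechet f a A & ~~ row_free A] `&` ball 0 N)).
Proof.
apply: content_zero_grid => e e0.
set P := _ `&` _.
have [P0|/set0P[a0 Pa0]] := eqVneq P set0.
  exists 0%N, (fun _ _ => 0), (fun=> 0); split => //.
    by rewrite P0 => y [x].
  by move=> k; rewrite big1 ?ltW// => i _; rewrite expr0n mulr0.
have N0 : 0 < N.
  by case: Pa0 => _; rewrite ball_rV/=; exact: le_lt_trans.
(* [D * K^-1] bounds the content of the covering with mesh [K^-1] *)
pose B := 5 * (4 + L); have B0 : 0 < B by rewrite mulr_gt0// addr_gt0.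
pose D := (5 ^+ n * B ^+ n.+1 * N ^+ n.+1).
have D0 : 0 < D by rewrite !mulr_gt0 ?exprn_gt0.
have [k hk] := exists_invS_lt (divr_gt0 e0 D0).
pose K := k.+1; have KR : 0 < K%:R :> R by [].
have KD : D / K%:R <= e by rewrite mulrC -ler_pdivlMr// ltW.
pose G := ((4 * K).+1 ^ n)%N; have G0 : (0 < G)%N by rewrite expn_gt0.
have /choice[r0 hr0] : forall a, exists r0, P a -> 0 < r0 /\ forall rho, 0 < rho < r0 ->
    exists j, forall b, ball a rho b -> exists t : {ffun 'I_n -> 'I_(4 * K).+1},
      `|f b - f (a + gridpt rho j t)| <= (3 + L) * rho / K%:R.
  move=> a; have [[[A fA rA] _]|nP] := pselect (P a); last by exists 0.
  by have [r r0 hr] := collapse_cover fA rA (isT : (0 < K)%N); exists r => _.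
pose Q a (r : R) := 5 * r < r0 a.
have fine_radii a : P a -> forall e : R, 0 < e -> exists r, 0 < r < e /\ Q a r.
  move=> Pa e1 e10; have [r00 _] := hr0 _ Pa.
  have m0 : 0 < Num.min e1 (r0 a / 5) by rewrite lt_min e10 divr_gt0.
  have m1 : Num.min e1 (r0 a / 5) <= e1 by rewrite ge_min lexx.
  have m2 : Num.min e1 (r0 a / 5) <= r0 a / 5 by rewrite ge_min lexx orbT.
  exists (Num.min e1 (r0 a / 5) / 2); move: m0 m1 m2; set m := Num.min _ _ => m0 m1 m2.
  split; first by apply/andP; split; lra.
  rewrite /Q; lra.
have PU : P `<=` ball 0 N by exact: subIsetr.
have [c [s [h1 h2 h3 h4]]] := vitali_open (ball_open 0 N) PU ltr01 fine_radii.
have s0 i : 0 <= s i by have [->|[_ /andP[/ltW]]] := h1 i.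
have GE : G = #|{ffun 'I_n -> 'I_(4 * K).+1}| by rewrite card_ffun !card_ord.
have /choice[jj hjj] : forall i, exists j, P (c i) -> forall b, 0 < s i -> ball (c i) (5 * s i) b -> exists t : {ffun 'I_n -> 'I_(4 * K).+1},
      `|f b - f (c i + gridpt (5 * s i) j t)| <= (3 + L) * (5 * s i) / K%:R.
  move=> i; have [s00|[Pc /andP[si _] Qc]] := h1 i.
    by exists ord0 => _ b; rewrite s00 ltxx.
  have [_ /(_ (5 * s i))[|j hj]] := hr0 _ Pc; first by rewrite mulr_gt0.
  by exists j => _ b _; exact: hj.
pose T0 : {ffun 'I_n -> 'I_(4 * K).+1} := [ffun=> ord0].
exists G.-1, (fun i g => f (c i + gridpt (5 * s i) (jj i)
  (nth T0 (enum {ffun 'I_n -> 'I_(4 * K).+1}) g))), (fun i => B * s i / K%:R).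
rewrite prednK//; split.
- by move=> i; rewrite divr_ge0// mulr_ge0// ltW.
- move=> _ [b Pb <-]; have [i _ hi] := h4 _ Pb.
  have [s00|[Pc /andP[si _] _]] := h1 i; first by move: hi; rewrite s00 mulr0 ball_rV0.
  have [t ht] := hjj i Pc b si hi; exists i, (index t (enum {ffun 'I_n -> 'I_(4 * K).+1})); split.
    by rewrite GE cardE index_mem mem_enum.
  rewrite nth_index ?mem_enum// ball_rV/= distrC (le_lt_trans ht)//.
  rewrite /B ltr_pM2r ?invr_gt0// mulrA ltr_pM2r// mulrC ltr_pM2l// ltrD2r.
  by rewrite ltr_nat.
- move=> m; apply: le_trans KD.
  have hp : \sum_(i < m) s i ^+ n.+1 <= N ^+ n.+1.
    have := packing (ltn0Sn n) lamB s0 h2 (ball_open 0 N) h3.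
    move=> /(_ ((2 * N) ^+ n.+1) _ m); rewrite lamB// lexx => /(_ isT).
    under eq_bigr do rewrite exprMn.
    by rewrite -mulr_sumr exprMn ler_pM2l// exprn_gt0.
  rewrite -mulr_sumr.
  under eq_bigr do rewrite mulrAC exprMn.
  rewrite -mulr_sumr mulrA.
  apply: (@le_trans _ _ (5 ^+ n * K%:R ^+ n * (B / K%:R) ^+ n.+1 * N ^+ n.+1)).
    apply: ler_pM => //.
    + by rewrite mulr_ge0// exprn_ge0// divr_ge0// ltW.
    + by apply: sumr_ge0 => i _; rewrite exprn_ge0.
    + apply: ler_pM => //; first by rewrite exprn_ge0// divr_ge0// ltW.
      rewrite /G natrX -exprMn lerXn2r ?nnegrE ?mulr_ge0//.
      by rewrite -natrM ler_nat [leqRHS]mulSn -add1n leq_add2r.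
  rewrite /D !exprMn exprVn le_eqVlt; apply/orP; left; apply/eqP; rewrite !exprS; field.
  by rewrite expf_neq0 ?gt_eqF.
Qed.

End degenerate.

(** Sard's theorem for Lipschitz maps. *)
Lemma degenerate_content_zero (R : realType) (n d : nat)
    (lam : {measure set (borel_rV R n) -> \bar R}) (f : 'rV[R]_n -> 'rV[R]_d) (L N : R) :
  (0 < n)%N -> (forall x r, 0 < r -> lam (ball x r) = ((2 * r) ^+ n)%:E) ->
  0 < L -> (forall x y, `|f x - f y| <= L * `|x - y|) ->
  content_zero n (f @` ([set a | exists2 A, frechet f a A & ~~ row_free A] `&` ball 0 N)).
Proof. by case: n lam f => // n lam f _ lamB L0 fL; exact: (degenerate_content_zero_S lamB L0 fL). Qed.

(** * Energy along nearly affine pieces *)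
Lemma locally_finite_sigma_finite (R : realType) (d : nat)
    (m : {measure set (borel_rV R d) -> \bar R}) : locally_finite m -> sigma_finite setT m.
Proof.
move=> lf; exists (fun N : nat => ball (0 : 'rV[R]_d) N%:R); last first.
  by move=> N; split; [apply: measurable_open_rV; exact: ball_open|exact: lf].
apply/seteqP; split => // x _; exists (Num.bound `|x|) => //.
by rewrite ball_rV/= sub0r normrN archi_boundP.
Qed.

(** A geometric sum is dominated by its last term. *)
Lemma dyadic_sum_le (R : realType) (n K : nat) (Y : R) : (0 < n)%N -> 0 <= Y ->
  \sum_(k < K) (2 ^+ k) ^+ n * ((2 ^+ k : R) < Y)%R%:R <= 2 * Y ^+ n.
Proof.
move=> n0 Y0.
have geo m : \sum_(k < m.+1) (2 ^+ k) ^+ n <= 2 * (2 ^+ m) ^+ n :> R.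
  elim: m => [|m IH]; first by rewrite big_ord_recl big_ord0 addr0 expr0 expr1n mulr1 ler1n.
  rewrite big_ord_recr/= (le_trans (lerD IH (lexx _)))// [leRHS]mulr_natl mulr2n lerD2r.
  rewrite [in leRHS]exprS [leRHS]exprMn ler_wpM2r ?exprn_ge0//.
  have h2 : 1 <= 2 :> R by rewrite ler1n.
  by have := ler_weXn2l h2 n0; rewrite expr1.
elim: K => [|K IH]; first by rewrite big_ord0 mulr_ge0// exprn_ge0.
rewrite big_ord_recr/=; case: ltP => [KY|_]; last by rewrite mulr0 addr0.
apply: (@le_trans _ _ (\sum_(k < K.+1) (2 ^+ k) ^+ n)).
  rewrite big_ord_recr/= mulr1 lerD2r; apply: ler_sum => k _.
  by rewrite ler_piMr ?exprn_ge0// lern1 leq_b1.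
by rewrite (le_trans (geo K))// ler_pM2l// lerXn2r ?nnegrE ?exprn_ge0// ltW.
Qed.

Section pieces.
Variables (R : realType) (n d : nat) (lam : {measure set (borel_rV R n) -> \bar R}).
Hypothesis n0 : (0 < n)%N.
Hypothesis lamB : forall x r, 0 < r -> lam (ball x r) = ((2 * r) ^+ n)%:E.
Variable mu : {measure set (borel_rV R d) -> \bar R}.
Hypothesis mu_lf : locally_finite mu.
Variables (f : 'rV[R]_n -> 'rV[R]_d) (Lf : R).
Hypothesis L0 : 0 < Lf.
Hypothesis fL : forall x y, `|f x - f y| <= Lf * `|x - y|.

(** The base points at which [f] is nearly affine with linear part [L] at all scales
    below [m.+1%:R^-1]. The error is relative to [v *m L], the displacement in the
    tangent plane, which makes [f] bilipschitz on small pieces of this set. *)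
Definition near_affine (L : 'M[R]_(n, d)) (m : nat) (eps : R) : set 'rV[R]_n :=
  [set a | forall v, `|v| < m.+1%:R^-1 ->
    enorm (f (a + v) - f a - v *m L) <= eps * enorm (v *m L)].

Lemma closed_near_affine L m eps : closed (near_affine L m eps).
Proof.
rewrite (_ : near_affine L m eps = \bigcap_(v in [set v | `|v| < m.+1%:R^-1])
    [set a | enorm (f (a + v) - f a - v *m L) <= eps * enorm (v *m L)]).
  apply: closed_bigI => v _; apply: (@lip_closed _ _ _ (d%:R * (2 * Lf))) => a b.
  rewrite (le_trans (enorm_lip _ _))// -[leRHS]mulrA ler_wpM2l//.
  rewrite (_ : _ - _ = (f (a + v) - f (b + v)) - (f a - f b)); last first.
    by apply/rowP => i; rewrite !mxE; ring.
  rewrite (le_trans (ler_normB _ _))// -mulrA mulr_natl mulr2n lerD//.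
  by rewrite (le_trans (fL _ _))// opprD addrACA subrr addr0.
by apply/seteqP; split => a ha; [move=> v; exact: ha|move=> v hv; exact: ha].
Qed.

Variables (L : 'M[R]_(n, d)) (c : R) (m : nat) (t : R) (q : nat * 'rV[int]_n).
Hypothesis c0 : 0 < c.
Hypothesis hL : lower_bound_mx L c.
Hypothesis t01 : 0 < t <= 1.

Let piece : set 'rV[R]_n := near_affine L m (t / 4) `&` @base_ball R n (q, (2 * m).+1).

Let t0 : 0 < t. Proof. by case/andP: t01. Qed.

Let piece_dist a b : piece a -> piece b -> `|b - a| < m.+1%:R^-1.
Proof.
move=> [_ qa] [_ qb]; move: qa qb; rewrite /base_ball/= !ball_rV/= => qa qb.
rewrite (le_lt_trans (ler_distD (ratmx R q.1 q.2) _ _))// distrC.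
rewrite (lt_le_trans (ltrD qb qa))// (_ : (2 * m).+2 = (2 * m.+1)%N); last by rewrite mulnS.
by rewrite natrM invfM; set w := m.+1%:R^-1; lra.
Qed.

Let piece_affine a b : piece a -> piece b ->
  enorm (f b - f a - (b - a) *m L) <= t / 4 * enorm ((b - a) *m L).
Proof.
move=> pa pb; have := pa.1 (b - a) (piece_dist pa pb).
by rewrite [a + _]addrC subrK.
Qed.

(** The vector from [f a] to [y] is nearly orthogonal to the tangent plane, which
    contains, up to small errors, the vector from [f a] to [f b]. *)
Let cone_gap a b y : piece a -> piece b -> wcone (perp L) (f a) (1 - t) y ->
  t * enorm (f a - y) <= 4 * enorm (f b - y).
Proof.
move=> pa pb [v Lv hv]; have hab := piece_affine pa pb.
set W := (b - a) *m L in hab; set X := enorm (f a - y) in hv *; set D := enorm (f b - y).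
have hW : enorm W <= enorm (W - v).
  by apply: enorm_orth; rewrite dotp_mulmx Lv /dotp big1// => i _; rewrite [X in _ * X]mxE mulr0.
have h1 : enorm (W - v) <= D + t / 4 * enorm W + (1 - t) * X.
  rewrite (_ : W - v = (f b - y) - (f b - f a - W) + (y - f a - v)); last first.
    by apply/rowP => i; rewrite !mxE; ring.
  rewrite (le_trans (enormD _ _))// lerD ?(ltW hv)//.
  by rewrite (le_trans (enormD _ _))// enormN lerD.
have h2 : X <= D + (1 + t / 4) * enorm W.
  have := enormD (f b - f a - W) W; rewrite subrK (enormBC (f b)) => hba.
  by have := enorm_dist (f b) (f a) y; rewrite -/X -/D; lra.
have W0 := enorm_ge0 W; have D0 := enorm_ge0 (f b - y); have X0 := enorm_ge0 (f a - y).
rewrite -/X in X0; rewrite -/D in D0; case/andP: t01 => _ t1.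
have h3 : (1 - t / 4) * enorm W <= D + (1 - t) * X by lra.
have t2 : 0 <= 1 - t / 2 by lra.
have h4 := ler_wpM2l t2 h2.
have h5 : (1 - t / 2) * ((1 + t / 4) * enorm W) <= (1 - t / 4) * enorm W.
  rewrite mulrA ler_wpM2r//.
  have := sqr_ge0 t; rewrite expr2 => tt; lra.
have t0' := t0; have h6 : (1 - t / 2) * D <= D by rewrite ler_piMl//; lra.
lra.
Qed.

Let piece_lower a b : piece a -> piece b -> c * `|b - a| <= 2 * enorm (f b - f a).
Proof.
move=> pa pb; have hab := piece_affine pa pb.
have h1 := hL (b - a); have h2 := ler_wpM2l (ltW c0) (norm_le_enorm (b - a)).
set W := (b - a) *m L in hab h1.
have h3 : enorm W <= enorm (f b - f a) + enorm (f b - f a - W).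
  rewrite -[enorm (_ - W)]enormN -[X in enorm X <= _](subKr (f b - f a)).
  exact: enormD.
case/andP: t01 => _ t1; have W0 := enorm_ge0 W.
have h4 : t / 4 * enorm W <= 1 / 4 * enorm W by rewrite ler_wpM2r//; lra.
lra.
Qed.

Let CC k a := wcone (perp L) (f a) (1 - t) `&` eball (f a) (2 ^+ k)^-1.
Let Z k : set (borel_rV R n * borel_rV R d) := [set z | piece z.1 /\ CC k z.1 z.2].
Let S (z : borel_rV R n * borel_rV R d) : \bar R :=
  (\sum_(0 <= k <oo) ((2 ^+ k) ^+ n)%:E * (\1_(Z k) z)%:E)%E.

Let mpiece : measurable (piece : set (borel_rV R n)).
Proof.
apply: measurableI; first by apply: measurable_closed_rV; exact: closed_near_affine.
by apply: measurable_open_rV; exact: ball_open.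
Qed.

Let mZ k : measurable (Z k).
Proof.
rewrite (_ : Z k = (piece `*` setT) `&` [set z | CC k z.1 z.2]); last first.
  by apply/seteqP; split => [z [? ?]|z [[? _] ?]].
apply: measurableI; first exact: measurableX.
apply: (@measurable_prod_base _ _ (borel_rV R n) (borel_rV R d) _ _
  (@base_ball R n) (@base_ball R d)).
- by move=> i; apply: measurable_open_rV; exact: ball_open.
- by move=> i; apply: measurable_open_rV; exact: ball_open.
move=> a0 y0 [/= [v Lv hv] hr]; rewrite /eball/= in hr.
set r := (2 ^+ k)^-1 in hr.
pose X0 := enorm (f a0 - y0).
pose e1 := Num.min ((1 - t) * X0 - enorm (y0 - f a0 - v)) (r - X0).
have e10 : 0 < e1 by rewrite lt_min !subr_gt0 hv hr.
pose D : R := 2 * d.+1%:R * (Lf + 1).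
have D0 : 0 < D by rewrite !mulr_gt0// addr_gt0.
have e0 : 0 < e1 / D by rewrite divr_gt0.
have [i [ia i_sub]] := base_ballP (ball_open a0 (e1 / D)) (ballxx a0 e0).
have [j [jy j_sub]] := base_ballP (ball_open y0 (e1 / D)) (ballxx y0 e0).
exists i, j; split => // -[a y] [/= /i_sub ha /j_sub hy].
move: ha hy; rewrite !ball_rV/= => ha hy.
have p1 : enorm ((f a0 - y0) - (f a - y)) <= e1 / 2.
  apply: (le_trans (enorm_le_norm _)).
  apply: (@le_trans _ _ (d.+1%:R * ((Lf + 1) * (e1 / D)))).
    apply: ler_pM => //; first by rewrite ler_nat.
    rewrite (_ : _ - _ = (f a0 - f a) - (y0 - y)); last first.
      by apply/rowP => l; rewrite !mxE; ring.
    rewrite (le_trans (ler_normB _ _))// mulrDl mul1r lerD ?(ltW hy)//.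
    by rewrite (le_trans (fL _ _))// ler_pM2l// ltW.
  rewrite /D le_eqVlt; apply/orP; left; apply/eqP; field.
  by rewrite gt_eqF ?addr_gt0//= -[0](natrD _ 0 0) ?gt_eqF.
have m1 : e1 <= (1 - t) * X0 - enorm (y0 - f a0 - v) by rewrite ge_min lexx.
have m2 : e1 <= r - X0 by rewrite ge_min lexx orbT.
have p2 : X0 <= enorm (f a - y) + e1 / 2.
  by have := enorm_lerB (f a0 - y0) (f a - y); rewrite -/X0; lra.
have p3 : enorm (f a - y) <= X0 + e1 / 2.
  by have := enorm_lerB (f a - y) (f a0 - y0); rewrite (enormBC (f a - y)) -/X0; lra.
split; last by rewrite /eball/= -/r; lra.
exists v => //.
have p4 : enorm (y - f a - v) <= enorm (y0 - f a0 - v) + e1 / 2.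
  rewrite (_ : y - f a - v = (y0 - f a0 - v) + ((f a0 - y0) - (f a - y))); last first.
    by apply/rowP => l; rewrite !mxE; ring.
  by rewrite (le_trans (enormD _ _))// lerD2l.
case/andP: t01 => _ t1; have u0 : 0 <= 1 - t by lra.
have p5 := ler_wpM2l u0 p2.
have p6 : 0 < t * (e1 / 2) by rewrite mulr_gt0// divr_gt0.
lra.
Qed.

Let S0 z : (0 <= S z)%E.
Proof. by apply: nneseries_ge0 => k _ _; rewrite mule_ge0// lee_fin !exprn_ge0. Qed.

Let mS : measurable_fun setT S.
Proof.
apply: ge0_emeasurable_sum => [k z _ _|k _].
  by rewrite mule_ge0// lee_fin !exprn_ge0.
apply: measurable_funeM; apply/measurable_EFinP.
by apply: measurable_indic; exact: mZ.
Qed.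

(** For a fixed [y] the contributing scales are those above the distance [rho]
    from [y] to the image, and the contributing parameters lie in a ball of
    radius comparable to [rho]. *)
Let fibre_bound : exists (C N : R), 0 <= C /\ forall y,
  (\int[lam]_a S (a, y) <= C%:E * (\1_(ball (0 : 'rV[R]_d) N) y)%:E)%E.
Proof.
pose C1 := 2 / c * (4 / t + 2).
have C10 : 0 < C1 by rewrite mulr_gt0 ?divr_gt0// addr_gt0// divr_gt0.
pose x0 := ratmx R q.1 q.2; pose N := 1 + Lf + `|f x0|.
exists (2 * (8 * C1 / t) ^+ n), N; split.
  by rewrite mulr_ge0// exprn_ge0// divr_ge0 ?(ltW t0)// mulr_ge0// ltW.
move=> y; pose A := [set a | piece a /\ CC 0 a y].
have out a : ~ A a -> S (a, y) = 0%E.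
  move=> nA; rewrite /S eseries0// => k _ _; rewrite indicE memNset ?mule0// => -[/= pa [Ky hy]].
  apply: nA; split => //; split => //; rewrite /eball/= (lt_le_trans hy)//.
  by rewrite expr0 invr1 invf_le1 ?exprn_gt0// exprn_ege1// ler1n.
have [A0|/set0P[a0 [pa0 [Ka0 ha0]]]] := eqVneq A set0.
  rewrite (eq_integral (cst 0%E)) ?integral0 ?mule_ge0// ?lee_fin//.
    by rewrite mulr_ge0// exprn_ge0// divr_ge0 ?(ltW t0)// mulr_ge0// ltW.
  by move=> a _; rewrite out// A0.
rewrite /eball/= expr0 invr1 in ha0.
pose rho := enorm (f a0 - y).
have rho0 : 0 < rho.
  case: Ka0 => v _ /(le_lt_trans (enorm_ge0 _)); rewrite -/rho.
  case/andP: t01 => _; rewrite le_eqVlt => /orP[/eqP ->|t1]; first by rewrite subrr mul0r ltxx.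
  by rewrite pmulr_rgt0// subr_gt0.
have yN : ball (0 : 'rV[R]_d) N y.
  rewrite ball_rV/= sub0r normrN (_ : y = (f a0 - f x0) - (f a0 - y) + f x0); last first.
    by apply/rowP => i; rewrite !mxE; ring.
  rewrite (le_lt_trans (ler_normD _ _))// ltrD2r (le_lt_trans (ler_normB _ _))// addrC.
  apply: ltr_leD; first exact: (le_lt_trans (norm_le_enorm _)).
  rewrite (le_trans (fL _ _))// ler_piMr ?(ltW L0)//.
  have [_] := pa0; rewrite /base_ball/= ball_rV/= distrC => /ltW /le_trans; apply.
  by rewrite invf_le1// ler1n.
rewrite indicE mem_set// mule1.
have bound a : (S (a, y) <= (2 * (4 / (t * rho)) ^+ n)%:E * (\1_(ball a0 (C1 * rho)) a)%:E)%E.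
  have E0 : 0 <= 4 / (t * rho) by rewrite divr_ge0// mulr_ge0// ltW.
  have [[pa [Ka _]]|/out->] := pselect (A a); last first.
    by rewrite mule_ge0// lee_fin// mulr_ge0// exprn_ge0.
  have g1 := cone_gap pa pa0 Ka; have g2 := cone_gap pa0 pa Ka0.
  rewrite -/rho in g1 g2; pose X := enorm (f a - y); rewrite -/X in g1 g2.
  have X0 : 0 < X.
    by rewrite -(pmulr_rgt0 _ (ltr0Sn R 3)) (lt_le_trans _ g2)// mulr_gt0.
  have aB : ball a0 (C1 * rho) a.
    rewrite ball_rV/= distrC -(ltr_pM2l c0) (le_lt_trans (piece_lower pa0 pa))//.
    apply: (@le_lt_trans _ _ (2 * (X + rho))).
      by rewrite ler_pM2l// (le_trans (enorm_dist y _ _))// (enormBC y).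
    rewrite /C1 (_ : c * (2 / c * (4 / t + 2) * rho) = 2 * (4 / t * rho + 2 * rho)).
      rewrite ltr_pM2l// ler_ltD//; last by rewrite ltr_pMl// ltr1n.
      by rewrite mulrAC ler_pdivlMr// mulrC.
    by field; rewrite !gt_eqF.
  rewrite indicE mem_set// mule1.
  have -> : S (a, y) = (\sum_(0 <= k <oo) ((2 ^+ k) ^+ n * ((2 ^+ k : R) < X^-1)%R%:R)%:E)%E.
    apply: eq_eseriesr => k _; rewrite EFinM; congr (_ * _)%E; congr _%:E.
    rewrite indicE; congr ((nat_of_bool _)%:R); apply/idP/idP => [|h].
      rewrite inE => -[_ [_]]; rewrite /eball/= -/X => h.
      by rewrite -[ltLHS]invrK ltf_pV2 ?posrE ?invr_gt0 ?exprn_gt0.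
    rewrite inE; split => //; split => //; rewrite /eball/= -/X.
    by rewrite -[X]invrK ltf_pV2 ?posrE ?invr_gt0 ?exprn_gt0.
  apply: nneseries_le_partial => [k|K]; first by rewrite mulr_ge0// !exprn_ge0.
  rewrite (le_trans (dyadic_sum_le _ n0 _)) ?invr_ge0 ?(ltW X0)//.
  rewrite ler_pM2l// lerXn2r ?nnegrE ?invr_ge0 ?(ltW X0)//.
  rewrite ler_pdivlMr ?mulr_gt0// mulrC ler_pdivrMr//.
have mB : measurable (ball a0 (C1 * rho) : set (borel_rV R n)).
  by apply: measurable_open_rV; exact: ball_open.
apply: (@le_trans _ _
    (\int[lam]_a ((2 * (4 / (t * rho)) ^+ n)%:E * (\1_(ball a0 (C1 * rho)) a)%:E))%E).
  by apply: ge0_le_integral_any => a _; [exact: S0|exact: bound].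
have E0 : 0 <= 2 * (4 / (t * rho)) ^+ n.
  by rewrite mulr_ge0// exprn_ge0// divr_ge0// mulr_ge0// ltW.
rewrite ge0_integralZl//; last by apply/measurable_EFinP; exact: measurable_indic.
have B0 : 0 < C1 * rho by exact: mulr_gt0.
rewrite integral_indic// setIT lamB// -EFinM lee_fin.
rewrite -[leLHS]mulrA -[X in _ * X <= _]exprMn le_eqVlt; apply/orP; left; apply/eqP; congr (_ * _ ^+ _).
by field; rewrite !gt_eqF.
Qed.

(** Tonelli's theorem: integrated over [a], the sums amount to the integral over
    [y] of the fibre bound, which is finite because [mu] is locally finite. *)
Lemma piece_finite : lam.-negligible [set a | piece a /\
  ~ (\sum_(0 <= k <oo) ((2 ^+ k) ^+ n)%:E * mu (CC k a) < +oo)%E].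
Proof.
pose sl := locally_finite_sigma_finite (lam_locally_finite lamB).
pose sm := locally_finite_sigma_finite mu_lf.
have [C [N [C0 hC]]] := fibre_bound.
have mB : measurable (ball (0 : 'rV[R]_d) N : set (borel_rV R d)).
  by apply: measurable_open_rV; exact: ball_open.
pose G := fubini_F (sf_measure sm) S.
have mG : measurable_fun setT G by exact: measurable_fun_fubini_tonelli_F.
have G0 a : (0 <= G a)%E by apply: integral_ge0 => y _.
have Gfin : (\int[lam]_a G a < +oo)%E.
  have -> : (\int[lam]_a G a = \int[mu]_y \int[lam]_a S (a, y))%E.
    exact: (@fubini_tonelli _ _ _ _ _ (sf_measure sl) (sf_measure sm)).
  apply: (@le_lt_trans _ _ (\int[mu]_y (C%:E * (\1_(ball (0 : 'rV[R]_d) N) y)%:E))%E).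
    apply: ge0_le_integral_any => y _; last exact: hC.
    by apply: integral_ge0.
  rewrite ge0_integralZl//; last by apply/measurable_EFinP; exact: measurable_indic.
  by rewrite integral_indic// setIT lte_mul_pinfty// ?lee_fin// mu_lf.
have iG : lam.-integrable setT G.
  apply/integrableP; split => //.
  by under eq_integral do rewrite gee0_abs//.
apply: negligibleS (integrable_ae measurableT iG) => a [pa nfin] /= /(_ Logic.I) h.
apply: nfin; move: h; rewrite ge0_fin_numE//.
suff -> : G a = (\sum_(0 <= k <oo) ((2 ^+ k) ^+ n)%:E * mu (CC k a))%E by [].
have mCC k : measurable (CC k a : set (borel_rV R d)).
  apply: measurable_open_rV; apply: openI; last exact: open_eball.
  by apply: open_wcone; case/andP: t01 => _; rewrite subr_ge0.
have SE y : S (a, y) = (\sum_(0 <= k <oo) ((2 ^+ k) ^+ n)%:E * (\1_(CC k a) y)%:E)%E.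
  apply: eq_eseriesr => k _; rewrite !indicE; congr (_ * (nat_of_bool _)%:R%:E)%E.
  by apply/idP/idP; rewrite !inE => //= -[].
have mI k : measurable_fun setT (fun y : borel_rV R d => (\1_(CC k a) y)%:E).
  by apply/measurable_EFinP; exact: measurable_indic.
rewrite /G /fubini_F/=; under eq_integral do rewrite SE.
rewrite integral_nneseries//.
- apply: eq_eseriesr => k _; rewrite ge0_integralZl ?lee_fin ?exprn_ge0//.
  by rewrite integral_indic// setIT.
- by move=> k; exact: measurable_funeM.
Qed.

End pieces.

(** * Necessity *)
Lemma lipschitz_map_norm (R : realType) (n d : nat) (f : 'rV[R]_n -> 'rV[R]_d) :
  lipschitz_map f -> exists2 L, 0 < L & forall x y, `|f x - f y| <= L * `|x - y|.
Proof.
move=> [L fL]; exists ((`|L| + 1) * n.+1%:R); first by rewrite mulr_gt0// ltr_wpDl.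
move=> x y; rewrite (le_trans (norm_le_enorm _))// (le_trans (fL _ _))// -mulrA.
apply: (@le_trans _ _ ((`|L| + 1) * enorm (x - y))).
  by rewrite ler_wpM2r// (le_trans (ler_norm _))// lerDl.
rewrite ler_wpM2l ?addr_ge0// (le_trans (enorm_le_norm _))//.
by rewrite ler_wpM2r// ler_nat.
Qed.

(** Both the error of differentiability and that of replacing [A] by [L] are
    absorbed by the lower bound of [L]. *)
Lemma frechet_near_affine (R : realType) (n d : nat) (f : 'rV[R]_n -> 'rV[R]_d) a
    (A L : 'M[R]_(n, d)) c eps : 0 < c -> 0 < eps -> frechet f a A -> lower_bound_mx L c ->
  mxsum (A - L) <= eps * c / 2 -> exists m, near_affine f L m eps a.
Proof.
move=> c0 eps0 fA hL AL.
have e0 : 0 < eps * c / (2 * d.+1%:R) by rewrite divr_gt0 ?mulr_gt0.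
have [r r0 hr] := fA _ e0; have [m mr] := exists_invS_lt r0.
exists m => v vm; have hv := hr v (lt_trans vm mr).
have h1 : eps * c * enorm v <= eps * enorm (v *m L) by rewrite -mulrA ler_pM2l.
apply: (le_trans _ h1).
rewrite (_ : _ - _ - _ = (f (a + v) - f a - v *m A) + v *m (A - L)); last first.
  by rewrite mulmxBr addrA subrK.
rewrite (le_trans (enormD _ _))//.
have h2 := le_trans (enorm_mulmx v (A - L)) (ler_wpM2r (enorm_ge0 v) AL).
have h3 : enorm (f (a + v) - f a - v *m A) <= eps * c / 2 * enorm v.
  rewrite (le_trans (enorm_le_norm _))//.
  apply: (@le_trans _ _ (d.+1%:R * (eps * c / (2 * d.+1%:R) * `|v|))).
    by apply: ler_pM => //; rewrite ler_nat.
  have D0 : d.+1%:R != 0 :> R by rewrite pnatr_eq0.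
  move: (d.+1%:R) D0 => D D0; rewrite (_ : D * _ = eps * c / 2 * `|v|); last by field.
  by rewrite ler_wpM2l ?norm_le_enorm// divr_ge0// mulr_ge0// ltW.
lra.
Qed.

Section necessity.
Variables (R : realType) (n d : nat) (p : R).
Hypotheses (nd : (n < d)%N) (p1 : 1 <= p).
Variable mu : {measure set (borel_rV R d) -> \bar R}.
Hypothesis mu_lf : locally_finite mu.

Let code : countType := (nat * 'M[int]_(n, d) * nat * nat * (nat * 'rV[int]_n))%type.

(** The exceptional parameters, as a countable family: a code consists of a
    rational plane, a scale, an aperture and a position. *)
Let infinite_energy (f : 'rV[R]_n -> 'rV[R]_d) (c : code) : set 'rV[R]_n :=
  let: (k, M, m, j, q) := c in let L := ratmx R k M in
  [set a | row_free L /\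
    (near_affine f L m (j.+1%:R^-1 / 4) `&` @base_ball R n (q, (2 * m).+1)) a /\
    ~ (\sum_(0 <= k <oo) ((2 ^+ k) ^+ n)%:E *
        mu (wcone (perp L) (f a) (1 - j.+1%:R^-1) `&` eball (f a) (2 ^+ k)^-1) < +oo)%E].

Let infinite_energy_negligible (lam : {measure set (borel_rV R n) -> \bar R}) f Lf c :
  (0 < n)%N -> (forall x r, 0 < r -> lam (ball x r) = ((2 * r) ^+ n)%:E) ->
  0 < Lf -> (forall x y, `|f x - f y| <= Lf * `|x - y|) ->
  lam.-negligible (infinite_energy f c).
Proof.
move=> n0 lamB L0 fL; move: c => [[[[k M] m] j] q].
have [rL|rL] := boolP (row_free (ratmx R k M)); last first.
  by apply: negligibleS (@negligible_set0 _ _ _ lam) => a [rL'] _; rewrite rL' in rL.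
have [c c0 hc] := row_free_lower rL.
have t01 : 0 < (j.+1%:R^-1 : R) <= 1 by rewrite invr_gt0 invf_le1//= ltr0n ler1n.
apply: negligibleS (piece_finite n0 lamB mu_lf L0 fL m q c0 hc t01) => a [_ [h1 h2]].
by split.
Qed.

(** The derivative determines the plane before the aperture is given. For each
    aperture, a rational plane close to it has a slightly wider cone, whose energy
    is finite because [a] is in no exceptional set. *)
Let good_point f a A M : frechet f a A -> row_free A ->
  (forall c, ~ infinite_energy f c a) ->
  (forall r, 0 < r <= 1 -> (mu (eball (f a) r) <= (M * r ^+ n)%:E)%E) ->
  exists2 V, grassmannian (d - n) V & forall alpha : R, 0 < alpha < 1 ->
    (conical_energy n mu p (f a) V alpha 1 < +oo)%E.
Proof.
move=> fA rA good hM; have [V gV VA] := perp_grassmannian (ltnW nd) rA.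
exists V => // alpha /andP[a0 a1].
have [c c0 hc] := row_free_lower rA; have c20 : 0 < c / 2 by rewrite divr_gt0.
have a1' : 0 < 1 - alpha by rewrite subr_gt0.
have [j] := exists_invS_lt a1'; have : 0 < j.+1%:R^-1 :> R by rewrite invr_gt0.
set t := j.+1%:R^-1 => t0 ta; pose s := 1 - t - alpha; have s0 : 0 < s by rewrite /s; lra.
have m0 : 0 < Num.min (t / 4 * (c / 2) / 2) (c * s / 4).
  by rewrite lt_min !divr_gt0// !mulr_gt0// ?divr_gt0.
have [k [N [hN]]] := rat_plane_approx c0 hc m0; rewrite le_min => /andP[AN1 AN2].
have t40 : 0 < t / 4 by rewrite divr_gt0.
have [m am] := frechet_near_affine c20 t40 fA hN AN1.
have r0 : 0 < (2 * m).+2%:R^-1 :> R by rewrite invr_gt0.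
have [q1 [q2 hq]] := ratmx_dense a r0.
have fin : (\sum_(0 <= k0 <oo) ((2 ^+ k0) ^+ n)%:E *
    mu (wcone (perp (ratmx R k N)) (f a) (1 - t) `&` eball (f a) (2 ^+ k0)^-1) < +oo)%E.
  apply: contrapT => nfin; apply: (good (k, N, m, j, (q1, q2))); split.
    exact: (lower_row_free c20 hN).
  by split => //; split => //; rewrite /base_ball/= ball_rV/= distrC.
have sub r : tcone (f a) V alpha r `<=`
    wcone (perp (ratmx R k N)) (f a) (1 - t) `&` eball (f a) r.
  move=> y [Ky yr]; split => //; move: Ky; rewrite coneE => /(wconeS VA (lexx alpha)).
  apply: (wcone_perturb c20 hN (ltW a0)); rewrite mxsum_tr.
  have h1 : mxsum (A - ratmx R k N) / (c / 2) <= s / 2.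
    by rewrite ler_pdivrMr// (le_trans AN2)//; lra.
  have h2 : mxsum (A - ratmx R k N) / (c / 2) * (1 + alpha) <= s / 2 * 2.
    have h0 : 0 <= mxsum (A - ratmx R k N) / (c / 2) by rewrite divr_ge0 ?mxsum_ge0 ?(ltW c20).
    by apply: ler_pM => //; lra.
  move: h2; rewrite /s; lra.
have oT r : open (tcone (f a) V alpha r).
  apply: openI; last exact: open_eball.
  by rewrite coneE; apply: open_wcone; exact: ltW.
have mE r : measurable (eball (f a) r : set (borel_rV R d)).
  by apply: measurable_open_rV; exact: open_eball.
have mT r : measurable (tcone (f a) V alpha r : set (borel_rV R d)) by exact: measurable_open_rV.
apply: (@energy_finite _ _ _ mu (tcone (f a) V alpha) p M p1) => //.
- by move=> r1 r2 r12 y [Ky yr]; split => //; rewrite /eball/= (lt_le_trans yr).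
- move=> r hr; apply: le_trans (hM r hr); apply: le_measure; rewrite ?inE//.
  by move=> y [].
- apply: le_lt_trans fin; apply: lee_nneseries => i *.
    by rewrite mule_ge0// lee_fin !exprn_ge0.
  apply: lee_wpmul2l; first by rewrite lee_fin !exprn_ge0.
  apply: le_measure; rewrite ?inE//; apply: measurable_open_rV; apply: openI.
    by apply: open_wcone; lra.
  exact: open_eball.
Qed.

(** Almost every point is the image [f i a] of a point
    where [f i] has a nondegenerate derivative and which is in no exceptional set:
    Lipschitz maps send null sets to sets of zero content, and absolute continuity
    makes those negligible. *)
Theorem necessity : (0 < n)%N -> rectifiable_measure n mu ->
  {ae mu, forall x : 'rV[R]_d, exists2 V, grassmannian (d - n) V &
     forall alpha : R, 0 < alpha < 1 -> (conical_energy n mu p x V alpha 1 < +oo)%E}.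
Proof.
move=> n0 [dom [E [[mE [f [fLip HE]]] muE]]].
have [lam [lamB lamS]] := lebesgue_rV_exists R n.
have negl N : content_zero n N -> mu.-negligible N by exact: content_zero_negligible.
have n1 : mu.-negligible (~` E) by apply/negligibleP => //; exact: measurableC.
have n2 : mu.-negligible (E `\` \bigcup_i range (f i)).
  by apply: negl; exact: hausdorff_content_zero.
have n3 := upper_bound_ae n0 mu_lf dom.
have n4 i : mu.-negligible (f i @` [set a | ~ exists A, frechet (f i) a A]).
  have [Lf L0 fL] := lipschitz_map_norm (fLip i); apply: negl.
  apply: (lipschitz_content_zero n0 lamB L0 fL).
  exact: (rademacher n0 lamB lamS L0 fL).
have n5 i : mu.-negligible (f i @` [set a | exists2 A, frechet (f i) a A & ~~ row_free A]).
  have [Lf L0 fL] := lipschitz_map_norm (fLip i).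
  pose F (N : nat) : set (borel_rV R d) :=
    f i @` ([set a | exists2 A, frechet (f i) a A & ~~ row_free A] `&` ball 0 N%:R).
  have nF N : mu.-negligible (F N).
    by apply: negl; exact: (degenerate_content_zero N%:R n0 lamB L0 fL).
  apply: negligibleS (negligible_bigcup nF) => _ [a ha <-].
  exists (Num.bound `|a|) => //; exists a => //; split => //.
  by rewrite ball_rV/= sub0r normrN archi_boundP.
have n6 i j : mu.-negligible (if unpickle j is Some c then f i @` infinite_energy (f i) c else set0).
  case: (unpickle j) => [c|]; last exact: negligible_set0.
  have [Lf L0 fL] := lipschitz_map_norm (fLip i); apply: negl.
  by apply: (lipschitz_content_zero n0 lamB L0 fL); exact: (infinite_energy_negligible c n0 lamB L0 fL).
apply: negligibleS (negligibleU (negligibleU (negligibleU n1 n2) n3)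
  (negligibleU (negligibleU (negligible_bigcup n4) (negligible_bigcup n5))
     (negligible_bigcup (fun i => negligible_bigcup (n6 i))))) => x bad.
apply: contrapT => /not_orP[/not_orP[/not_orP[/contrapT Ex nx] /contrapT[M hM]]].
move=> /not_orP[/not_orP[m4 m5] m6].
have [[i _ [a _ fa]]|nr] := pselect ((\bigcup_i range (f i)) x); last by apply: nx.
apply: bad; rewrite -fa in hM *.
have [A fA] : exists A, frechet (f i) a A.
  by apply: contrapT => nA; apply: m4; exists i => //; exists a.
apply: (good_point fA _ _ hM).
  by apply/negPn/negP => rA; apply: m5; exists i => //; exists a => //; exists A.
move=> c hc; apply: m6; exists i => //; have := pickleK c; move: (pickle c) => k ck.
by exists k => //; rewrite ck; exists a.
Qed.

End necessity.

(** * The characterization *)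

Unset Implicit Arguments.

Theorem theorem1p4 (R : realType) (n d : nat) (p : R)
    (n_gt0 : (0 < n)%N) (n_lt_d : (n < d)%N) (p_ge1 : 1 <= p) :
  (forall mu : {measure set (borel_rV R d) -> \bar R},
     radon mu ->
     {ae mu, forall x : 'rV[R]_d,
        (0 < upper_density n mu x)%E /\ (lower_density n mu x < +oo)%E} ->
     {ae mu, forall x : 'rV[R]_d,
        exists2 V, grassmannian (d - n) V &
        exists alpha : R, 0 < alpha < 1 /\
          (conical_energy n mu p x V alpha 1 < +oo)%E} ->
     rectifiable_measure n mu)
  /\
  (forall mu : {measure set (borel_rV R d) -> \bar R},
     radon mu -> rectifiable_measure n mu ->
     {ae mu, forall x : 'rV[R]_d,
        exists2 V, grassmannian (d - n) V &
        forall alpha : R, 0 < alpha < 1 ->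
          (conical_energy n mu p x V alpha 1 < +oo)%E}).
Proof.
have d_gt0 := ltn_trans n_gt0 n_lt_d; have p_gt0 := lt_le_trans ltr01 p_ge1.
split=> [mu radon_mu|mu radon_mu rect].
  exact: (sufficiency n_gt0 n_lt_d p_gt0 (radon_locally_finite d_gt0 radon_mu)).
exact: (necessity n_lt_d p_ge1 (radon_locally_finite d_gt0 radon_mu) n_gt0 rect).
Qed.
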